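(* Assume that the rates $(c_{\Delta}(\cdot, \xi_{\Delta}))_{\Delta \Subset \mathbb{Z}^d,\xi_\Delta\in \Omega_\Delta}$ of an interacting particle system satisfy conditions (R1)–(R6) listed in the context. Moreover, assume that there exists a translation-invariant time-stationary measure $\mu$ which is a Gibbs measure with respect to a specification $\gamma$ that satisfies conditions (S1)–(S4) listed in the context. Then, for any translation-invariant starting measure $\nu\in \mathcal{M}_1^{inv}(\Omega)$ and any sequence $t_n \uparrow \infty$ such that $(\nu_{t_n})_{n \in \mathbb{N}}$ converges weakly to some $\nu^*$, we have $\nu^* \in \mathscr{G}(\gamma)$.
   Context: **Configurations.** Fix $q,d\in\mathbb{N}$ and let $\Omega=\{1,\dots,q\}^{\mathbb{Z}^d}$ with the product topology and Borel $\sigma$-algebra $\mathcal F$. $\Lambda\Subset\mathbb{Z}^d$ means $\Lambda$ is a finite subset; $\Omega_\Lambda=\{1,\dots,q\}^\Lambda$; $\eta_\Lambda$ is the restriction of $\eta$ to $\Lambda$; $\eta_\Lambda\omega_\Delta$ is concatenation for disjoint $\Lambda,\Delta$. Sums $\sum_{\xi_\Delta}$ run over $\Omega_\Delta$. $\mathcal{M}_1(\Omega)$ (resp. $\mathcal{M}_1^{inv}(\Omega)$) is the set of (translation-invariant) probability measures on $\Omega$; $\nu(\eta_\Lambda):=\nu(\{\omega:\omega_\Lambda=\eta_\Lambda\})$, and $\mathbf 1_{\eta_\Lambda}$ is the indicator of this cylinder. $(\tau_x\eta)_y=\eta_{y-x}$. For $z\in\mathbb{Z}^d$, $i\in\{1,\dots,q\}$,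 $\eta^{z,i}$ equals $\eta$ except that its value at $z$ is $i$, and $\nabla_z^i f(\eta)=f(\eta^{z,i})-f(\eta)$. **Specifications.** A specification $\gamma=(\gamma_\Lambda)_{\Lambda\Subset\mathbb{Z}^d}$ is a family of probability kernels $\gamma_\Lambda$ from $\Omega_{\Lambda^c}$ to $\mathcal{M}_1(\Omega)$ that are proper ($\gamma_\Lambda(\eta_\Lambda\eta_\Delta|\eta_{\Lambda^c})=\gamma_\Lambda(\eta_\Lambda|\eta_{\Lambda^c})\mathbf 1_{\eta_\Delta}(\eta_{\Lambda^c})$ for $\Delta\subset\Lambda^c$) and consistent ($\gamma_\Lambda(\gamma_\Delta(\eta_\Delta|\cdot)|\eta_{\Lambda^c})=\gamma_\Lambda(\eta_\Delta|\eta_{\Lambda^c})$ for $\Delta\subset\Lambda\Subset\mathbb{Z}^d$). $\gamma_\Lambda(\cdot|\cdot)$ is also viewed as the function $\omega\mapsto\gamma_\Lambda(\omega_\Lambda|\omega_{\Lambda^c})$. $\mathscr G(\gamma)$ is the set of Gibbs measures: $\mu\in\mathcal{M}_1(\Omega)$ with $\mu(\gamma_\Lambda(\eta_\Lambda|\cdot))=\mu(\eta_\Lambda)$ for all $\Lambda\Subset\mathbb{Z}^d$ and $\eta_\Lambda$. **Rates and dynamics.** Rates are functions $c_\Delta(\cdot,\xi_\Delta):\Omega\to[0,\infty)$, and $\mathscr{L}f(\eta)=\sum_{\Delta\Subset\mathbb{Z}^d}\sum_{\xi_\Delta}c_\Delta(\eta,\xi_\Delta)[f(\xi_\Delta\eta_{\Delta^c})-f(\eta)]$;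 under (R1)–(R4) this (on the core of $f\in C(\Omega)$ with $\sum_x\sup_{\eta_{x^c}=\xi_{x^c}}|f(\eta)-f(\xi)|<\infty$) generates a Markov semigroup $(P_t)_{t\ge0}$ on $C(\Omega)$. $\nu_t:=\nu P_t$; $\mu$ is time-stationary if $\mu P_t=\mu$ for all $t\geq 0$. **Conditions on the rates.** (R1) Each $\eta\mapsto c_\Delta(\eta,\xi_\Delta)$ is continuous. (R2) There are at most finitely many $\Delta\ni0$ with $c_\Delta:=\sup_{\xi_\Delta}\|c_\Delta(\cdot,\xi_\Delta)\|_\infty>0$. (R3) $\sum_{z\ne0}\sum_{\Delta\ni0}\sum_{\xi_\Delta}\sum_{i=1}^q\|\nabla_z^ic_\Delta(\cdot,\xi_\Delta)\|_\infty<\infty$. (R4) $c_{\Delta+x}(\tau_x\eta,\cdot)=c_\Delta(\eta,\cdot)$ for all $x,\Delta,\eta$ (with $\Omega_{\Delta+x}$ and $\Omega_\Delta$ identified by translation). (R5) $\inf\{c_\Delta(\eta,\xi_\Delta):\Delta\Subset\mathbb{Z}^d,\xi_\Delta,\eta,\ c_\Delta(\eta,\xi_\Delta)>0\}>0$. (R6) For every $\eta\in\Omega$, $\Delta\Subset\mathbb{Z}^d$, $\xi_\Delta\in\Omega_\Delta$ there is a finite sequence $\eta^{(0)},\dots,\eta^{(n)}\in\Omega$ with $\eta^{(0)}=\eta$, $\eta^{(n)}=\xi_\Delta\eta_{\Delta^c}$ and positive transition rate from $\eta^{(i)}$ to $\eta^{(i+1)}$ for all $0\le i\le n-1$. **Conditions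 on the specification.** (S1) Quasilocal: for all $\Lambda\Subset\mathbb{Z}^d$, $\lim_{\Delta\uparrow\mathbb{Z}^d}\sup_{\eta,\xi}|\gamma_\Lambda(\eta_\Lambda|\eta_{\Delta\setminus\Lambda}\xi_{\Delta^c})-\gamma_\Lambda(\eta_\Lambda|\eta_{\Lambda^c})|=0$. (S2) Non-null: $\inf_{\eta}\gamma_{\{0\}}(\eta_0|\eta_{\{0\}^c})\ge\delta$ for some $\delta>0$. (S3) $\sum_{\Delta\ni0:\,c_\Delta>0}\sum_{z\ne0}\sum_{i=1}^q\|\nabla_z^i\gamma_\Delta(\cdot|\cdot)\|_\infty<\infty$. (S4) Translation-invariant: $\gamma_{\Lambda+x}((\tau_x\eta)_{\Lambda+x}|(\tau_x\eta)_{(\Lambda+x)^c})=\gamma_\Lambda(\eta_\Lambda|\eta_{\Lambda^c})$ for all $\Lambda,x,\eta$.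
   Formalization: Consistency of the specification is required for all events (γ_Λγ_Δ = γ_Λ as measures), not only for cylinders η_Δ over Δ as displayed; with the displayed form alone the claim fails (low-temperature Ising, γ_Λ = μ⁺ on Λ times the boundary condition). *)

(* Defs.v *)
From HB Require Import structures.
From mathcomp Require Import all_boot all_order all_algebra finmap.
From mathcomp Require Import all_classical all_reals all_analysis.

Set Implicit Arguments.
Unset Strict Implicit.
Unset Printing Implicit Defensive.

Import Order.TTheory GRing.Theory Num.Theory.
Import numFieldNormedType.Exports.

Local Open Scope classical_set_scope.
Local Open Scope ring_scope.

Notation site d := 'rV[int]_d.

(* Has exactly q elements when 0 < q; the successor form makes it a pointed
   type, as measurable structures require. *)
Notation spin q := 'I_q.-1.+1.

(* I is Z^d or the complement of a finite subset of Z^d. *)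
Definition config (q : nat) (I : Type) : Type :=
  prod_topology (fun _ : I => discrete_topology (spin q)).

HB.instance Definition _ q I := Choice.on (config q I).
HB.instance Definition _ q I :=
  isPointed.Build (config q I) (fun _ => ord0).
HB.instance Definition _ q I := Topological.on (config q I).
HB.instance Definition _ q I :=
  @isMeasurable.Build (sigma_display (@open (config q I))) (config q I)
    <<s (@open (config q I)) >> (@sigma_algebra0 _ setT open)
    (@sigma_algebraC _ open) (@sigma_algebra_bigcup _ setT open).

Section configurations.
Variables (q d : nat).
Local Notation Omega := (config q (site d)).

Definition restr (D : {fset site d}) (eta : Omega) : {ffun D -> spin q} :=
  [ffun x => eta (val x)].

Definition restrC (D : {fset site d}) (eta : Omega) :
    config q {x | x \notin D} :=
  fun x => eta (val x).
Arguments restrC : clear implicits.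

(* The configuration $\xi_\Delta \eta_{\Delta^c}$. *)
Definition glue (D : {fset site d}) (xi : {ffun D -> spin q}) (eta : Omega) :
    Omega :=
  fun x => if insub x is Some y then xi y else eta x.

Definition cyl (D : {fset site d}) (xi : {ffun D -> spin q}) : set Omega :=
  [set w | restr D w = xi].

Definition tau (x : site d) (eta : Omega) : Omega := fun y => eta (y - x).

Definition fshift (x : site d) (D : {fset site d}) : {fset site d} :=
  [fset (y + x)%R | y in D]%fset.

Definition update (z : site d) (i : spin q) (eta : Omega) : Omega :=
  fun y => if y == z then i else eta y.

End configurations.
Arguments restrC {q d} D eta.

Section observables.
Variables (R : realType) (q d : nat).
Local Notation Omega := (config q (site d)).
Implicit Type f : Omega -> R.

Definition nabla (z : site d) (i : spin q) f : Omega -> R :=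
  fun eta => f (update z i eta) - f eta.

Definition supnorm f : \bar R := ereal_sup [set `|f eta|%:E | eta in setT].

Definition osc (x : site d) f : \bar R :=
  ereal_sup [set `|f p.1 - f p.2|%:E | p in
    [set p : Omega * Omega | forall y, y != x -> p.1 y = p.2 y]].

Definition core f : Prop :=
  continuous f /\ (\esum_(x in [set: site d]) osc x f < +oo)%E.

Definition weak_cvg (nu_ : nat -> probability Omega R)
    (nu : probability Omega R) : Prop :=
  forall f, continuous f ->
    (\int[nu_ n]_w (f w)%:E)%E @[n --> \oo] --> (\int[nu]_w (f w)%:E)%E.

Definition translation_invariant (nu : probability Omega R) : Prop :=
  forall (x : site d) (A : set Omega), measurable A ->
    nu (tau x @^-1` A) = nu A.

End observables.

Section rates.
Variables (R : realType) (q d : nat).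
Local Notation Omega := (config q (site d)).

Definition rates : Type :=
  forall D : {fset site d}, Omega -> {ffun D -> spin q} -> R.

Variable c : rates.
Arguments c : clear implicits.

Definition nonneg_rates : Prop := forall D eta xi, 0 <= c D eta xi.

Definition rate_sup (D : {fset site d}) : \bar R :=
  ereal_sup [set supnorm (c D ^~ xi) | xi in setT].

Definition pos_transition (eta zeta : Omega) : Prop :=
  exists (D : {fset site d}) (xi : {ffun D -> spin q}),
    zeta = glue xi eta /\ 0 < c D eta xi.

Definition R1 : Prop := forall D xi, continuous (c D ^~ xi).

Definition R2 : Prop :=
  finite_set [set D : {fset site d} | 0 \in D /\ (0 < rate_sup D)%E].

Definition R3 : Prop :=
  (\esum_(z in [set z : site d | z != 0%R])
     \esum_(D in [set D : {fset site d} | 0%R \in D])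
       \sum_(xi : {ffun D -> spin q}) \sum_(i : spin q)
         supnorm (nabla z i (c D ^~ xi)) < +oo)%E.

(* Every element of Omega_D is restr D zeta for some zeta, and its translate
   in Omega_(D + x) is then restr (D + x) (tau x zeta). *)
Definition R4 : Prop :=
  forall (x : site d) D (eta zeta : Omega),
    c (fshift x D) (tau x eta) (restr (fshift x D) (tau x zeta)) =
    c D eta (restr D zeta).

Definition R5 : Prop :=
  (0 < ereal_inf [set r%:E | r in
         [set r | exists D eta xi, r = c D eta xi /\ (0 < r)%R]])%E.

Definition R6 : Prop :=
  forall (eta : Omega) (D : {fset site d}) (xi : {ffun D -> spin q}),
    exists (n : nat) (s : nat -> Omega),
      [/\ s 0 = eta, s n = glue xi eta &
          forall i, (i < n)%N -> pos_transition (s i) (s i.+1)].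

Definition Lterm (f : Omega -> R) (eta : Omega) (D : {fset site d}) : \bar R :=
  (\sum_(xi : {ffun D -> spin q}) c D eta xi * (f (glue xi eta) - f eta))%:E.

(* esum is meant for nonnegative families: the (absolutely convergent) signed
   series is the difference of its positive and negative parts. *)
Definition Lop (f : Omega -> R) : Omega -> R := fun eta =>
  fine (\esum_(D in setT) (Lterm f eta)^\+ D -
        \esum_(D in setT) (Lterm f eta)^\- D)%E.

End rates.

Section semigroup.
Variables (R : realType) (q d : nat).
Local Notation Omega := (config q (site d)).

(* Operators on C(Omega); P t f is unconstrained for t < 0 or f not
   continuous. *)
Variable P : R -> (Omega -> R) -> (Omega -> R).

Record markov_semigroup : Prop := MarkovSemigroup {
  semigroup_continuous : forall t f,
    0 <= t -> continuous f -> continuous (P t f) ;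
  semigroup_linear : forall (t a : R) (f g : Omega -> R), 0 <= t -> continuous f -> continuous g ->
    P t (fun w => a * f w + g w) = (fun w => a * P t f w + P t g w) ;
  semigroup0 : forall f : Omega -> R, continuous f -> P 0 f = f ;
  semigroupD : forall (s t : R) (f : Omega -> R), 0 <= s -> 0 <= t -> continuous f ->
    P (s + t) f = P s (P t f) ;
  semigroup1 : forall t : R, 0 <= t -> P t (fun=> 1) = (fun=> 1) ;
  semigroup_ge0 : forall (t : R) (f : Omega -> R), 0 <= t -> continuous f ->
    (forall w, 0 <= f w) -> forall w, 0 <= P t f w ;
  semigroup_rcontinuous : forall (t : R) (f : Omega -> R), 0 <= t -> continuous f ->
    supnorm (fun w => P s f w - P t f w) @[s --> t^'+] --> 0%E
}.

Definition generator_graph (f g : Omega -> R) : Prop :=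
  supnorm (fun w => t^-1 * (P t f w - f w) - g w) @[t --> 0^'+] --> 0%E.

(* The graph of the closure in C(Omega) of the restriction of Lop c to core. *)
Definition closure_graph (c : rates R q d) (f g : Omega -> R) : Prop :=
  exists f_ : nat -> Omega -> R,
    [/\ forall n, core (f_ n),
        supnorm (fun w => f_ n w - f w) @[n --> \oo] --> 0%E &
        supnorm (fun w => Lop c (f_ n) w - g w) @[n --> \oo] --> 0%E].

Definition generated_by (c : rates R q d) : Prop :=
  forall f g : Omega -> R, continuous f -> continuous g ->
    (generator_graph f g <-> closure_graph c f g).

(* nu' = nu P_t, the measure that represents f |-> nu (P_t f). *)
Definition evolves (t : R) (nu nu' : probability Omega R) : Prop :=
  forall f : Omega -> R, continuous f ->
    (\int[nu']_w (f w)%:E = \int[nu]_w (P t f w)%:E)%E.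

Definition time_stationary (mu : probability Omega R) : Prop :=
  forall t : R, 0 <= t -> evolves t mu mu.

End semigroup.

Section specifications.
Variables (R : realType) (q d : nat).
Local Notation Omega := (config q (site d)).

Definition kernels : Type :=
  forall L : {fset site d}, R.-pker (config q {x | x \notin L}) ~> Omega.

Variable gam : kernels.
Arguments gam : clear implicits.

Definition proper_kernels : Prop :=
  forall (L D : {fset site d}) (xi : {ffun L -> spin q})
    (zeta : {ffun D -> spin q}) (eta : Omega), [disjoint L & D]%fset ->
    gam L (restrC L eta) (cyl xi `&` cyl zeta) =
    (gam L (restrC L eta) (cyl xi) * (\1_(cyl zeta) eta)%:E)%E.

(* Equality of the measures gam_L gam_D and gam_L on the whole sigma-algebra;
   equality on the cylinders over D alone would be strictly weaker. *)
Definition consistent_kernels : Prop :=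
  forall (D L : {fset site d}) (b : config q {x | x \notin L}) (A : set Omega),
    (D `<=` L)%fset -> measurable A ->
    (\int[gam L b]_w gam D (restrC D w) A = gam L b A)%E.

Definition specification : Prop := proper_kernels /\ consistent_kernels.

(* gamfun L w = $\gamma_\Lambda(\omega_\Lambda | \omega_{\Lambda^c})$ *)
Definition gamval (L : {fset site d}) (zeta w : Omega) : R :=
  fine (gam L (restrC L w) (cyl (restr L zeta))).

Definition gamfun (L : {fset site d}) (w : Omega) : R := gamval L w w.

Definition Gibbs (mu : probability Omega R) : Prop :=
  forall (L : {fset site d}) (xi : {ffun L -> spin q}),
    (\int[mu]_w gam L (restrC L w) (cyl xi) = mu (cyl xi))%E.

Definition S1 : Prop :=
  forall (L : {fset site d}) (e : R), 0 < e ->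
    exists D0 : {fset site d}, forall D : {fset site d}, (D0 `<=` D)%fset ->
      (ereal_sup [set `|gamval L p.1 (glue (restr D p.1) p.2)
                        - gamval L p.1 p.1|%:E | p in [set: Omega * Omega]]
       <= e%:E)%E.

Definition S2 : Prop :=
  exists2 delta : R, 0 < delta &
    (delta%:E <= ereal_inf [set (gamfun [fset 0]%fset eta)%:E | eta in setT])%E.

Definition S3 (c : rates R q d) : Prop :=
  (\esum_(D in [set D : {fset site d} | 0%R \in D /\ 0 < rate_sup c D])
     \esum_(z in [set z : site d | z != 0%R])
       \sum_(i : spin q) supnorm (nabla z i (gamfun D)) < +oo)%E.

Definition S4 : Prop :=
  forall (L : {fset site d}) (x : site d) (eta : Omega),
    gamfun (fshift x L) (tau x eta) = gamfun L eta.

End specifications.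

(* Main.v *)
(** Let mu be the stationary Gibbs measure and, for a finite volume L, let f be
    the density on L of (nu_t + mu) / 2 with respect to mu; mixing with mu makes
    f >= 1/2. The relative entropy on L changes at the rate E_m[Lop (ln f)], which
    is compared with E_mu[Lop f] = 0 one transition at a time. A transition with
    rate c and density ratio r contributes at most the mean of
    c (ln r - (r - 1)) up to an error governed by the oscillation of c outside L,
    hence o(|L|) in total; tilting ln r <= r - 1 by a test function s extracts in
    addition a quantity that is linear and weakly continuous in the measure and
    that, by translation invariance, occurs at a positive fraction of the sites
    of L. If it were positive at a limit point of nu_t, it would stay bounded
    away from zero during a time tau after infinitely many t_n, and the entropy
    on a large enough box would become negative. So all these quantities vanish at
    nustar: nustar satisfies, for every transition of positive rate, the same
    change of variables formula as mu. By (R6), composing transitions yields this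
    formula for every change of finitely many spins, which is the Gibbs property. *)

Require Import Defs.
From HB Require Import structures.
From mathcomp Require Import all_boot all_order all_algebra finmap.
From mathcomp Require Import all_classical all_reals all_analysis.
From mathcomp Require Import ring lra zify.

Set Implicit Arguments.
Unset Strict Implicit.
Unset Printing Implicit Defensive.

Import Order.TTheory GRing.Theory Num.Theory.
Import numFieldNormedType.Exports.
Import Defs.

Local Open Scope classical_set_scope.
Local Open Scope ring_scope.

(** * Cylinders and continuous functions *)

Section topology.
Variables (q d : nat).
Local Notation Omega := (config q (site d)).

(** The term ln r - (r - 1) is nonlinear in a density that changes with the volume, so its mean does
    not pass to a weak limit; the tilt trades it for the fixed continuous observable [rgain], at a
    price quadratic in s. Taking s = theta g and letting theta tend to 0 removes this price and
    leaves an inequality for the mean of [rdefect]; applied to g and to -g it becomes an equality.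
    Since mu itself gives mean 0, the average with mu that was introduced for positivity disappears
    again. A second obstacle is that rates may vanish, so the formula for one transition carries
    information only where that transition is allowed. Paths are therefore followed only from a
    small cylinder around a given configuration, where by continuity the rates along the path stay
    bounded below, and compactness of the configuration space patches the cylinders together. *)

Lemma restr_eqP (W : {fset site d}) (w w' : Omega) :
  restr W w = restr W w' <-> {in W, w =1 w'}.
Proof.
split=> [e x xW|e]; first by have /ffunP/(_ (FSetSub xW)) := e; rewrite !ffunE.
by apply/ffunP => x; rewrite !ffunE e // (valP x).
Qed.

Lemma restr_sub (V W : {fset site d}) (w w' : Omega) :
  (V `<=` W)%fset -> restr W w = restr W w' -> restr V w = restr V w'.
Proof.
by move=> /fsubsetP VW /restr_eqP e; apply/restr_eqP => x /VW; exact: e.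
Qed.

Lemma glueE (D : {fset site d}) (xi : {ffun D -> spin q}) (w : Omega) x :
  x \notin D -> glue xi w x = w x.
Proof. by move=> xD; rewrite /glue insubN. Qed.

Lemma glue_in (D : {fset site d}) (xi : {ffun D -> spin q}) (w : Omega)
  x (xD : x \in D) : glue xi w x = xi (FSetSub xD).
Proof. by rewrite /glue insubT /=; congr (xi _); exact: val_inj. Qed.

Lemma restr_glue (D : {fset site d}) (xi : {ffun D -> spin q}) (w : Omega) :
  restr D (glue xi w) = xi.
Proof. by apply/ffunP => x; rewrite ffunE /glue valK. Qed.

Lemma glue_restr (D : {fset site d}) (w : Omega) : glue (restr D w) w = w.
Proof.
apply/funext => x; have [xD|xD] := boolP (x \in D); last by rewrite glueE.
by rewrite (glue_in _ _ xD) ffunE.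
Qed.

Lemma glue_glue (D : {fset site d}) (xi zeta : {ffun D -> spin q}) (w : Omega) :
  glue xi (glue zeta w) = glue xi w.
Proof.
apply/funext => x; have [xD|xD] := boolP (x \in D); last by rewrite !glueE.
by rewrite !glue_in.
Qed.

Lemma restrC_glue (D : {fset site d}) (xi : {ffun D -> spin q}) (w : Omega) :
  restrC D (glue xi w) = restrC D w.
Proof. by apply/funext => -[x xD]; rewrite /restrC /= glueE. Qed.

Lemma restr_glue_eq (W D : {fset site d}) (xi : {ffun D -> spin q})
    (w w' : Omega) :
  restr W w = restr W w' -> restr W (glue xi w) = restr W (glue xi w').
Proof.
move=> /restr_eqP e; apply/restr_eqP => x xW.
have [xD|xD] := boolP (x \in D); last by rewrite !glueE // e.
by rewrite !glue_in.
Qed.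

(** Sets containing a cylinder around [w] form a filter that converges to [w] in every coordinate,
    hence in the product topology; conversely a cylinder is a finite intersection of open coordinate
    conditions because the spins are discrete. *)
Lemma nbhs_cylP (w : Omega) (A : set Omega) :
  nbhs w A <-> exists W : {fset site d},
    forall w', restr W w' = restr W w -> A w'.
Proof.
split.
  pose F : set_system Omega := [set A | exists W : {fset site d},
    forall w', restr W w' = restr W w -> A w'].
  have FF : Filter F.
    split=> [|P Q [V hV] [W hW]|P Q PQ [V hV]].
    - by exists fset0.
    - exists (V `|` W)%fset => w' e; split.
        by apply/hV/(restr_sub _ e)/fsubsetUl.
      by apply/hW/(restr_sub _ e)/fsubsetUr.
    - by exists V => w' /hV/PQ.
  suff : F --> w by apply.
  apply/cvg_sup => i B [C [[U oU <-] Uw] CB].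
  exists [fset i]%fset => w' /restr_eqP e; apply: CB.
  by rewrite /preimage /=; move: Uw; rewrite /preimage /= -e // inE.
move=> [W hW]; apply: (@filterS _ _ _ (\bigcap_(x in [set` W])
   [set w' : Omega | w' x = w x])).
  by move=> w' h; apply: hW; apply/restr_eqP => x xW; apply: h.
apply: filter_bigI => x xW.
have := @proj_continuous _ (fun _ : site d => discrete_topology (spin q)) x w.
move/(_ [set w x]); apply.
by rewrite nbhs_principalE.
Qed.

Lemma Omega_compact : compact [set: Omega].
Proof.
have := @tychonoff (site d) (fun=> discrete_topology (spin q)) (fun=> setT).
have -> : [set f : forall i : site d, discrete_topology (spin q) |
  forall i, [set: discrete_topology (spin q)] (f i)] = setT.
  by apply/seteqP; split.
apply=> i; apply: finite_compact.
exact: (@finite_finset (spin q)).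
Qed.

(* Lebesgue number lemma for cylinders. *)
Lemma cylinder_cover (U : Omega -> set Omega) : (forall w, nbhs w (U w)) ->
  exists W : {fset site d}, forall w, exists w0,
    forall w', restr W w' = restr W w -> U w0 w'.
Proof.
move=> hU.
pose P (W : {fset site d}) w := exists w0,
    forall w', restr W w' = restr W w -> U w0 w'.
(* The filter of all sufficiently large windows: compactness in its near-covering form turns a
   window for each point into one window for all points. *)
pose F : set_system {fset site d} := [set A | exists W : {fset site d},
  forall W' : {fset site d}, (W `<=` W')%fset -> A W'].
have FF : Filter F.
  split=> [|A B [V hV] [W hW]|A B AB [V hV]].
  - by exists fset0.
  - exists (V `|` W)%fset => W' e; split.
      by apply: hV; apply: fsubset_trans e; exact: fsubsetUl.
    by apply: hW; apply: fsubset_trans e; exact: fsubsetUr.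
  - by exists V => w' /hV/AB.
have := Omega_compact; rewrite compact_near_coveringP.
move=> /(_ _ F P FF) [|W hW].
  move=> x _; have /nbhs_cylP[W hW] := hU x.
  exists ([set w | restr W w = restr W x],
    [set W' : {fset site d} | (W `<=` W')%fset]) => /=.
    by split; [apply/nbhs_cylP; exists W|exists W].
  move=> [w W'] /= [wx WW']; exists x => w' e; apply: hW.
  by rewrite -wx; exact: restr_sub e.
by exists W => w; apply: hW.
Qed.

Definition local (T : Type) (W : {fset site d}) (F : Omega -> T) : Prop :=
  forall w w', restr W w = restr W w' -> F w = F w'.

Lemma localS T (V W : {fset site d}) (F : Omega -> T) : (V `<=` W)%fset ->
  local V F -> local W F.
Proof. by move=> VW lF w w' /(restr_sub VW); exact: lF. Qed.

End topology.

(** * Continuity through finite windows *)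

Section continuity.
Variables (R : realType) (q d : nat).
Local Notation Omega := (config q (site d)).
Implicit Types F : Omega -> R.

Definition osc_le (W : {fset site d}) F (e : R) : Prop :=
  forall w w', restr W w = restr W w' -> `|F w - F w'| <= e.

(** Uniform continuity on a compact space, with finite windows in place of a metric. The algebra of
    continuous functions below is derived from this form. *)
Lemma continuous_qlocP F : continuous F <->
  forall e : R, 0 < e -> exists W : {fset site d}, osc_le W F e.
Proof.
split=> [cF e e0|h w].
  have e2 : 0 < e / 2 by rewrite divr_gt0.
  pose U w := [set w' | `|F w - F w'| <= e / 2].
  have [w|W hW] := @cylinder_cover q d U.
    exact: (cvgr_dist_le _ _ (cF w) _ e2).
  exists W => w w' ww'; have [w0 h] := hW w.
  have h1 : `|F w0 - F w| <= e / 2 by exact: h.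
  have h2 : `|F w0 - F w'| <= e / 2 by exact: h.
  rewrite (splitr e) -[X in `|X|](subrKA (F w0)).
  by rewrite (le_trans (ler_normD _ _)) // lerD // distrC.
apply: (iffRL (@cvgrPdist_le R R^o Omega (nbhs w) _ F (F w))) => e e0; have [W hW] := h e e0.
by apply/nbhs_cylP; exists W => w' ww'; apply: hW.
Qed.

Lemma local_continuous (W : {fset site d}) F : local W F -> continuous F.
Proof.
move=> lF; apply/continuous_qlocP => e e0; exists W => w w' /lF ->.
by rewrite subrr normr0 ltW.
Qed.

Lemma osc_leS (V W : {fset site d}) F e : (V `<=` W)%fset ->
  osc_le V F e -> osc_le W F e.
Proof. by move=> VW h w w' /(restr_sub VW); exact: h. Qed.

Lemma continuous_bounded F : continuous F -> exists2 M, 0 <= M &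
  forall w, `|F w| <= M.
Proof.
move=> /continuous_qlocP/(_ _ ltr01)[W hW].
pose S := \sum_(xi : {ffun W -> spin q}) `|F (glue xi point)|.
exists (1 + S); first by rewrite addr_ge0 // sumr_ge0.
move=> w; rewrite -[F w](subrK (F (glue (restr W w) point))).
rewrite (le_trans (ler_normD _ _)) // lerD //.
  by apply: hW; rewrite restr_glue.
by rewrite /S (bigD1 (restr W w)) //= lerDl sumr_ge0.
Qed.

Definition locapprox (W : {fset site d}) F (e : R) : Prop :=
  exists2 G : Omega -> R, local W G & forall w, `|F w - G w| <= e.

Lemma osc_locapprox (W : {fset site d}) F e : osc_le W F e -> locapprox W F e.
Proof.
move=> h; exists (fun w => F (glue (restr W w) point)).
  by move=> w w' ->.
by move=> w; apply: h; rewrite restr_glue.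
Qed.

Lemma continuous_locapprox F e : continuous F -> 0 < e ->
  exists W : {fset site d}, forall W' : {fset site d}, (W `<=` W')%fset ->
    locapprox W' F e.
Proof.
move=> /continuous_qlocP cF /cF[W hW]; exists W => W' WW'.
by apply: osc_locapprox; exact: osc_leS hW.
Qed.

Lemma cont_cst (a : R) : continuous (fun _ : Omega => a).
Proof. exact: (@local_continuous fset0). Qed.

Lemma cont_add F G : continuous F -> continuous G ->
  continuous (fun w => F w + G w).
Proof.
move=> /continuous_qlocP cF /continuous_qlocP cG.
apply/continuous_qlocP => e e0; have e2 : 0 < e / 2 by rewrite divr_gt0.
have [V hV] := cF _ e2; have [W hW] := cG _ e2.
exists (V `|` W)%fset => w w' ww'; rewrite opprD addrACA (splitr e).
rewrite (le_trans (ler_normD _ _)) // lerD //.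
  by apply/hV/(restr_sub _ ww')/fsubsetUl.
by apply/hW/(restr_sub _ ww')/fsubsetUr.
Qed.

Lemma cont_opp F : continuous F -> continuous (fun w => - F w).
Proof.
move=> /continuous_qlocP cF; apply/continuous_qlocP => e /cF[W hW].
by exists W => w w' /hW; rewrite -opprD normrN.
Qed.

Lemma cont_sub F G : continuous F -> continuous G ->
  continuous (fun w => F w - G w).
Proof. by move=> cF cG; apply: cont_add => //; exact: cont_opp. Qed.

Lemma cont_mul F G : continuous F -> continuous G ->
  continuous (fun w => F w * G w).
Proof.
move=> cF cG; have [M M0 hM] := continuous_bounded cF.
have [N N0 hN] := continuous_bounded cG.
move: cF cG => /continuous_qlocP cF /continuous_qlocP cG.
apply/continuous_qlocP => e e0.
have e1 : 0 < e / 2 / (N + 1) by rewrite !divr_gt0 // ltr_wpDl.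
have e2 : 0 < e / 2 / (M + 1) by rewrite !divr_gt0 // ltr_wpDl.
have [V hV] := cF _ e1; have [W hW] := cG _ e2.
exists (V `|` W)%fset => w w' ww'.
have h1 : `|F w - F w'| <= e / 2 / (N + 1).
  by apply/hV/(restr_sub _ ww')/fsubsetUl.
have h2 : `|G w - G w'| <= e / 2 / (M + 1).
  by apply/hW/(restr_sub _ ww')/fsubsetUr.
have -> : F w * G w - F w' * G w' =
  (F w - F w') * G w + F w' * (G w - G w').
  by rewrite mulrBl mulrBr subrKA.
rewrite (splitr e) (le_trans (ler_normD _ _)) // lerD // normrM.
  apply: (@le_trans _ _ (e / 2 / (N + 1) * (N + 1))).
    by apply: ler_pM => //; rewrite (le_trans (hN _)) // lerDl.
  by rewrite divfK // gt_eqF // ltr_wpDl.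
apply: (@le_trans _ _ ((M + 1) * (e / 2 / (M + 1)))).
  by apply: ler_pM => //; rewrite (le_trans (hM _)) // lerDl.
by rewrite mulrC divfK // gt_eqF // ltr_wpDl.
Qed.

Lemma continuous_norm_lb F : continuous F -> (forall w, F w != 0) ->
  exists2 a, 0 < a & forall w, a <= `|F w|.
Proof.
move=> cF F0.
have [w|W hW] := @cylinder_cover q d
    (fun w => [set w' | `|F w - F w'| <= `|F w| / 2]).
  have e2 : 0 < `|F w| / 2 by rewrite divr_gt0 // normr_gt0.
  exact: (cvgr_dist_le _ _ (cF w) _ e2).
have h w : exists2 a, 0 < a & forall w', restr W w' = restr W w -> a <= `|F w'|.
  have [w0 hw0] := hW w; exists (`|F w0| / 2).
    by rewrite divr_gt0 // normr_gt0.
  move=> w' /hw0 /= h; have := ler_normD (F w0 - F w') (F w').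
  rewrite subrK => h2.
  by rewrite -(lerD2l (`|F w0| / 2)) -splitr (le_trans h2) // lerD2r.
have /choice[g g0] : forall xi : {ffun W -> spin q}, exists a : R, 0 < a /\
    forall w', restr W w' = xi -> a <= `|F w'|.
  move=> xi.
  by have [a a0 ha] := h (glue xi point); exists a; split=> // w' e;
    apply: ha; rewrite restr_glue.
(* A stand-in for the minimum of finitely many positive numbers: positive, and below each [g xi]. *)
exists (\sum_(xi : {ffun W -> spin q}) (g xi)^-1)^-1.
  rewrite invr_gt0 (bigD1 (restr W point)) //= ltr_pwDl //.
    by rewrite invr_gt0; have [] := g0 (restr W point).
  by apply: sumr_ge0 => xi _; rewrite invr_ge0 ltW //; have [] := g0 xi.
move=> w; have [gw0 /(_ w erefl) hw] := g0 (restr W w).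
rewrite (le_trans _ hw) // -[leRHS]invrK lef_pV2 ?posrE ?invr_gt0 //.
  rewrite (bigD1 (restr W w)) //= lerDl.
  by apply: sumr_ge0 => xi _; rewrite invr_ge0 ltW //; have [] := g0 xi.
rewrite (bigD1 (restr W w)) //= ltr_pwDl ?invr_gt0 //.
by apply: sumr_ge0 => xi _; rewrite invr_ge0 ltW //; have [] := g0 xi.
Qed.

Lemma cont_inv F : continuous F -> (forall w, F w != 0) ->
  continuous (fun w => (F w)^-1).
Proof.
move=> cF F0; have [a a0 ha] := continuous_norm_lb cF F0.
move: cF => /continuous_qlocP cF; apply/continuous_qlocP => e e0.
have e1 : 0 < e * (a * a) by rewrite !mulr_gt0.
have [W hW] := cF _ e1; exists W => w w' /hW h.
have -> : (F w)^-1 - (F w')^-1 = (F w' - F w) / (F w * F w').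
  by field; rewrite !F0.
rewrite normrM normfV ler_pdivrMr; last by rewrite normr_gt0 mulf_neq0.
rewrite distrC (le_trans h) // ler_pM2l // normrM.
by apply: ler_pM => //; exact: ltW.
Qed.

Lemma cont_norm F : continuous F -> continuous (fun w => `|F w|).
Proof.
move=> /continuous_qlocP cF; apply/continuous_qlocP => e /cF[W hW].
by exists W => w w' /hW; apply: le_trans; exact: ler_dist_dist.
Qed.

Lemma cont_sum (I : Type) (r : seq I) (Q : pred I) (f : I -> Omega -> R) :
  (forall i, Q i -> continuous (f i)) ->
  continuous (fun w => \sum_(i <- r | Q i) f i w).
Proof.
move=> cf; elim: r => [|i r IH].
  rewrite (_ : (fun _ => _) = fun=> 0); first exact: cont_cst.
  by apply/funext => w; rewrite big_nil.
have [Qi|Qi] := boolP (Q i).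
  rewrite (_ : (fun _ => _) = fun w => f i w + \sum_(j <- r | Q j) f j w).
    by apply: cont_add => //; exact: cf.
  by apply/funext => w; rewrite big_cons Qi.
rewrite (_ : (fun _ => _) = fun w => \sum_(j <- r | Q j) f j w) //.
by apply/funext => w; rewrite big_cons (negbTE Qi).
Qed.

Lemma cont_map (T : Omega -> Omega) F :
  (forall W : {fset site d}, exists V : {fset site d},
    forall w w', restr V w = restr V w' -> restr W (T w) = restr W (T w')) ->
  continuous F -> continuous (fun w => F (T w)).
Proof.
move=> hT /continuous_qlocP cF; apply/continuous_qlocP => e /cF[W hW].
by have [V hV] := hT W; exists V => w w' /hV/hW.
Qed.

Lemma cont_glue (D : {fset site d}) (xi : {ffun D -> spin q}) F :
  continuous F -> continuous (fun w => F (glue xi w)).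
Proof. by apply: cont_map => W; exists W => w w'; exact: restr_glue_eq. Qed.

Lemma cont_tau (x : site d) F :
  continuous F -> continuous (fun w => F (tau x w)).
Proof.
apply: cont_map => W; exists (fshift (- x) W) => w w' /restr_eqP e.
apply/restr_eqP => y yW; rewrite /tau e //.
by apply/imfsetP; exists y.
Qed.

End continuity.

(** * Positive normalized functionals *)

Section states.
Variables (R : realType) (q d : nat).
Local Notation Omega := (config q (site d)).
Implicit Types (F G : Omega -> R) (m : (Omega -> R) -> R).

(** A probability measure seen as a functional on the continuous functions; nothing is required of
    [m] elsewhere. Mixtures and time evolutions of measures are then states without any measure
    being constructed. *)
Record state m : Prop := State {
  state_lin : forall a F G, continuous F -> continuous G ->
    m (fun w => a * F w + G w) = a * m F + m G ;
  state_ge0 : forall F, continuous F -> (forall w, 0 <= F w) -> 0 <= m F ;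
  state1 : m (fun=> 1) = 1 }.

Section one_state.
Variables (m : (Omega -> R) -> R) (sm : state m).

Lemma stateD F G : continuous F -> continuous G ->
  m (fun w => F w + G w) = m F + m G.
Proof.
move=> cF cG; have := state_lin sm 1 cF cG; rewrite mul1r => <-.
by congr (m _); apply/funext => w; rewrite mul1r.
Qed.

Lemma state0 : m (fun=> 0) = 0.
Proof.
have := stateD (@cont_cst R q d 0) (@cont_cst R q d 0).
rewrite (_ : (fun=> 0 + 0) = fun=> 0); last by apply/funext=> w; rewrite addr0.
by move=> /eqP; rewrite -subr_eq subrr eq_sym => /eqP.
Qed.

Lemma stateZ a F : continuous F -> m (fun w => a * F w) = a * m F.
Proof.
move=> cF; have := state_lin sm a cF (@cont_cst R q d 0).
rewrite state0 addr0 => <-.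
by congr (m _); apply/funext => w; rewrite addr0.
Qed.

Lemma stateN F : continuous F -> m (fun w => - F w) = - m F.
Proof.
move=> cF; rewrite -mulN1r -stateZ //.
by congr (m _); apply/funext => w; rewrite mulN1r.
Qed.

Lemma stateB F G : continuous F -> continuous G ->
  m (fun w => F w - G w) = m F - m G.
Proof. by move=> cF cG; rewrite stateD ?stateN //; exact: cont_opp. Qed.

Lemma state_cst (a : R) : m (fun=> a) = a.
Proof.
have := stateZ a (@cont_cst R q d 1); rewrite (state1 sm) => e; rewrite -[RHS]mulr1 -e.
by congr (m _); apply/funext => w; rewrite mulr1.
Qed.

Lemma state_sum (I : Type) (r : seq I) (Q : pred I) (f : I -> Omega -> R) :
  (forall i, Q i -> continuous (f i)) ->
  m (fun w => \sum_(i <- r | Q i) f i w) = \sum_(i <- r | Q i) m (f i).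
Proof.
move=> cf; elim: r => [|i r IH].
  rewrite big_nil -[RHS]state0; congr (m _).
  by apply/funext => w; rewrite big_nil.
have [Qi|Qi] := boolP (Q i).
  rewrite big_cons Qi -IH -stateD; [|exact: cf|exact: cont_sum].
  by congr (m _); apply/funext => w; rewrite big_cons Qi.
rewrite big_cons (negbTE Qi) -IH.
by congr (m _); apply/funext => w; rewrite big_cons (negbTE Qi).
Qed.

Lemma state_le F G : continuous F -> continuous G ->
  (forall w, F w <= G w) -> m F <= m G.
Proof.
move=> cF cG FG; rewrite -subr_ge0 -stateB //; apply: state_ge0 => //.
  exact: cont_sub.
by move=> w; rewrite subr_ge0.
Qed.

Lemma state_bound F (e : R) : continuous F -> (forall w, F w <= e) -> m F <= e.
Proof.
by move=> cF Fe; rewrite -[leRHS]state_cst; apply: state_le => //; exact: cont_cst.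
Qed.

Lemma state_norm F (e : R) : continuous F -> (forall w, `|F w| <= e) ->
  `|m F| <= e.
Proof.
move=> cF Fe; apply/ler_normlP; split.
  rewrite -stateN //; apply: state_bound; first exact: cont_opp.
  by move=> w; rewrite (le_trans (ler_norm _)) // normrN.
by apply: state_bound => // w; rewrite (le_trans (ler_norm _)).
Qed.

Lemma state_close F G (e : R) : continuous F -> continuous G ->
  (forall w, `|F w - G w| <= e) -> `|m F - m G| <= e.
Proof.
by move=> cF cG FG; rewrite -stateB //; apply: state_norm => //; exact: cont_sub.
Qed.

End one_state.

Definition ind (W : {fset site d}) (xi : {ffun W -> spin q}) : Omega -> R :=
  fun w => (restr W w == xi)%:R.

Lemma ind_local (W : {fset site d}) (xi : {ffun W -> spin q}) :
  local W (ind xi).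
Proof. by move=> w w'; rewrite /ind => ->. Qed.

Lemma ind_cont (W : {fset site d}) (xi : {ffun W -> spin q}) :
  continuous (ind xi).
Proof. exact: local_continuous (@ind_local W xi). Qed.

Lemma ind_ge0 (W : {fset site d}) (xi : {ffun W -> spin q}) w : 0 <= ind xi w.
Proof. by rewrite /ind ler0n. Qed.

Lemma sum_ind (W : {fset site d}) (f : {ffun W -> spin q} -> R) w :
  \sum_xi f xi * ind xi w = f (restr W w).
Proof.
rewrite (bigD1 (restr W w)) //= /ind eqxx mulr1 big1 ?addr0 // => xi.
by rewrite eq_sym => /negbTE ->; rewrite mulr0.
Qed.

Lemma local_sum (W : {fset site d}) F : local W F ->
  F = fun w => \sum_(xi : {ffun W -> spin q}) F (glue xi point) * ind xi w.
Proof.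
move=> lF; apply/funext => w.
by rewrite (sum_ind (fun xi => F (glue xi point))); apply: lF; rewrite restr_glue.
Qed.

Lemma state_local m (W : {fset site d}) F : state m -> local W F ->
  m F = \sum_(xi : {ffun W -> spin q}) F (glue xi point) * m (ind xi).
Proof.
move=> sm lF; rewrite {1}(local_sum lF) (state_sum sm); last first.
  by move=> xi _; apply: cont_mul; [exact: cont_cst|exact: ind_cont].
by apply: eq_bigr => xi _; rewrite (stateZ sm) //; exact: ind_cont.
Qed.

Lemma state_ind_sum m (W : {fset site d}) : state m ->
  \sum_(xi : {ffun W -> spin q}) m (ind xi) = 1.
Proof.
move=> sm; have := @state_local m W (fun=> 1) sm.
by rewrite (state1 sm) => -> //; apply: eq_bigr => xi _; rewrite mul1r.
Qed.

Lemma state_ind_ge0 m (W : {fset site d}) (xi : {ffun W -> spin q}) :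
  state m -> 0 <= m (ind xi).
Proof. by move=> sm; apply: (state_ge0 sm); [exact: ind_cont|exact: ind_ge0]. Qed.

Lemma state_ind_le1 m (W : {fset site d}) (xi : {ffun W -> spin q}) :
  state m -> m (ind xi) <= 1.
Proof.
by move=> sm; apply: (state_bound sm);
  [exact: ind_cont|move=> w; rewrite /ind; case: eqP => //= _; exact: ler01].
Qed.

(** Local functions over windows containing [V] are uniformly dense among the continuous ones. The
    freedom in [V] serves the kernels, whose properness is exploited on windows containing their own
    volume. *)
Lemma state_ext (V : {fset site d}) m1 m2 F : state m1 -> state m2 ->
  (forall (W : {fset site d}) (xi : {ffun W -> spin q}),
    (V `<=` W)%fset -> m1 (ind xi) = m2 (ind xi)) ->
  continuous F -> m1 F = m2 F.
Proof.
move=> s1 s2 e12 cF; apply/eqP; rewrite -subr_eq0 -normr_le0.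
apply/ler_addgt0Pr => e e0; rewrite add0r.
have e2 : 0 < e / 2 by rewrite divr_gt0.
have [W /(_ _ (fsubsetUl W V)) [G lG FG]] := continuous_locapprox cF e2.
have cG := local_continuous lG.
have := state_close s1 cF cG FG; have := state_close s2 cF cG FG.
have -> : m1 G = m2 G.
  rewrite (state_local s1 lG) (state_local s2 lG).
  by apply: eq_bigr => xi _; rewrite e12 // fsubsetUr.
move=> h2 h1; rewrite (splitr e) -[X in `|X|](subrKA (m2 G)).
by rewrite (le_trans (ler_normD _ _)) // lerD // distrC.
Qed.

Definition tinv m : Prop :=
  forall x F, continuous F -> m (fun w => F (tau x w)) = m F.

End states.

(** * Probability measures as states *)

Section probability_states.
Variables (R : realType) (q d : nat).
Local Notation Omega := (config q (site d)).
Implicit Types (F G : Omega -> R).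

Lemma cont_measurable F : continuous F -> measurable_fun setT F.
Proof.
move=> cF; apply: (measurability _ (measurable_realfun.RGenOInfty.measurableE R)).
move=> _ [_ [x ->] <-]; rewrite setTI; apply: sub_sigma_algebra.
apply: open_comp; last exact: interval_open.
by move=> w _; exact: cF.
Qed.

Lemma cyl_measurable (W : {fset site d}) (xi : {ffun W -> spin q}) :
  measurable (cyl xi).
Proof.
apply: sub_sigma_algebra; rewrite openE => w xiw.
by apply/nbhs_cylP; exists W => w' ww'; rewrite /cyl /= ww'.
Qed.

Lemma ind_indic (W : {fset site d}) (xi : {ffun W -> spin q}) w :
  ind R xi w = \1_(cyl xi) w.
Proof.
rewrite indicE /ind; have [e|e] := eqVneq (restr W w) xi.
  by rewrite mem_set.
by rewrite memNset //; exact/eqP.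
Qed.

Section prob.
Variables (N : {measure set Omega -> \bar R}) (N1 : N setT = 1%E).

Definition pstate F : R := Rintegral N setT F.

Lemma cont_integrable F : continuous F -> N.-integrable setT (EFin \o F).
Proof.
move=> cF; apply: measurable_bounded_integrable => //.
- by rewrite N1 ltry.
- exact: cont_measurable.
- have [M M0 FM] := continuous_bounded cF.
  exists M; split; first exact: num_real.
  by move=> y My w _ /=; apply: le_trans (FM w) _; exact: ltW.
Qed.

Lemma pstate_fin F : continuous F -> (\int[N]_w (F w)%:E)%E = (pstate F)%:E.
Proof.
move=> cF; rewrite /pstate /Rintegral fineK //.
exact: integrable_fin_num (cont_integrable cF).
Qed.

Lemma pstateP : state pstate.
Proof.
split=> [a F G cF cG|F cF F0|].
- rewrite /pstate RintegralD //.
  + by rewrite RintegralZl //; exact: cont_integrable.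
  + apply: cont_integrable.
    by apply: cont_mul => //; exact: cont_cst.
  + exact: cont_integrable.
- by apply: Rintegral_ge0.
- by rewrite /pstate Rintegral_cst // N1 mulr1.
Qed.

Lemma pstate_ind (W : {fset site d}) (xi : {ffun W -> spin q}) :
  N (cyl xi) = (pstate (ind R xi))%:E.
Proof.
rewrite -pstate_fin; last exact: ind_cont.
rewrite -[cyl xi]setIT -integral_indic //; last exact: cyl_measurable.
by apply: eq_integral => w _; rewrite ind_indic.
Qed.

End prob.

Lemma pstate_tinv (nu : probability Omega R) :
  translation_invariant nu -> tinv (pstate nu).
Proof.
have h1 : nu setT = 1%E by exact: probability_setT.
move=> nuT x F cF.
have sm := pstateP h1.
apply: (@state_ext R q d fset0 (fun F => pstate nu (fun w => F (tau x w))) (pstate nu)).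
- split=> [a G H cG cH|G cG G0|]; last exact: (state1 sm).
    by rewrite (state_lin sm) //; exact: cont_tau.
  by apply: (state_ge0 sm) => //; exact: cont_tau.
- exact: pstateP.
- move=> W xi _; have h := nuT x _ (cyl_measurable xi).
  have e1 : nu (cyl xi) = (pstate nu (ind R xi))%:E := pstate_ind h1 xi.
  have cI : continuous (fun w => ind R xi (tau x w)).
    by apply: cont_tau; exact: ind_cont.
  have e2 : nu (tau x @^-1` cyl xi) =
      (pstate nu (fun w => ind R xi (tau x w)))%:E.
    rewrite -(pstate_fin h1 cI) -[X in nu X]setIT -integral_indic //.
      by apply: eq_integral => w _; rewrite ind_indic.
    (* Measurability of the preimage: it is the set where a continuous function takes the value
       1. *)
    have := cont_measurable cI measurableT (measurable_set1 1).
    rewrite setTI; congr (measurable _); apply/seteqP; split=> w /=.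
      rewrite /ind /cyl /preimage /=; case: eqP => // _ /esym/eqP.
      by rewrite oner_eq0.
    by rewrite /ind /cyl /preimage /= => ->; rewrite eqxx.
  by have [] : (pstate nu (fun w => ind R xi (tau x w)))%:E =
    (pstate nu (ind R xi))%:E by rewrite -e1 -e2.
- exact: cF.
Qed.

End probability_states.

(** * Gibbs measures *)

Section specifications.
Variables (R : realType) (q d : nat).
Local Notation Omega := (config q (site d)).
Implicit Types (F G u v : Omega -> R).
Variable gam : kernels R q d.

Definition gcond (D : {fset site d}) (a : {ffun D -> spin q}) (w : Omega) : R :=
  fine (gam D (restrC D w) (cyl a)).

(** Integration against the kernel as a finite sum: a proper kernel resamples only the spins in [D],
    as [gintE] confirms. *)
Definition gint (D : {fset site d}) F (w : Omega) : R :=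
  \sum_(a : {ffun D -> spin q}) gcond a w * F (glue a w).

Lemma gam_setT (D : {fset site d}) w : gam D (restrC D w) setT = 1%E.
Proof. exact: prob_kernel. Qed.

Lemma gcondE (D : {fset site d}) (a : {ffun D -> spin q}) w :
  gcond a w = pstate (gam D (restrC D w)) (ind R a).
Proof. by rewrite /gcond (pstate_ind (gam_setT D w)). Qed.

Lemma gcond_EFin (D : {fset site d}) (a : {ffun D -> spin q}) w :
  gam D (restrC D w) (cyl a) = (gcond a w)%:E.
Proof. by rewrite gcondE (pstate_ind (gam_setT D w)). Qed.

Lemma gcond_ge0 (D : {fset site d}) (a : {ffun D -> spin q}) w : 0 <= gcond a w.
Proof. by rewrite gcondE; apply/state_ind_ge0/pstateP/gam_setT. Qed.

Lemma gcond_sum (D : {fset site d}) w :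
  \sum_(a : {ffun D -> spin q}) gcond a w = 1.
Proof.
rewrite -(state_ind_sum D (pstateP (gam_setT D w))).
by apply: eq_bigr => a _; rewrite gcondE.
Qed.

Lemma gcond_glue (D : {fset site d}) (a b : {ffun D -> spin q}) w :
  gcond a (glue b w) = gcond a w.
Proof. by rewrite /gcond restrC_glue. Qed.

Hypotheses (hgam : specification gam) (hS1 : S1 gam).

Lemma gcond_cont (D : {fset site d}) (a : {ffun D -> spin q}) :
  continuous (gcond a).
Proof.
apply/continuous_qlocP => e e0; have [D0 hD0] := hS1 D e0.
exists D0 => w w' ww'.
have /(restr_glue_eq a) e1 := ww'.
have := hD0 D0 (fsubset_refl _) => /(le_trans _) h.
rewrite -lee_fin distrC; apply: h; apply: ereal_sup_ubound.
(* Since [w] and [w'] agree on [D0], gluing the first configuration into the second over [D0] gives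
   the second one back, so [S1] compares exactly these two. *)
exists (glue a w, glue a w') => //=.
by rewrite e1 glue_restr /gamval restr_glue !restrC_glue.
Qed.

Lemma gint_cont (D : {fset site d}) F : continuous F -> continuous (gint D F).
Proof.
move=> cF; apply: cont_sum => a _; apply: cont_mul; first exact: gcond_cont.
exact: cont_glue.
Qed.

Lemma gint_state (D : {fset site d}) w : state (fun F => gint D F w).
Proof.
split=> [a F G cF cG|F cF F0|].
- rewrite /gint mulr_sumr -big_split /=; apply: eq_bigr => b _.
  by rewrite mulrDr mulrCA.
- by apply: sumr_ge0 => a _; rewrite mulr_ge0 // gcond_ge0.
- by rewrite /gint -[RHS](gcond_sum D w); apply: eq_bigr => a _; rewrite mulr1.
Qed.

Lemma gint_ind (D : {fset site d}) (a : {ffun D -> spin q}) w :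
  gint D (ind R a) w = gcond a w.
Proof.
rewrite /gint (bigD1 a) //= /ind restr_glue eqxx mulr1 big1 ?addr0 // => b.
by rewrite restr_glue => /negbTE ->; rewrite mulr0.
Qed.

(** A cylinder over a window containing [D] splits into its parts inside and outside [D]; properness
    evaluates the outer part at the boundary condition [w]. *)
Lemma gintE (D : {fset site d}) F w : continuous F ->
  pstate (gam D (restrC D w)) F = gint D F w.
Proof.
move=> cF; apply: (@state_ext R q d D _ (fun F => gint D F w)) => //.
- exact/pstateP/gam_setT.
- exact: gint_state.
move=> W xi DW; have [hp _] := hgam.
pose z : Omega := glue xi point.
have xiE : xi = restr W z by rewrite restr_glue.
have cylE : cyl xi = cyl (restr D z) `&` cyl (restr (W `\` D)%fset z).
  rewrite xiE; apply/seteqP; split=> w' /=.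
    rewrite /cyl /= => e; split; first exact: restr_sub e.
    by apply: restr_sub e; exact: fsubsetDl.
  rewrite /cyl /= => -[/restr_eqP e1 /restr_eqP e2]; apply/restr_eqP => x xW.
  have [xD|xD] := boolP (x \in D); first exact: e1.
  by apply: e2; rewrite inE xD.
have -> : pstate (gam D (restrC D w)) (ind R xi) =
    fine (gam D (restrC D w) (cyl xi)).
  by rewrite (pstate_ind (gam_setT D w)).
rewrite cylE hp; last by apply/fdisjointP => x xD; rewrite inE xD.
rewrite gcond_EFin -EFinM /= -ind_indic.
rewrite /gint (bigD1 (restr D z)) //= big1 ?addr0.
  congr (_ * _); rewrite /ind; congr (nat_of_bool _)%:R; rewrite xiE.
  apply/eqP/eqP => /restr_eqP e; apply/restr_eqP => x.
    move=> xW; have [xD|xD] := boolP (x \in D).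
      by rewrite (glue_in _ _ xD) ffunE.
    by rewrite glueE // e // inE xD.
  rewrite inE => /andP[xD xW]; rewrite -e //.
  by rewrite glueE.
move=> b bz; rewrite /ind; case: eqP => [e|_]; last by rewrite mulr0.
case/eqP: bz; rewrite -(restr_glue b w).
by apply: restr_sub DW _; rewrite e xiE.
Qed.

Lemma gint_gint (D L : {fset site d}) F w : (D `<=` L)%fset -> continuous F ->
  gint L (gint D F) w = gint L F w.
Proof.
move=> DL cF.
apply: (@state_ext R q d fset0 (fun F => gint L (gint D F) w)
  (fun F => gint L F w)) => //.
- split=> [a G H cG cH|G cG G0|].
  + rewrite -(state_lin (gint_state L w)); [|exact: gint_cont..].
    congr (gint L _ w); apply/funext => w'.
    by rewrite (state_lin (gint_state D w')).
  + apply: (state_ge0 (gint_state L w)); first exact: gint_cont.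
    by move=> w'; apply: (state_ge0 (gint_state D w')).
  + rewrite -[RHS](state1 (gint_state L w)); congr (gint L _ w).
    by apply/funext => w'; exact: (state1 (gint_state D w')).
- exact: gint_state.
move=> W xi _; have [_ hc] := hgam.
have cI := @ind_cont R q d W xi.
rewrite -!gintE //; last exact: gint_cont.
have [] : (pstate (gam L (restrC L w)) (gint D (ind R xi)))%:E =
    (pstate (gam L (restrC L w)) (ind R xi))%:E => //.
rewrite -(pstate_ind (gam_setT L w)) -(hc D) //; last exact: cyl_measurable.
rewrite -(pstate_fin (gam_setT L w)); last exact: gint_cont.
apply: eq_integral => w' _.
by rewrite (pstate_ind (gam_setT D w')) gintE.
Qed.

Hypotheses (hS2 : S2 gam) (hS4 : S4 gam).

(** Nonnullness at the origin is moved to every site by translation invariance and then multiplied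
    up: consistency inside [D] allows one site and the rest of [D] to be resampled separately, at
    the cost of a factor [delta] per site. This bound keeps the relative entropy of order |L|. *)
Lemma gcond_lb : exists2 delta : R, 0 < delta &
  forall (D : {fset site d}) (a : {ffun D -> spin q}) w,
    delta ^+ #|` D| <= gcond a w.
Proof.
have [delta d0 hd] := hS2; exists delta => //.
have h1 (x : site d) (a : {ffun [fset x]%fset -> spin q}) w : delta <= gcond a w.
  have -> : gcond a w = gamfun gam [fset x]%fset (glue a w).
    by rewrite /gamfun /gamval restr_glue restrC_glue.
  move: (glue a w) => eta.
  have -> : eta = tau x (tau (- x) eta).
    by apply/funext => y; rewrite /tau opprK subrK.
  have -> : [fset x]%fset = fshift x [fset 0]%fset.
    apply/fsetP => y; rewrite inE; apply/eqP/imfsetP => [->|[z]] /=.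
      by exists 0; rewrite ?inE ?add0r.
    by rewrite inE => /eqP -> ->; rewrite add0r.
  rewrite hS4 -lee_fin; apply: le_trans hd _.
  by apply: ereal_inf_lbound; eexists.
apply: finSet_rect => D IH; have [->|[x xD]] := fset_0Vmem D.
  move=> a w; rewrite cardfs0 expr0.
  rewrite -(gcond_sum fset0 w) (bigD1 a) //= big1 ?addr0 // => b /eqP[].
  by apply/ffunP => -[y y0]; have := y0; rewrite in_fset0.
move=> a w; pose D' := (D `\ x)%fset.
have D'D : (D' `<` D)%fset by exact: fproperD1.
have D'D2 := fproper_sub D'D.
pose z : Omega := glue a point.
rewrite (cardfsD1 x) xD /= exprS.
have lb : gint D (fun w' => delta * ind R (restr D' z) w') w <= gcond a w.
  rewrite -gint_ind -(@gint_gint [fset x]%fset D (ind R a)) ?fsub1set //;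
    last exact: ind_cont.
  apply: (state_le (gint_state D w)).
  - by apply: cont_mul; [exact: cont_cst|exact: ind_cont].
  - by apply: gint_cont; exact: ind_cont.
  move=> w'; rewrite {1}/ind; have [e|_] := eqP; last first.
    rewrite mulr0; apply: (state_ge0 (gint_state _ w')); first exact: ind_cont.
    exact: ind_ge0.
  rewrite mulr1 /gint (bigD1 (restr [fset x]%fset z)) //=.
  apply: ler_wpDr.
    by apply: sumr_ge0 => b _; rewrite mulr_ge0 ?gcond_ge0 ?ind_ge0.
  have -> : ind R a (glue (restr [fset x]%fset z) w') = 1.
    rewrite /ind (_ : (_ == _) = true) //; apply/eqP.
    rewrite -[RHS](restr_glue a point); apply/restr_eqP => y yD.
    have [yx|yx] := boolP (y \in [fset x]%fset).
      by rewrite (glue_in _ _ yx) ffunE.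
    rewrite glueE //; move/restr_eqP: e; apply.
    by rewrite !inE yD andbT; rewrite inE in yx.
  by rewrite mulr1.
apply: le_trans lb; rewrite (stateZ (gint_state D w)); last exact: ind_cont.
rewrite ler_pM2l // -(@gint_gint D' D) //; last exact: ind_cont.
rewrite -[leLHS](state_cst (gint_state D w)).
apply: (state_le (gint_state D w)); first exact: cont_cst.
  by apply: gint_cont; exact: ind_cont.
by move=> w'; rewrite gint_ind; apply: IH.
Qed.

Lemma gcond_gt0 (D : {fset site d}) (a : {ffun D -> spin q}) w : 0 < gcond a w.
Proof.
have [delta d0 h] := gcond_lb; apply: lt_le_trans (h D a w).
exact: exprn_gt0.
Qed.

(* The density, with respect to any Gibbs measure mu, of the image of u mu under
   glue xi; see push_dual. *)
Definition push (D : {fset site d}) (xi : {ffun D -> spin q}) u : Omega -> R :=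
  fun w => ind R xi w * gint D u w / gcond xi w.

Lemma push_cont (D : {fset site d}) (xi : {ffun D -> spin q}) u :
  continuous u -> continuous (push xi u).
Proof.
move=> cu; apply: cont_mul.
  by apply: cont_mul; [exact: ind_cont|exact: gint_cont].
apply: cont_inv; first exact: gcond_cont.
by move=> w; rewrite gt_eqF // gcond_gt0.
Qed.

Variables (mu : probability Omega R) (mu_Gibbs : Gibbs gam mu).

Let I := pstate mu.
Let mu1 : mu setT = 1%E := probability_setT mu.
Let sI : state I := pstateP mu1.

Lemma Gibbs_gcond (D : {fset site d}) (xi : {ffun D -> spin q}) :
  I (gcond xi) = I (ind R xi).
Proof.
have := mu_Gibbs xi; have e1 : mu (cyl xi) = (I (ind R xi))%:E := pstate_ind mu1 xi.
rewrite e1 => e2; have [] : (I (gcond xi))%:E = (I (ind R xi))%:E => //.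
rewrite -e2 -(pstate_fin mu1); last exact: gcond_cont.
by apply: eq_integral => w _; rewrite gcond_EFin.
Qed.

Lemma DLR_local (U : {fset site d}) F : local U F -> I (gint U F) = I F.
Proof.
move=> lF; rewrite (state_local sI lF).
have -> : gint U F = fun w =>
    \sum_(a : {ffun U -> spin q}) F (glue a point) * gcond a w.
  apply/funext => w; apply: eq_bigr => a _; rewrite mulrC; congr (_ * _).
  by apply: lF; rewrite !restr_glue.
rewrite (state_sum sI) => [|a _]; last first.
  by apply: cont_mul; [exact: cont_cst|exact: gcond_cont].
apply: eq_bigr => a _; rewrite (stateZ sI); last exact: gcond_cont.
by rewrite Gibbs_gcond.
Qed.

(* Gibbs only speaks of cylinders over the kernel's own volume: a larger volume V
   is reached by consistency, after approximating gint D F by V-local functions. *)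
Lemma DLR (D : {fset site d}) F : continuous F -> I (gint D F) = I F.
Proof.
move=> cF; apply: (@state_ext R q d D (fun F => I (gint D F)) I) => //.
  split=> [a G H cG cH|G cG G0|].
  - rewrite -(state_lin sI); [|exact: gint_cont..].
    congr (I _); apply/funext => w'.
    by rewrite (state_lin (gint_state D w')).
  - apply: (state_ge0 sI); first exact: gint_cont.
    by move=> w'; apply: (state_ge0 (gint_state D w')).
  - rewrite -[RHS](state1 sI); congr (I _).
    by apply/funext => w'; exact: (state1 (gint_state D w')).
move=> W xi DW; have cI := @ind_cont R q d W xi.
have cG := gint_cont (D := D) cI.
apply/eqP; rewrite -subr_eq0 -normr_le0.
apply/ler_addgt0Pr => e e0; rewrite add0r.
have e2 : 0 < e / 2 by rewrite divr_gt0.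
have [U /(_ _ (fsubsetUl U W)) [G lG FG]] := continuous_locapprox cG e2.
set V := (U `|` W)%fset in lG.
have cGG := local_continuous lG.
have h1 := state_close sI cG cGG FG.
have h2 : `|I (gint V G) - I (gint V (gint D (ind R xi)))| <= e / 2.
  apply: (state_close sI); [exact: gint_cont..|move=> w].
  apply: (state_close (gint_state V w)) => //.
  by move=> w'; rewrite distrC.
have e3 : gint V (gint D (ind R xi)) = gint V (ind R xi).
  apply/funext => w; apply: gint_gint => //.
  by apply: fsubset_trans DW _; exact: fsubsetUr.
rewrite e3 (DLR_local lG) in h2.
have e4 : I (gint V (ind R xi)) = I (ind R xi).
  by apply/DLR_local/(localS _ (@ind_local R q d W xi))/fsubsetUr.
rewrite e4 in h2; rewrite (splitr e) -[X in `|X|](subrKA (I G)).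
by rewrite (le_trans (ler_normD _ _)) // lerD.
Qed.

(** Both sides are averaged over the spins in [D]. On the left [v] is then frozen and [u] averaged;
    on the right only the configuration [xi] survives, and its weight cancels the denominator of
    [push]. *)
Lemma push_dual (D : {fset site d}) (xi : {ffun D -> spin q}) u v :
  continuous u -> continuous v ->
  I (fun w => u w * v (glue xi w)) = I (fun w => push xi u w * v w).
Proof.
move=> cu cv; rewrite -(@DLR D) -1?[RHS](@DLR D); last first.
- by apply: cont_mul => //; exact: cont_glue.
- by apply: cont_mul => //; exact: push_cont.
congr (I _); apply/funext => w.
rewrite /gint [RHS](bigD1 xi) //= [X in _ = _ + X]big1 ?addr0; last first.
  move=> a axi; rewrite /push /ind restr_glue (negbTE axi).
  by rewrite !mul0r mulr0.
rewrite /push /ind restr_glue eqxx mul1r gcond_glue.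
rewrite mulrA [gcond xi w * _]mulrC divfK ?gt_eqF ?gcond_gt0 //.
rewrite /gint mulr_suml; apply: eq_bigr => a _.
by rewrite !glue_glue !gcond_glue mulrA.
Qed.

Lemma Gibbs_ind_gt0 (W : {fset site d}) (xi : {ffun W -> spin q}) :
  0 < I (ind R xi).
Proof.
have [delta d0 h] := gcond_lb.
rewrite -Gibbs_gcond; apply: (@lt_le_trans _ _ (delta ^+ #|` W|)).
  exact: exprn_gt0.
rewrite -[leLHS](state_cst sI); apply: (state_le sI) => //.
  exact: cont_cst.
exact: gcond_cont.
Qed.

(** A continuous function that is nonzero at a point keeps half its size on a cylinder, and every
    cylinder has positive mass. *)
Lemma Gibbs_full_support F : continuous F -> I (fun w => F w * F w) = 0 ->
  F = fun=> 0.
Proof.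
move=> cF IF; apply/funext => w; apply/eqP/contraT => Fw.
have e0 : 0 < `|F w| / 2 by rewrite divr_gt0 // normr_gt0.
have [W hW] := (iffLR (continuous_qlocP F) cF) _ e0.
pose a := (`|F w| / 2) ^+ 2.
have : I (fun w' => a * ind R (restr W w) w') <= I (fun w => F w * F w).
  apply: (state_le sI).
  - by apply: cont_mul; [exact: cont_cst|exact: ind_cont].
  - exact: cont_mul.
  move=> w'; rewrite /ind; case: eqP => [e|_]; last by rewrite mulr0 -expr2 sqr_ge0.
  rewrite mulr1 /a -expr2 -(real_normK (num_real (F w'))).
  rewrite ler_pXn2r ?nnegrE ?(ltW e0) //.
  have := hW _ _ e => h; have := ler_normD (F w - F w') (F w').
  rewrite subrK distrC => h2; have := splitr `|F w|; lra.
rewrite IF (stateZ sI); last exact: ind_cont.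
rewrite leNgt => /negP[]; apply: mulr_gt0; last exact: Gibbs_ind_gt0.
by rewrite exprn_gt0.
Qed.

End specifications.

(** * The generator on local functions *)

Section shifts.
Variables (q d : nat).
Local Notation Omega := (config q (site d)).

Lemma mem_fshift (x y : site d) (D : {fset site d}) :
  (y \in fshift x D) = (y - x \in D).
Proof.
apply/imfsetP/idP => [[z /= zD ->]|yD]; first by rewrite addrK.
by exists (y - x); rewrite ?subrK.
Qed.

Lemma fshiftD (x y : site d) (D : {fset site d}) :
  fshift x (fshift y D) = fshift (x + y) D.
Proof. by apply/fsetP => z; rewrite !mem_fshift opprD addrA. Qed.

Lemma fshift0 (D : {fset site d}) : fshift 0 D = D.
Proof. by apply/fsetP => z; rewrite mem_fshift subr0. Qed.

Lemma fshiftK (x : site d) : cancel (fshift x) (fshift (- x)).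
Proof. by move=> D; rewrite fshiftD addNr fshift0. Qed.

Lemma fshiftVK (x : site d) : cancel (fshift (- x)) (fshift x).
Proof. by move=> D; rewrite fshiftD addrN fshift0. Qed.

Lemma tauVK (x : site d) : cancel (@tau q d (- x)) (tau x).
Proof. by move=> w; apply/funext => y; rewrite /tau opprK subrK. Qed.

Lemma restr_tau (x : site d) (W : {fset site d}) (w w' : Omega) :
  restr (fshift x W) (tau x w) = restr (fshift x W) (tau x w') <->
  restr W w = restr W w'.
Proof.
split=> /restr_eqP e; apply/restr_eqP => y.
  by move=> yW; have := e (y + x); rewrite mem_fshift /tau addrK; exact.
by rewrite mem_fshift => /e.
Qed.

Lemma glue_tau (x : site d) (D : {fset site d}) (z w : Omega) :
  tau x (glue (restr D z) w) = glue (restr (fshift x D) (tau x z)) (tau x w).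
Proof.
apply/funext => y; rewrite {1}/tau.
have [yD|yD] := boolP (y \in fshift x D).
  have yD' : y - x \in D by rewrite -mem_fshift.
  by rewrite (glue_in _ _ yD) (glue_in _ _ yD') !ffunE.
by rewrite (glueE _ _ yD) glueE // -mem_fshift.
Qed.

Definition ffshift (x : site d) (D : {fset site d}) (a : {ffun D -> spin q}) :
    {ffun fshift x D -> spin q} :=
  restr (fshift x D) (tau x (glue a point)).

Lemma ffshift_restr (x : site d) (D : {fset site d}) (w : Omega) :
  ffshift x (restr D w) = restr (fshift x D) (tau x w).
Proof. by apply/restr_tau; rewrite restr_glue. Qed.

Lemma ffshift_bij (x : site d) (D : {fset site d}) :
  bijective (@ffshift x D).
Proof.
exists (fun b => restr D (tau (- x) (glue b point))) => [a|b].
  rewrite -[RHS](restr_glue a point); apply/(restr_tau x).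
  by rewrite tauVK restr_glue.
by rewrite ffshift_restr tauVK restr_glue.
Qed.

Lemma glue_ffshift (x : site d) (D : {fset site d}) (a : {ffun D -> spin q})
    (w : Omega) :
  tau x (glue a w) = glue (ffshift x a) (tau x w).
Proof. by rewrite -{1}(restr_glue a point) glue_tau. Qed.

End shifts.

Section generator.
Variables (R : realType) (q d : nat).
Local Notation Omega := (config q (site d)).
Variable c : rates R q d.
Arguments c : clear implicits.
Implicit Types F G : Omega -> R.

Definition Ldelta (D : {fset site d}) F (w : Omega) : R :=
  \sum_(a : {ffun D -> spin q}) c D w a * (F (glue a w) - F w).

Lemma LtermE F w D : Lterm c F w D = (Ldelta D F w)%:E.
Proof. by []. Qed.

Lemma esum_finite (T : choiceType) (S : {fset T}) (a : T -> \bar R) :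
  (forall i, 0 <= a i)%E -> (forall i, i \notin S -> a i = 0%E) ->
  (\esum_(i in setT) a i = \sum_(i <- S) a i)%E.
Proof.
move=> a0 aS; transitivity (\esum_(i in [set` S]) a i)%E; last first.
  rewrite esum_fset //; rewrite fsbig_finite //=; by rewrite set_fsetK.
rewrite [RHS]esum_mkcond; apply: eq_esum => i _.
case: ifPn => // /negP iS; rewrite aS //; apply/negP => iS'; apply: iS.
exact: mem_set.
Qed.

Lemma Lop_finite (S : {fset {fset site d}}) F w :
  (forall D, D \notin S -> Ldelta D F w = 0) ->
  Lop c F w = \sum_(D <- S) Ldelta D F w.
Proof.
move=> h; rewrite /Lop.
rewrite (@esum_finite _ S); last 2 first.
- by move=> D; exact: funepos_ge0.
- by move=> D /h hD; rewrite funeposE LtermE hD maxxx.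
rewrite (@esum_finite _ S); last 2 first.
- by move=> D; exact: funeneg_ge0.
- by move=> D /h hD; rewrite funenegE LtermE hD oppe0 maxxx.
have -> : (\sum_(i <- S) (Lterm c F w)^\+ i =
    (\sum_(i <- S) Num.max (Ldelta i F w) 0)%:E)%E.
  by rewrite -sumEFin; apply: eq_bigr => i _; rewrite funeposE LtermE EFin_max.
have -> : (\sum_(i <- S) (Lterm c F w)^\- i =
    (\sum_(i <- S) Num.max (- Ldelta i F w) 0)%:E)%E.
  by rewrite -sumEFin; apply: eq_bigr => i _; rewrite funenegE LtermE EFin_max.
rewrite -EFinB /= -sumrB; apply: eq_bigr => i _.
by rewrite !maxEle; case: ifPn; case: ifPn; lra.
Qed.

Hypotheses (c_ge0 : nonneg_rates c) (hR1 : R1 c) (hR2 : R2 c) (hR4 : R4 c).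

Lemma rate_le_sup D eta xi : ((c D eta xi)%:E <= rate_sup c D)%E.
Proof.
apply: (@le_trans _ _ (supnorm (c D ^~ xi))).
  by apply: ereal_sup_ubound; exists eta => //; rewrite ger0_norm.
by apply: ereal_sup_ubound; exists xi.
Qed.

Lemma rate_sup_gt0 D eta xi : 0 < c D eta xi -> (0 < rate_sup c D)%E.
Proof. by move=> c0; apply: lt_le_trans (rate_le_sup eta xi); rewrite lte_fin. Qed.

Lemma rate_eq0 D eta xi : ~ (0 < rate_sup c D)%E -> c D eta xi = 0.
Proof.
move=> h; apply/eqP; rewrite eq_le c_ge0 andbT leNgt; apply/negP => c0.
by apply: h; exact: rate_sup_gt0 c0.
Qed.

Lemma rate_sup_shift x D : (0 < rate_sup c D)%E -> (0 < rate_sup c (fshift x D))%E.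
Proof.
move=> h; have [[[w xi] /= cp]|h'] := pselect (exists p : Omega * {ffun D -> spin q},
    0 < c D p.1 p.2).
  move: cp; rewrite -(restr_glue xi point) -(hR4 x).
  exact: rate_sup_gt0.
exfalso; move: h; rewrite ltNge => /negP; apply.
apply: ge_ereal_sup => _ [xi _ <-]; apply: ge_ereal_sup => _ [w _ <-].
rewrite lee_fin ger0_norm // leNgt; apply/negP => cp.
by apply: h'; exists (w, xi).
Qed.

(** Every nonempty volume with a nonzero rate is a translate of one of these. [fset_set] is empty on
    infinite sets; [R2] makes it faithful here. *)
Definition active0 : {fset {fset site d}} :=
  fset_set [set D : {fset site d} | 0 \in D /\ (0 < rate_sup c D)%E].

Lemma active0P D : (D \in active0) <-> (0 \in D) /\ (0 < rate_sup c D)%E.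
Proof. by rewrite in_fset_set // inE. Qed.

Definition touching (L : {fset site d}) : {fset {fset site d}} :=
  [fset fshift p.1 p.2 | p in (L `*` active0)%fset]%fset.

Lemma touchingP (L D : {fset site d}) : D \in touching L <->
  (0 < rate_sup c D)%E /\ exists2 x, x \in L & x \in D.
Proof.
split.
  move=> /imfsetP[[x D0] /=]; rewrite in_fsetM /= => /andP[xL /active0P[D00 D0c]] ->.
  split; first exact: rate_sup_shift.
  by exists x => //; rewrite mem_fshift subrr.
move=> [cD [x xL xD]]; apply/imfsetP => /=; exists (x, fshift (- x) D).
  rewrite in_fsetM /= xL /=; apply/active0P; split.
    by rewrite mem_fshift opprK add0r.
  exact: rate_sup_shift.
by rewrite /= fshiftVK.
Qed.

Lemma Ldelta_local0 (L D : {fset site d}) F w : local L F ->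
  D \notin touching L -> Ldelta D F w = 0.
Proof.
move=> lF DL; rewrite /Ldelta big1 // => xi _.
have [cD|cD] := pselect (0 < rate_sup c D)%E; last by rewrite rate_eq0 // mul0r.
rewrite (lF (glue xi w) w) ?subrr ?mulr0 //; apply/restr_eqP => x xL.
apply: glueE; apply/negP => xD; move/negP: DL; apply.
by apply/touchingP; split => //; exists x.
Qed.

Lemma Lop_local (L : {fset site d}) F w : local L F ->
  Lop c F w = \sum_(D <- touching L) Ldelta D F w.
Proof. by move=> lF; apply: Lop_finite => D; exact: Ldelta_local0. Qed.

Lemma Ldelta_cont D F : continuous F -> continuous (Ldelta D F).
Proof.
move=> cF; apply: cont_sum => xi _; apply: cont_mul; first exact: hR1.
by apply: cont_sub => //; exact: cont_glue.
Qed.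

Lemma Lop_local_cont (L : {fset site d}) F : local L F -> continuous (Lop c F).
Proof.
move=> lF; rewrite (_ : Lop c F = fun w => \sum_(D <- touching L) Ldelta D F w).
  by apply: cont_sum => D _; apply: Ldelta_cont; exact: local_continuous lF.
by apply/funext => w; exact: Lop_local.
Qed.

(* Each D is counted once from every site x of D in L, with weight 1 / |D cap L|. *)
Lemma touching_sum (L : {fset site d}) (a : {fset site d} -> R) :
  \sum_(D <- touching L) a D = \sum_(x <- L) \sum_(D0 <- active0)
    a (fshift x D0) / (#|` fshift x D0 `&` L|%fset)%:R.
Proof.
pose n (D : {fset site d}) : R := (#|` D `&` L|%fset)%:R.
have n0 D : D \in touching L -> n D != 0.
  move=> /touchingP[_ [x xL xD]]; rewrite pnatr_eq0 -lt0n cardfs_gt0.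
  by apply/fset0Pn; exists x; rewrite inE xD.
transitivity (\sum_(x <- L) \sum_(D0 <- active0) \sum_(D <- touching L | D == fshift x D0)
    a D / n D); last first.
  rewrite big_seq [RHS]big_seq; apply: eq_bigr => x xL.
  rewrite big_seq [RHS]big_seq; apply: eq_bigr => D0 D0r.
  rewrite -big_filter (_ : [seq _ <- _ | _] = [:: fshift x D0]) ?big_seq1 //.
  rewrite -[LHS]/(seq.filter (pred1 (fshift x D0)) (touching L)).
  rewrite filter_pred1_uniq ?fset_uniq //; apply/imfsetP; exists (x, D0) => //=.
  by rewrite in_fsetM xL.
under [RHS]eq_bigr do rewrite (exchange_big_dep xpredT) //=.
rewrite exchange_big /= big_seq [RHS]big_seq; apply: eq_bigr => D DL.
transitivity (\sum_(x <- L) (x \in D)%:R * (a D / n D)).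
  rewrite -mulr_suml -natr_sum.
  rewrite (_ : (\sum_(x <- L) (x \in D) = #|` D `&` L|%fset)%N).
    by rewrite mulrC divfK // n0.
  rewrite -big_mkcond /= sum1_count -size_filter; apply: perm_size.
  apply: uniq_perm; rewrite ?filter_uniq ?fset_uniq // => y.
  by rewrite mem_filter in_fsetI.
apply: eq_bigr => x _.
have eqD D0 : (D == fshift x D0) = (D0 == fshift (- x) D).
  by apply/eqP/eqP => ->; rewrite ?fshiftK ?fshiftVK.
under [RHS]eq_bigl do rewrite eqD.
rewrite -[RHS]big_filter; have [xD|xD] := boolP (x \in D).
  rewrite (_ : [seq _ <- _ | _] = [:: fshift (- x) D]) ?big_seq1 ?mul1r //.
  rewrite -[LHS]/(seq.filter (pred1 (fshift (- x) D)) active0).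
  rewrite filter_pred1_uniq ?fset_uniq //; apply/active0P; split.
    by rewrite mem_fshift opprK add0r.
  by apply: rate_sup_shift; have /touchingP[] := DL.
rewrite mul0r big_seq big1 // => D0; rewrite mem_filter => /andP[/eqP -> /active0P[]].
by rewrite mem_fshift opprK add0r (negbTE xD).
Qed.

End generator.

(** * Translation covariance of the semigroup *)

Section sup_norm.
Variables (R : realType) (q d : nat).
Local Notation Omega := (config q (site d)).
Implicit Types F G : Omega -> R.

Lemma supnorm_leP F (e : R) : (supnorm F <= e%:E)%E <-> forall w, `|F w| <= e.
Proof.
split=> [h w|h]; last by apply: ge_ereal_sup => _ [w _ <-]; rewrite lee_fin.
by rewrite -lee_fin; apply: le_trans h; apply: ereal_sup_ubound; exists w.
Qed.

Lemma supnorm_ge0 F : (0 <= supnorm F)%E.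
Proof.
apply: (@le_trans _ _ `|F point|%:E); first by rewrite lee_fin.
by apply: ereal_sup_ubound; exists point.
Qed.

Lemma supnorm_cvgP (T : Type) (A : set_system T) (FA : Filter A)
    (f : T -> Omega -> R) :
  (supnorm (f t) @[t --> A] --> 0%E) <->
  forall e, 0 < e -> \forall t \near A, forall w, `|f t w| <= e.
Proof.
split=> [h e e0|h U].
  have : nbhs (0%E : \bar R) [set x | (x <= e%:E)%E].
    rewrite /nbhs /=; exists e => //= r /=; rewrite sub0r normrN lee_fin => re.
    by apply: le_trans (ltW re); exact: ler_norm.
  move=> hn; have : A [set t | (supnorm (f t) <= e%:E)%E] := h _ hn.
  by apply: filterS => t /= /supnorm_leP.
rewrite /nbhs /= => -[e /= e0 he].
have e2 : 0 < e / 2 by rewrite divr_gt0.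
apply: filterS (h _ e2) => t /supnorm_leP ht; change (U (supnorm (f t))).
have := supnorm_ge0 (f t); move: ht; case: (supnorm (f t)) => //= r.
rewrite !lee_fin => re r0; apply: he => /=.
rewrite sub0r normrN ger0_norm // (le_lt_trans re) //.
by rewrite ltr_pdivrMr // ltr_pMr // ltr1n.
Qed.

Lemma near0P (A : R -> Prop) : (\forall t \near (0 : R)^'+, A t) <->
  exists2 rho, 0 < rho & forall t, 0 < t -> t < rho -> A t.
Proof.
split=> [[rho /= r0 h]|[rho r0 h]].
  exists rho => // t t0 tr; apply: h => //=.
  by rewrite sub0r normrN gtr0_norm.
exists rho => //= t /=; rewrite sub0r normrN => tr t0; apply: h => //.
by rewrite gtr0_norm in tr.
Qed.

Lemma continuous_max F : continuous F -> exists w0, forall w, `|F w| <= `|F w0|.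
Proof.
move=> cF; have [w1 _ h1] : exists2 c, c \in [set: Omega] &
    forall t, t \in [set: Omega] -> `|F t| <= `|F c|.
  apply: (@compact_EVT_max _ _ (fun w => `|F w|)).
  - by exists point.
  - exact: Omega_compact.
  - by apply: continuous_subspaceT; exact: cont_norm.
by exists w1 => w; apply: h1; rewrite inE.
Qed.

End sup_norm.

Section semigroup.
Variables (R : realType) (q d : nat).
Local Notation Omega := (config q (site d)).
Implicit Types F G f g : Omega -> R.
Variable P : R -> (Omega -> R) -> (Omega -> R).
Hypothesis hP : markov_semigroup P.

Lemma P_cont t f : 0 <= t -> continuous f -> continuous (P t f).
Proof. exact: semigroup_continuous. Qed.

Lemma P_state t w : 0 <= t -> state (fun f => P t f w).
Proof.
move=> t0; split=> [a F G cF cG|F cF F0|].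
- by rewrite (semigroup_linear hP).
- exact: (semigroup_ge0 hP).
- by rewrite (semigroup1 hP).
Qed.

Lemma P_norm t f e : 0 <= t -> continuous f -> (forall w, `|f w| <= e) ->
  forall w, `|P t f w| <= e.
Proof. by move=> t0 cf fe w; exact: (state_norm (P_state w t0)). Qed.

Lemma P_close t f g e : 0 <= t -> continuous f -> continuous g ->
  (forall w, `|f w - g w| <= e) -> forall w, `|P t f w - P t g w| <= e.
Proof. by move=> t0 cf cg fe w; exact: (state_close (P_state w t0)). Qed.

Lemma P_cont0 f e : continuous f -> 0 < e -> exists2 rho, 0 < rho &
  forall t, 0 <= t -> t < rho -> forall w, `|P t f w - f w| <= e.
Proof.
move=> cf e0; have /supnorm_cvgP/(_ _ e0) := semigroup_rcontinuous hP (lexx 0) cf.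
rewrite (semigroup0 hP cf) => /near0P[rho r0 h]; exists rho => // t.
rewrite le_eqVlt => /predU1P[<- _ w|t0 tr]; last exact: h.
by rewrite (semigroup0 hP cf) subrr normr0 ltW.
Qed.

Definition gen f g : Prop := [/\ continuous f, continuous g &
  forall e, 0 < e -> exists2 rho, 0 < rho & forall h, 0 < h -> h < rho ->
    forall w, `|P h f w - f w - h * g w| <= e * h].

Lemma genP f g : continuous f -> continuous g -> generator_graph P f g <-> gen f g.
Proof.
move=> cf cg.
have eqh h w : 0 < h -> `|P h f w - f w - h * g w| =
    `|h^-1 * (P h f w - f w) - g w| * h.
  move=> h0.
  have -> : P h f w - f w - h * g w = (h^-1 * (P h f w - f w) - g w) * h.
    by field; rewrite gt_eqF.
  by rewrite normrM (gtr0_norm h0).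
split=> [/supnorm_cvgP hg|[_ _ hg]].
  split => // e /hg/near0P[rho r0 hr]; exists rho => // h h0 hrho w.
  by rewrite eqh // ler_pM2r //; exact: hr.
apply/supnorm_cvgP => e /hg[rho r0 hr]; apply/near0P; exists rho => // h h0 hrho w.
by have := hr h h0 hrho w; rewrite eqh // ler_pM2r.
Qed.

Lemma gen_P u f g : 0 <= u -> gen f g -> gen (P u f) (P u g).
Proof.
move=> u0 [cf cg hg]; split; [exact: P_cont..|].
move=> e /hg[rho r0 hr]; exists rho => // h h0 hrho w.
have h0' := ltW h0.
have s := P_state w u0.
rewrite -(semigroupD hP h0' u0 cf) [h + u]addrC (semigroupD hP u0 h0' cf).
have cPf := P_cont h0' cf.
rewrite -(stateB s cPf cf) -(stateZ s _ cg) -(stateB s); last first.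
- by apply: cont_mul => //; exact: cont_cst.
- exact: cont_sub.
apply: (state_norm s); last exact: hr.
by apply: cont_sub; [exact: cont_sub|apply: cont_mul => //; exact: cont_cst].
Qed.

Lemma gen_sub f g f' g' : gen f g -> gen f' g' ->
  gen (fun w => f w - f' w) (fun w => g w - g' w).
Proof.
move=> [cf cg hg] [cf' cg' hg']; split; [exact: cont_sub..|].
move=> e e0; have e2 : 0 < e / 2 by rewrite divr_gt0.
have [r1 r10 h1] := hg _ e2; have [r2 r20 h2] := hg' _ e2.
exists (Num.min r1 r2); first by rewrite lt_min r10.
move=> h h0; rewrite lt_min => /andP[hr1 hr2] w.
rewrite (stateB (P_state w (ltW h0)) cf cf').
have -> : P h f w - P h f' w - (f w - f' w) - h * (g w - g' w) =
  (P h f w - f w - h * g w) - (P h f' w - f' w - h * g' w) by ring.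
rewrite (le_trans (ler_normB _ _)) // (splitr e) mulrDl lerD //.
  exact: h1.
exact: h2.
Qed.

(** Contractivity of the resolvent. At a point w0 where |f| is maximal, (r + h) f(w0) equals r (f -
    h g)(w0) + h P_r f(w0) up to an error r e, and |P_r f| does not exceed |f(w0)|. *)
Lemma gen_dissipative f g h M : gen f g -> 0 < h ->
  (forall w, `|f w - h * g w| <= M) -> forall w, `|f w| <= M.
Proof.
move=> [cf cg hg] h0 hM; have [w0 hw0] := continuous_max cf.
suff : `|f w0| <= M by move=> h1 w; exact: le_trans (hw0 w) h1.
apply/ler_addgt0Pr => e e0; have eh : 0 < e / h by rewrite divr_gt0.
have [rho r0 hr] := hg _ eh; pose r := rho / 2.
have rpos : 0 < r by rewrite divr_gt0.
have rr : r < rho by rewrite ltr_pdivrMr // ltr_pMr // ltr1n.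
have h1 := hr r rpos rr w0; have h2 := hM w0.
have h3 := P_norm (ltW rpos) cf hw0 w0.
have : `|(r + h) * f w0| <= r * M + h * `|f w0| + r * e.
  have -> : (r + h) * f w0 = r * (f w0 - h * g w0) + h * P r f w0
      - h * (P r f w0 - f w0 - r * g w0) by ring.
  rewrite (le_trans (ler_normB _ _)) // lerD //.
    rewrite (le_trans (ler_normD _ _)) // lerD // normrM gtr0_norm // ler_pM2l //.
  rewrite normrM gtr0_norm //.
  have -> : r * e = h * (e / h * r) by field; rewrite gt_eqF.
  by rewrite ler_pM2l.
rewrite normrM gtr0_norm ?addr_gt0 // => h4.
have : r * `|f w0| <= r * (M + e).
  rewrite -(lerD2r (h * `|f w0|)) -mulrDl (le_trans h4) //.
  by rewrite le_eqVlt; apply/orP; left; apply/eqP; ring.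
by rewrite ler_pM2l.
Qed.

(** The generator is taken at the end of the step, as backward Euler and [gen_dissipative] require;
    the error is uniform in [u] because [P u] is a contraction. *)
Lemma gen_step f g e : gen f g -> 0 < e -> exists2 rho, 0 < rho &
  forall u h, 0 <= u -> 0 < h -> h < rho -> forall w,
    `|P (u + h) f w - P u f w - h * P (u + h) g w| <= e * h.
Proof.
move=> [cf cg hg] e0; have e2 : 0 < e / 2 by rewrite divr_gt0.
have [r1 r10 h1] := hg _ e2; have [r2 r20 h2] := P_cont0 cg e2.
exists (Num.min r1 r2); first by rewrite lt_min r10.
move=> u h u0 h0; rewrite lt_min => /andP[hr1 hr2] w.
have h0' := ltW h0; have s := P_state w u0.
rewrite !(semigroupD hP u0 h0') //.
have cPf := P_cont h0' cf; have cPg := P_cont h0' cg.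
have chPg : continuous (fun w => h * P h g w).
  by apply: cont_mul => //; exact: cont_cst.
rewrite -(stateB s cPf cf) -(stateZ s _ cPg) -(stateB s) //; last exact: cont_sub.
apply: (state_norm s); first by apply: cont_sub => //; exact: cont_sub.
move=> w'.
have -> : P h f w' - f w' - h * P h g w' =
  (P h f w' - f w' - h * g w') - h * (P h g w' - g w') by ring.
rewrite (le_trans (ler_normB _ _)) // (splitr e) mulrDl lerD //; first exact: h1.
by rewrite normrM gtr0_norm // mulrC ler_pM2r // h2.
Qed.

Section generated.
Variable c : rates R q d.
Hypotheses (c_ge0 : nonneg_rates c) (hR1 : R1 c) (hR2 : R2 c) (hR4 : R4 c).
Hypothesis hPc : generated_by P c.

Lemma core_local (L : {fset site d}) F : local L F -> core F.
Proof.
move=> lF; have cF := local_continuous lF; split => //.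
have [M M0 hM] := continuous_bounded cF.
have o0 x : (0 <= osc x F)%E.
  apply: (@le_trans _ _ `|F point - F point|%:E); first by rewrite lee_fin.
  by apply: ereal_sup_ubound; exists (point, point).
rewrite (@esum_finite _ _ L) //.
  rewrite big_seq lte_sum_pinfty // => x _.
  apply: (@le_lt_trans _ _ (M + M)%:E); last exact: ltry.
  apply: ge_ereal_sup => _ [p _ <-]; rewrite lee_fin.
  by rewrite (le_trans (ler_normB _ _)) // lerD.
move=> x xL; apply/eqP; rewrite eq_le o0 andbT.
apply: ge_ereal_sup => _ [p /= hp <-].
rewrite (lF p.1 p.2) ?subrr ?normr0 //.
by apply/restr_eqP => y yL; apply: hp; apply: contraNneq xL => <-.
Qed.

Lemma gen_local (L : {fset site d}) F : local L F -> gen F (Lop c F).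
Proof.
move=> lF; have cF := local_continuous lF.
have cL := Lop_local_cont c_ge0 hR1 hR2 hR4 lF.
apply/genP => //; apply/hPc => //; exists (fun=> F); split.
- by move=> _; exact: core_local lF.
- apply/supnorm_cvgP => e e0; apply: nearW => n w.
  by rewrite subrr normr0 ltW.
- apply/supnorm_cvgP => e e0; apply: nearW => n w.
  by rewrite subrr normr0 ltW.
Qed.

Lemma Ldelta_tau x D F w :
  Ldelta c D (fun w => F (tau x w)) w = Ldelta c (fshift x D) F (tau x w).
Proof.
rewrite /Ldelta [RHS](reindex (@ffshift q d x D)) /=; last first.
  exact/onW_bij/ffshift_bij.
apply: eq_bigr => a _; rewrite glue_ffshift; congr (_ * _).
by rewrite -{1}(restr_glue a point) -(hR4 x).
Qed.

Lemma Lop_tau x F w : Lop c (fun w => F (tau x w)) w = Lop c F (tau x w).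
Proof.
have bij : set_bij setT setT (@fshift d x).
  split=> //; first by move=> D D' _ _ /(can_inj (fshiftK x)).
  by move=> D _; exists (fshift (- x) D) => //; exact: fshiftVK.
rewrite /Lop; congr (fine (_ - _)%E); rewrite [RHS](reindex_esum _ _ _ _ bij);
  apply: eq_esum => D _.
  by rewrite !funeposE !LtermE Ldelta_tau.
by rewrite !funenegE !LtermE Ldelta_tau.
Qed.

Lemma osc_tau x y F : osc y (fun w => F (tau x w)) = osc (y + x) F.
Proof.
rewrite /osc; congr ereal_sup; apply/seteqP; split=> _ [p hp <-].
  exists (tau x p.1, tau x p.2) => //= z zy; rewrite /tau; apply: hp.
  by apply: contraNneq zy => <-; rewrite subrK.
exists (tau (- x) p.1, tau (- x) p.2); last by rewrite /= !tauVK.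
move=> z zy; rewrite /= /tau opprK; apply: hp.
by apply: contraNneq zy => /addIr ->.
Qed.

Lemma core_tau x F : core F -> core (fun w => F (tau x w)).
Proof.
move=> [cF oF]; split; first exact: cont_tau.
have bij : set_bij setT setT (fun y : site d => y + x).
  split=> //; first by move=> D D' _ _ /addIr.
  by move=> y _; exists (y - x) => //; rewrite subrK.
rewrite (reindex_esum _ _ _ _ bij) in oF.
apply: le_lt_trans oF; rewrite le_eqVlt; apply/orP; left; apply/eqP.
by apply: eq_esum => y _; rewrite osc_tau.
Qed.

(** The generator is the closure of [Lop c] on [core], and both the core and the operator are
    translation covariant. *)
Lemma gen_tau x f g : gen f g ->
  gen (fun w => f (tau x w)) (fun w => g (tau x w)).
Proof.
move=> gfg; have [cf cg _] := gfg.
have /(hPc cf cg)[f_ [h1 h2 h3]] : generator_graph P f g by apply/genP.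
apply/genP; [exact: cont_tau..|]; apply/hPc; [exact: cont_tau..|].
exists (fun n w => f_ n (tau x w)); split.
- by move=> n; exact: core_tau.
- apply/supnorm_cvgP => e; move/supnorm_cvgP: h2 => h2 /h2.
  by apply: filterS => n h w.
- apply/supnorm_cvgP => e; move/supnorm_cvgP: h3 => h3 /h3.
  by apply: filterS => n h w; rewrite Lop_tau.
Qed.

(* z u = P_u (f tau) - (P_u f) tau starts from 0 and solves the evolution equation,
   so backward Euler steps and dissipativity keep it at 0. *)
Lemma P_tau_gen x f g t : 0 <= t -> gen f g ->
  P t (fun w => f (tau x w)) = (fun w => P t f (tau x w)).
Proof.
move=> t0 gfg; have gfg' := gen_tau x gfg.
have [cf cg _] := gfg; have [cf' cg' _] := gfg'.
pose z u w := P u (fun w => f (tau x w)) w - P u f (tau x w).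
pose y u w := P u (fun w => g (tau x w)) w - P u g (tau x w).
have gz u : 0 <= u -> gen (z u) (y u).
  move=> u0; apply: gen_sub; first exact: gen_P.
  exact: (gen_tau x (gen_P u0 gfg)).
suff z0 e : 0 < e -> forall w, `|z t w| <= t * e.
  apply/funext => w; apply/eqP; rewrite -subr_eq0 -normr_le0.
  apply/ler_addgt0Pr => e e0; rewrite add0r.
  have t1 : 0 < t + 1 by rewrite ltr_wpDl.
  apply: le_trans (z0 (e / (t + 1)) _ w) _; first by rewrite divr_gt0.
  by rewrite mulrCA ger_pMr // ler_pdivrMr // mul1r lerDl.
move=> e0; have e2 : 0 < e / 2 by rewrite divr_gt0.
have [r1 r10 h1] := gen_step gfg e2; have [r2 r20 h2] := gen_step gfg' e2.
(* Two errors [e / 2 * h], one for each semigroup term, separate [z (u + h) - h * y (u + h)] from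
   [z u]. *)
have step u h M : 0 <= u -> 0 < h -> h < Num.min r1 r2 ->
    (forall w, `|z u w| <= M) -> forall w, `|z (u + h) w| <= M + h * e.
  move=> u0 h0; rewrite lt_min => /andP[hr1 hr2] hM.
  apply: (gen_dissipative (gz (u + h) _) h0); first by rewrite addr_ge0 // ltW.
  move=> w; rewrite /z /y.
  set A1 := P (u + h) _ w; set A2 := P (u + h) f _.
  set B1 := P (u + h) _ w; set B2 := P (u + h) g _.
  have k1 := h1 u h u0 h0 hr1 (tau x w); have k2 := h2 u h u0 h0 hr2 w.
  rewrite -/A1 -/A2 -/B1 -/B2 in k1 k2; have k3 := hM w; rewrite /z in k3.
  move: k1 k2 k3; rewrite !ler_norml => /andP[k1 k1'] /andP[k2 k2'] /andP[k3 k3'].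
  have : e * h = e / 2 * h + e / 2 * h by field.
  by move=> eh; apply/andP; split; lra.
have r0 : 0 < Num.min r1 r2 by rewrite lt_min r10.
pose n := (Num.truncn (t / Num.min r1 r2)).+1.
pose h := t / n%:R.
have hr : h < Num.min r1 r2.
  by rewrite ltr_pdivrMr ?ltr0n // mulrC -ltr_pdivrMr // /n truncnS_gt.
have hn : t = n%:R * h by rewrite mulrC divfK // pnatr_eq0.
move: t0; rewrite le_eqVlt => /predU1P[t0|t0].
  move=> w; rewrite -t0 mul0r /z !(semigroup0 hP) //.
  by rewrite subrr normr0.
have h0 : 0 < h by rewrite divr_gt0 // ltr0n.
suff claim k w : `|z (k%:R * h) w| <= k%:R * h * e by rewrite hn.
elim: k w => [|k IH] w.
  by rewrite !mul0r /z !(semigroup0 hP) // subrr normr0.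
rewrite mulrSr mulrDl mul1r mulrDl; apply: step => //.
by rewrite mulr_ge0 // ltW.
Qed.

Lemma P_tau x F t : 0 <= t -> continuous F ->
  P t (fun w => F (tau x w)) = (fun w => P t F (tau x w)).
Proof.
move=> t0 cF; apply/funext => w.
apply/eqP; rewrite -subr_eq0 -normr_le0.
apply/ler_addgt0Pr => e e0; rewrite add0r.
have e2 : 0 < e / 2 by rewrite divr_gt0.
have [W /(_ W (fsubset_refl _))[G lG FG]] := continuous_locapprox cF e2.
have cG := local_continuous lG.
have k1 := @P_close t _ _ _ t0 (@cont_tau _ _ _ x _ cF) (@cont_tau _ _ _ x _ cG)
  (fun w => FG (tau x w)) w.
have k2 := P_close t0 cF cG FG (tau x w).
have k3 : P t (fun w => G (tau x w)) w = P t G (tau x w).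
  by rewrite (P_tau_gen x t0 (gen_local lG)).
move: k1 k2; rewrite k3 !ler_norml => /andP[k1 k1'] /andP[k2 k2'].
by apply/andP; split; lra.
Qed.

End generated.
End semigroup.

(** * Entropy production *)

(* The tilt by s makes the bound -s (r - 1), whose mean is linear in the measure,
   available next to the leading term r - 1. *)
Lemma ln_tilt (R : realType) (r s : R) : 0 < r -> `|s| <= 1 / 2 ->
  ln r <= (1 - s) * (r - 1) + 2 * s ^+ 2.
Proof.
move=> r0; rewrite ler_norml => /andP[s1 s2].
have p1 : 0 < 1 - s by lra.
(* Write ln r = ln ((1 - s) r) + ln (1 / (1 - s)) and apply ln x <= x - 1 to each; |s| <= 1/2 gives
   s / (1 - s) <= s + 2 s^2, the source of the constant 2. *)
have h1 : ln ((1 - s) * r) <= (1 - s) * r - 1.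
  rewrite -{1}[_ * r](subrKC 1) le_ln1Dx //.
  by have := mulr_gt0 p1 r0; lra.
have h2 : ln ((1 - s)^-1) <= (1 - s)^-1 - 1.
  rewrite -{1}[_^-1](subrKC 1) le_ln1Dx //.
  by have i0 : 0 < (1 - s)^-1; [rewrite invr_gt0|lra].
rewrite lnM ?posrE // in h1; rewrite lnV ?posrE // in h2.
have h3 : (1 - s)^-1 - 1 <= s + 2 * s ^+ 2.
  have -> : (1 - s)^-1 - 1 = s / (1 - s) by field; rewrite gt_eqF.
  rewrite ler_pdivrMr // -subr_ge0.
  have -> : (s + 2 * s ^+ 2) * (1 - s) - s = s ^+ 2 * (1 - 2 * s) by ring.
  by rewrite mulr_ge0 ?sqr_ge0 //; lra.
have h4 : (1 - s) * (r - 1) = (1 - s) * r - 1 + s by ring.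
lra.
Qed.

Ltac cont_tac := lazymatch goal with
  | |- continuous (fun w => @?F w + @?G w) => apply: (@cont_add _ _ _ F G); cont_tac
  | |- continuous (fun w => @?F w * @?G w) => apply: (@cont_mul _ _ _ F G); cont_tac
  | |- continuous (fun w => - @?F w) => apply: (@cont_opp _ _ _ F); cont_tac
  | |- continuous (fun _ => ?a) => exact: cont_cst
  | |- continuous (fun w => ?f w) =>
      match goal with H : continuous f |- _ => exact: H end
  | |- _ => assumption
  end.

Section dissipation.
Variables (R : realType) (q d : nat).
Local Notation Omega := (config q (site d)).
Implicit Types (F G u v s : Omega -> R) (L W D : {fset site d}).
Variable c : rates R q d.
Arguments c : clear implicits.
Hypotheses (c_ge0 : nonneg_rates c) (hR1 : R1 c) (hR2 : R2 c) (hR4 : R4 c).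
Variables (gam : kernels R q d) (hgam : specification gam).
Hypotheses (hS1 : S1 gam) (hS2 : S2 gam) (hS4 : S4 gam).
Variables (mu : probability Omega R) (mu_Gibbs : Gibbs gam mu).

Let I := pstate mu.
Let sI : state I := pstateP (probability_setT mu).

Let I_gt0 W (xi : {ffun W -> spin q}) : 0 < I (ind R xi).
Proof. exact: (Gibbs_ind_gt0 hgam hS1 hS2 hS4 mu_Gibbs). Qed.

Definition dens (m : (Omega -> R) -> R) L : Omega -> R :=
  fun w => m (ind R (restr L w)) / I (ind R (restr L w)).

Lemma dens_local m L : local L (dens m L).
Proof. by move=> w w' e; rewrite /dens e. Qed.

Lemma dens_int m L G : state m -> local L G ->
  m G = I (fun w => dens m L w * G w).
Proof.
move=> sm lG; rewrite (state_local sm lG).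
rewrite (@state_local R q d I L (fun w => dens m L w * G w) sI); last first.
  by move=> w w' e; rewrite (lG _ _ e) (dens_local m e).
apply: eq_bigr => xi _; rewrite /dens restr_glue.
by rewrite mulrAC divfK 1?mulrC // gt_eqF // I_gt0.
Qed.

Definition half_dominates m := forall F, continuous F -> (forall w, 0 <= F w) ->
  I F / 2 <= m F.

Lemma dens_ge_half m L w : half_dominates m -> 1 / 2 <= dens m L w.
Proof.
move=> hm; rewrite /dens ler_pdivlMr ?I_gt0 // mulrC mulrA mulr1.
by apply: hm; [exact: ind_cont|exact: ind_ge0].
Qed.

Section one_term.
Variables (m : (Omega -> R) -> R) (sm : state m) (hm : half_dominates m).
Variables (L D : {fset site d}) (xi : {ffun D -> spin q}).

Let f := dens m L.
Let lf : local L f := @dens_local m L.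
Let f_gt0 w : 0 < f w.
Proof. by apply: lt_le_trans (dens_ge_half L w hm); rewrite divr_gt0. Qed.

(* The subtracted terms add up to the mu-mean of Lop f, which is 0. *)
Definition gain := m (fun w => c D w xi * (ln (f (glue xi w)) - ln (f w))) -
  I (fun w => c D w xi * (f (glue xi w) - f w)).

(** [f] represents [m] only on [L]-local functions, whereas the rates and [push] may depend on all
    spins. Each passage between [m] and [mu] goes through a local approximation, once to enter it
    and once to leave it, hence the doubled errors [ev] and [ev']. [K + 1] bounds the [mu]-mean of
    the density plus its shifted copy, the weight that [ev] multiplies. *)
Lemma gain_le s ev ev' K : continuous s -> (forall w, `|s w| <= 1 / 2) ->
  locapprox L (fun w => c D w xi * (1 - s w)) ev ->
  locapprox L (fun w => push gam xi (fun w => c D w xi * s w) w - c D w xi * s w) ev' ->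
  (forall w, push gam xi (fun=> 1) w <= K) ->
  gain <= - m (fun w => push gam xi (fun w => c D w xi * s w) w - c D w xi * s w)
    + 2 * m (fun w => c D w xi * s w ^+ 2) + 2 * ev' + 2 * ev * (K + 1).
Proof.
have arith1 (a b e x : R) : `|a - x| <= e -> x <= b + e * 1 -> - b <= - a + 2 * e.
  by rewrite ler_norml => /andP[]; lra.
have arith2 (a a1 a2 b b1 x y e E : R) : a <= a2 + 2 * y -> a2 <= b1 + E ->
    b1 = b - x -> - x <= - a1 + 2 * e -> a - b <= - a1 + 2 * y + 2 * e + E.
  lra.
move=> cs s2 [G lG vG] [G' lG' vG'] hK.
have cf : continuous f := local_continuous lf.
pose f' w := f (glue xi w).
have lf' : local L f' by move=> w w' e; apply: lf; exact: restr_glue_eq.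
have cf' : continuous f' := local_continuous lf'.
have f'_gt0 w : 0 < f' w by exact: f_gt0.
pose r w := f' w / f w.
have lr : local L r by move=> w w' e; rewrite /r (lf e) (lf' _ _ e).
have cr : continuous r := local_continuous lr.
have r_gt0 w : 0 < r w by rewrite divr_gt0.
have cG : continuous G := local_continuous lG.
have cG' : continuous G' := local_continuous lG'.
pose cc w := c D w xi.
have c_cc : continuous cc := @hR1 D xi.
pose v w := cc w * (1 - s w).
have cv : continuous v.
  by change (continuous (fun w => cc w * (1 - s w))); cont_tac.
pose u w := cc w * s w.
have cu : continuous u by change (continuous (fun w => cc w * s w)); cont_tac.
pose css w := cc w * s w ^+ 2.
have ccss : continuous css.
  by apply: cont_mul => //; rewrite /GRing.exp /=; exact: cont_mul.
have lln : local L (fun w => ln (f w)) by move=> w w' e; rewrite (lf e).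
have lln' : local L (fun w => ln (f' w)) by move=> w w' e; rewrite (lf' _ _ e).
have cln := local_continuous lln; have cln' := local_continuous lln'.
have c1 := @cont_cst R q d 1.
have ev0 : 0 <= ev by apply: le_trans (vG point).
have If : I f = 1.
  rewrite -(state1 sm) (dens_int sm (L := L)) //.
  by congr (I _); apply/funext => w; rewrite mulr1.
have pushD u0 v0 : continuous u0 -> continuous v0 ->
    I (fun w => u0 w * v0 (glue xi w)) = I (fun w => push gam xi u0 w * v0 w).
  exact: (push_dual hgam hS1 hS2 hS4 mu_Gibbs xi).
(* Moving the shift from [f] to the constant 1 makes [push gam xi (fun=> 1)] appear. *)
have If' : I f' <= K.
  have -> : I f' = I (fun w => push gam xi (fun=> 1) w * f w).
    rewrite -(pushD (fun=> 1) f) //; congr (I _); apply/funext => w.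
    by rewrite mul1r.
  apply: (@le_trans _ _ (I (fun w => K * f w))).
    apply: (state_le sI).
    - by apply: cont_mul; [apply: push_cont|].
    - cont_tac.
    - by move=> w; rewrite ler_pM2r.
  by rewrite (stateZ sI) // If mulr1.
have step1 : m (fun w => cc w * (ln (f' w) - ln (f w))) <=
    m (fun w => v w * (r w - 1)) + 2 * m css.
  rewrite -(stateZ sm) // -(stateD sm); last 2 first.
  - cont_tac.
  - cont_tac.
  apply: (state_le sm).
  - cont_tac.
  - cont_tac.
  move=> w; rewrite -ln_div ?posrE // -/(r w).
  have -> : v w * (r w - 1) + 2 * css w =
    cc w * ((1 - s w) * (r w - 1) + 2 * s w ^+ 2) by rewrite /v /css; ring.
  by apply: ler_wpM2l; [exact: c_ge0|exact: ln_tilt].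
have step2 : m (fun w => v w * (r w - 1)) <=
    I (fun w => v w * (f' w - f w)) + 2 * ev * (K + 1).
  have h1 : m (fun w => v w * (r w - 1)) <=
      m (fun w => G w * (r w - 1)) + ev * m (fun w => r w + 1).
    rewrite -(stateZ sm); last cont_tac.
    rewrite -(stateD sm); last 2 first.
    - cont_tac.
    - cont_tac.
    apply: (state_le sm).
    - cont_tac.
    - cont_tac.
    move=> w; rewrite -lerBlDl -mulrBl.
    apply: le_trans (ler_norm _) _; rewrite normrM; apply: ler_pM => //.
      exact: vG.
    rewrite (le_trans (ler_normB _ _)) // normr1 gtr0_norm //.
  have h2 : m (fun w => G w * (r w - 1)) = I (fun w => G w * (f' w - f w)).
    rewrite (dens_int sm (L := L)); last by move=> w w' e; rewrite (lG _ _ e) (lr _ _ e).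
    congr (I _); apply/funext => w; rewrite -/f /r.
    by field; rewrite gt_eqF.
  have h3 : m (fun w => r w + 1) = I f' + 1.
    rewrite (dens_int sm (L := L)); last by move=> w w' e; rewrite (lr _ _ e).
    transitivity (I f' + I f); last by rewrite If.
    rewrite -(stateD sI cf' cf).
    congr (I _); apply/funext => w; rewrite -/f /r.
    by field; rewrite gt_eqF.
  have h4 : I (fun w => G w * (f' w - f w)) <=
      I (fun w => v w * (f' w - f w)) + ev * (I f' + 1).
    rewrite -If -(stateD sI cf' cf) -(stateZ sI); last cont_tac.
    rewrite -(stateD sI); last 2 first.
    - cont_tac.
    - cont_tac.
    apply: (state_le sI).
    - cont_tac.
    - cont_tac.
    move=> w; rewrite -lerBlDl -mulrBl.
    apply: le_trans (ler_norm _) _; rewrite normrM; apply: ler_pM => //.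
      by rewrite distrC; exact: vG.
    by rewrite (le_trans (ler_normB _ _)) // !gtr0_norm.
  have h5 : ev * (I f' + 1) <= ev * (K + 1) by apply: ler_wpM2l; rewrite ?lerD2r.
  rewrite h2 h3 in h1; apply: (le_trans h1).
  rewrite -mulrA mulr_natl mulr2n addrA; apply: lerD => //.
  by apply: (le_trans h4); rewrite lerD2l.
pose v' w := push gam xi u w - u w.
have ctG : continuous (push gam xi u) by apply: push_cont.
have cv' : continuous v'.
  by change (continuous (fun w => push gam xi u w - u w)); cont_tac.
(* The untilted part is the subtracted term of [gain]; in the tilted part duality moves the shift
   from the density to [u]. *)
have step3 : I (fun w => v w * (f' w - f w)) =
    I (fun w => cc w * (f' w - f w)) - I (fun w => v' w * f w).
  have e1 : I (fun w => u w * f' w) = I (fun w => push gam xi u w * f w) by exact: pushD.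
  have e2 : I (fun w => v' w * f w) = I (fun w => u w * f' w) - I (fun w => u w * f w).
    rewrite e1 -(stateB sI); [|cont_tac..].
    by congr (I _); apply/funext => w; rewrite mulrBl.
  rewrite e2 -(stateB sI); [|cont_tac..].
  rewrite -(stateB sI); last 2 first.
  - cont_tac.
  - cont_tac.
  by congr (I _); apply/funext => w; rewrite /v /u; ring.
have step4 : - I (fun w => v' w * f w) <= - m v' + 2 * ev'.
  have k1 : `|m v' - m G'| <= ev' by exact: (state_close sm).
  have k2 : m G' = I (fun w => G' w * f w).
    rewrite (dens_int sm lG'); congr (I _); apply/funext => w.
    by rewrite mulrC.
  have k3 : I (fun w => G' w * f w) <= I (fun w => v' w * f w) + ev' * 1.
    rewrite -If -(stateZ sI) // -(stateD sI); last 2 first.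
    - cont_tac.
    - cont_tac.
    apply: (state_le sI).
    - cont_tac.
    - cont_tac.
    move=> w; rewrite -mulrDl ler_pM2r //.
    by rewrite -lerBlDl (le_trans (ler_norm _)) // distrC; exact: vG'.
  by rewrite -k2 in k3; exact: arith1 k1 k3.
exact: (arith2 _ _ _ _ _ _ _ _ _ step1 step2 step3 step4).
Qed.

End one_term.
End dissipation.

Lemma seq_window (K : choiceType) (T : eqType) (r : seq T)
    (Q : T -> {fset K} -> Prop) :
  (forall t, t \in r -> exists W : {fset K}, forall L : {fset K}, (W `<=` L)%fset -> Q t L) ->
  exists W : {fset K}, forall L : {fset K}, (W `<=` L)%fset -> forall t, t \in r -> Q t L.
Proof.
elim: r => [|t r IH] h; first by exists fset0.
have [t' t'r|W hW] := IH; first by apply: h; rewrite inE t'r orbT.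
have [V hV] := h t (mem_head _ _).
exists (V `|` W)%fset => L; rewrite fsubUset => /andP[VL WL] t'.
by rewrite inE => /predU1P[->|]; [exact: hV|exact: hW].
Qed.

(** * Entropy production in large volumes *)

Section production.
Variables (R : realType) (q d : nat).
Local Notation Omega := (config q (site d)).
Implicit Types (F G u v s : Omega -> R) (L W D : {fset site d}).
Implicit Type m : (Omega -> R) -> R.
Variable c : rates R q d.
Arguments c : clear implicits.
Hypotheses (c_ge0 : nonneg_rates c) (hR1 : R1 c) (hR2 : R2 c) (hR4 : R4 c).
Variables (gam : kernels R q d) (hgam : specification gam).
Hypotheses (hS1 : S1 gam) (hS2 : S2 gam) (hS4 : S4 gam).
Variables (mu : probability Omega R) (mu_Gibbs : Gibbs gam mu).

Let I := pstate mu.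
Let sI : state I := pstateP (probability_setT mu).

(* Under mu, and under any measure with the same conditional probabilities, the
   mean of rdefect xi s is 0. *)
Definition rdefect D (xi : {ffun D -> spin q}) s : Omega -> R := fun w =>
  push gam xi (fun w => c D w xi * s w) w - c D w xi * s w.

(** What a tilt [s] extracts from one transition: a part linear in [s], minus the quadratic price
    from [ln_tilt]. *)
Definition rgain D (xi : {ffun D -> spin q}) s : Omega -> R := fun w =>
  rdefect xi s w - 2 * (c D w xi * s w ^+ 2).

Lemma rdefect_cont D (xi : {ffun D -> spin q}) s :
  continuous s -> continuous (rdefect xi s).
Proof.
move=> cs; have cu : continuous (fun w => c D w xi * s w).
  by apply: cont_mul; [exact: hR1|exact: cs].
by apply: cont_sub; [apply: push_cont|exact: cu].
Qed.

Lemma css_cont D (xi : {ffun D -> spin q}) s :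
  continuous s -> continuous (fun w => c D w xi * s w ^+ 2).
Proof. by move=> cs; apply: cont_mul; [exact: hR1|exact: (cont_mul cs cs)]. Qed.

Lemma rgain_cont D (xi : {ffun D -> spin q}) s :
  continuous s -> continuous (rgain xi s).
Proof.
move=> cs; apply: cont_sub; first exact: rdefect_cont.
by apply: cont_mul; [exact: cont_cst|exact: css_cont].
Qed.

Lemma rdefect0 D (xi : {ffun D -> spin q}) : rdefect xi (fun=> 0) = fun=> 0.
Proof.
apply/funext => w; rewrite /rdefect mulr0 subr0 /push /gint.
by rewrite big1 ?mulr0 ?mul0r // => a _; rewrite !mulr0.
Qed.

Lemma rgain0 D (xi : {ffun D -> spin q}) : rgain xi (fun=> 0) = fun=> 0.
Proof.
by apply/funext => w; rewrite /rgain rdefect0 expr0n !mulr0 subr0.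
Qed.

Definition production D L m : R :=
  m (Ldelta c D (fun w => ln (dens mu m L w))) - I (Ldelta c D (dens mu m L)).

Lemma productionE D L m : state m -> half_dominates mu m ->
  production D L m = \sum_(xi : {ffun D -> spin q}) gain c mu m L xi.
Proof.
move=> sm hm.
have lf : local L (dens mu m L) by exact: dens_local.
have cf := local_continuous lf.
have cln : continuous (fun w => ln (dens mu m L w)).
  by apply: (@local_continuous _ _ _ L) => w w' e; rewrite (lf _ _ e).
rewrite /production /gain sumrB; congr (_ - _).
  rewrite -(state_sum sm) // => xi _; apply: cont_mul; first exact: hR1.
  by apply: cont_sub; [exact: (cont_glue (xi := xi) cln)|exact: cln].
rewrite -(state_sum sI) // => xi _; apply: cont_mul; first exact: hR1.
by apply: cont_sub; [exact: (cont_glue (xi := xi) cf)|exact: cf].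
Qed.

Lemma push1_bound D (xi : {ffun D -> spin q}) :
  exists2 K, 0 <= K & forall w, push gam xi (fun=> 1) w <= K.
Proof.
have : continuous (push gam xi (fun=> 1)) by apply: push_cont => //; exact: cont_cst.
move=> /continuous_bounded[K K0 hK]; exists K => // w.
by apply: le_trans (hK w); exact: ler_norm.
Qed.

Lemma gain_window D (xi : {ffun D -> spin q}) s e :
  continuous s -> (forall w, `|s w| <= 1 / 2) -> 0 < e ->
  exists W, forall L, (W `<=` L)%fset -> forall m, state m -> half_dominates mu m ->
    gain c mu m L xi <= e - m (rgain xi s).
Proof.
move=> cs s2 e0; have [K K0 hK] := push1_bound xi.
have K1 : 0 < K + 1 by rewrite ltr_wpDl.
(* Each approximation error enters [gain_le] twice: half of [e] is spent on the rate, weighted by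
   [K + 1], and half on the defect. *)
have e1 : 0 < e / 4 by rewrite divr_gt0.
have e2 : 0 < e / 4 / (K + 1) by rewrite divr_gt0.
have cv : continuous (fun w => c D w xi * (1 - s w)).
  apply: cont_mul; first exact: hR1.
  by apply: cont_sub; [exact: cont_cst|exact: cs].
have cr := rdefect_cont (xi := xi) cs.
have [V hV] := continuous_locapprox cv e2; have [W hW] := continuous_locapprox cr e1.
exists (V `|` W)%fset => L; rewrite fsubUset => /andP[/hV k1 /hW k2] m sm hm.
apply: le_trans (gain_le c_ge0 hR1 hgam hS1 hS2 hS4 mu_Gibbs sm hm cs s2 k1 k2 hK) _.
have c2 : continuous (fun w => 2 * (c D w xi * s w ^+ 2)).
  by apply: cont_mul; [exact: cont_cst|exact: css_cont].
rewrite /rgain (stateB sm cr c2).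
rewrite (stateZ sm); last exact: css_cont.
have -> : 2 * (e / 4 / (K + 1)) * (K + 1) = e / 2 by field; rewrite gt_eqF.
rewrite /rdefect; set a := m _; set b := m _.
by rewrite le_eqVlt; apply/orP; left; apply/eqP; field.
Qed.

(** The window depends on the volume and the tilts but not on [m], so that one box can serve all
    times at once. *)
Lemma production_window D (s : {ffun D -> spin q} -> Omega -> R) e :
  (forall xi, continuous (s xi)) -> (forall xi w, `|s xi w| <= 1 / 2) -> 0 < e ->
  exists W, forall L, (W `<=` L)%fset -> forall m, state m -> half_dominates mu m ->
    production D L m <= e - \sum_xi m (rgain xi (s xi)).
Proof.
move=> cs s2 e0; pose n : R := #|{: {ffun D -> spin q}}|%:R.
have n0 : 0 < n by rewrite ltr0n; apply/card_gt0P; exists (restr D point).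
have e1 : 0 < e / n by rewrite divr_gt0.
have [W hW] := @seq_window _ _ (enum {: {ffun D -> spin q}})
  (fun xi L => forall m, state m -> half_dominates mu m ->
    gain c mu m L xi <= e / n - m (rgain xi (s xi)))
  (fun xi _ => gain_window xi (cs xi) (s2 xi) e1).
exists W => L WL m sm hm; rewrite productionE //.
have -> : e = \sum_(xi : {ffun D -> spin q}) (e / n).
  by rewrite sumr_const -mulr_natr divfK // gt_eqF.
rewrite -sumrB; apply: ler_sum => xi _; apply: hW => //.
by rewrite mem_enum.
Qed.

(** A crude bound for volumes close to the boundary of [L], where no window fits: no tilt, and 0 as
    the local approximation of the rate. *)
Lemma production_ub D : exists2 B, 0 <= B &
  forall L m, state m -> half_dominates mu m -> production D L m <= B.
Proof.
have hxi (xi : {ffun D -> spin q}) : exists B : R, 0 <= B /\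
    forall L m, state m -> half_dominates mu m -> gain c mu m L xi <= B.
  have [K K0 hK] := push1_bound xi.
  have [M M0 hM] := continuous_bounded (@hR1 D xi).
  exists (2 * M * (K + 1)); split.
    by rewrite !mulr_ge0 // addr_ge0.
  move=> L m sm hm.
  have k1 : locapprox L (fun w => c D w xi * (1 - 0)) M.
    by exists (fun=> 0) => // w; rewrite !subr0 mulr1.
  have k2 : locapprox L (rdefect xi (fun=> 0)) 0.
    by exists (fun=> 0) => // w; rewrite rdefect0 subr0 normr0.
  have s2 (w : Omega) : `|(0 : R)| <= 1 / 2 by rewrite normr0 divr_ge0.
  have cs := @cont_cst R q d 0.
  apply: le_trans (gain_le c_ge0 hR1 hgam hS1 hS2 hS4 mu_Gibbs sm hm cs s2 k1 k2 hK) _.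
  rewrite -[fun w => push _ _ _ w - _]/(rdefect xi (fun=> 0)) rdefect0.
  rewrite (_ : (fun w => c D w xi * 0 ^+ 2) = fun=> 0); last first.
    by apply/funext => w; rewrite expr0n mulr0.
  by rewrite (state0 sm) oppr0 !mulr0 !add0r.
have /choice[B hB] := hxi.
exists (\sum_xi B xi); first by apply: sumr_ge0 => xi _; have [] := hB xi.
move=> L m sm hm; rewrite productionE //; apply: ler_sum => xi _.
by have [_] := hB xi; exact.
Qed.

Lemma restr_tauN x L (w w' : Omega) :
  restr L (tau x w) = restr L (tau x w') <->
  restr (fshift (- x) L) w = restr (fshift (- x) L) w'.
Proof.
split=> /restr_eqP e; apply/restr_eqP => y.
  by rewrite mem_fshift opprK => /e; rewrite /tau addrK.
by move=> yL; apply: e; rewrite mem_fshift opprK subrK.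
Qed.

Lemma dens_tau m L x w : tinv m -> tinv I ->
  dens mu m L (tau x w) = dens mu m (fshift (- x) L) w.
Proof.
have key m' : tinv m' -> m' (ind R (restr L (tau x w))) =
    m' (ind R (restr (fshift (- x) L) w)).
  move=> tm; rewrite -(tm x); last exact: ind_cont.
  congr (m' _); apply/funext => w'; rewrite /ind; congr (nat_of_bool _)%:R.
  by apply/eqP/eqP => e; apply/(restr_tauN x L).
by move=> tm tI; rewrite /dens -/I (key m tm) (key I tI).
Qed.

Lemma production_tau D L m x : state m -> tinv m -> tinv I ->
  production (fshift x D) L m = production D (fshift (- x) L) m.
Proof.
move=> sm tm tI; rewrite /production.
have lf : local L (dens mu m L) by exact: dens_local.
have cf := local_continuous lf.
have cln : continuous (fun w => ln (dens mu m L w)).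
  by apply: (@local_continuous _ _ _ L) => w w' e; rewrite (lf _ _ e).
have e1 : m (Ldelta c (fshift x D) (fun w => ln (dens mu m L w))) =
    m (Ldelta c D (fun w => ln (dens mu m (fshift (- x) L) w))).
  rewrite -(tm x); last exact: Ldelta_cont.
  congr (m _); apply/funext => w; rewrite -(Ldelta_tau hR4).
  by congr (Ldelta c D _ w); apply/funext => w'; rewrite dens_tau.
have e2 : I (Ldelta c (fshift x D) (dens mu m L)) =
    I (Ldelta c D (dens mu m (fshift (- x) L))).
  rewrite -(tI x); last exact: Ldelta_cont.
  congr (I _); apply/funext => w; rewrite -(Ldelta_tau hR4).
  by congr (Ldelta c D _ w); apply/funext => w'; rewrite dens_tau.
by rewrite e1 e2.
Qed.

Lemma card_fshift x D : #|` fshift x D| = #|` D|.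
Proof. by rewrite card_imfset //=; exact: addIr. Qed.

Hypothesis I_stat : forall L F, local L F -> I (Lop c F) = 0.
Hypothesis I_tinv : tinv I.

(** Stationarity of [mu] allows the mean of [Lop c] of the density to be subtracted; translation
    invariance then moves each volume back to one containing the origin and shifts [L] instead, so
    that only finitely many volumes have to be controlled. *)
Lemma Lop_ln_dens L m : state m -> tinv m ->
  m (Lop c (fun w => ln (dens mu m L w))) =
  \sum_(x <- L) \sum_(D <- active0 c)
     production D (fshift (- x) L) m / (#|` fshift x D `&` L|%fset)%:R.
Proof.
move=> sm tm.
have lf : local L (dens mu m L) by exact: dens_local.
have cf := local_continuous lf.
have lln : local L (fun w => ln (dens mu m L w)).
  by move=> w w' e; rewrite (lf _ _ e).
have cln := local_continuous lln.
transitivity (m (Lop c (fun w => ln (dens mu m L w))) - I (Lop c (dens mu m L))).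
  by rewrite (I_stat lf) subr0.
have -> : Lop c (fun w => ln (dens mu m L w)) = fun w =>
    \sum_(D <- touching c L) Ldelta c D (fun w => ln (dens mu m L w)) w.
  by apply/funext => w; rewrite (Lop_local c_ge0 hR2 hR4 _ lln).
have -> : Lop c (dens mu m L) = fun w =>
    \sum_(D <- touching c L) Ldelta c D (dens mu m L) w.
  by apply/funext => w; rewrite (Lop_local c_ge0 hR2 hR4 _ lf).
rewrite (state_sum sm) => [|D _]; last exact: Ldelta_cont.
rewrite (state_sum sI) => [|D _]; last exact: Ldelta_cont.
rewrite -sumrB (touching_sum c_ge0 hR2 hR4 L (fun D => production D L m)).
by apply: eq_bigr => x _; apply: eq_bigr => D _; rewrite production_tau.
Qed.

Definition folner (B : nat -> {fset site d}) : Prop :=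
  (forall k, (0 < #|` B k|)%N) /\
  forall W (e : R), 0 < e -> exists k0 : nat, forall k, (k0 <= k)%N ->
    (count (fun x => ~~ (fshift x W `<=` B k)%fset) (B k))%:R <= e * #|` B k|%:R.

(** At a site [x] with x + W inside the set, the window bound applies; any other site is covered by
    the crude bound, and such sites are a vanishing fraction. Neither bound depends on [m], hence
    neither does [k0]. *)
Lemma rate_bound (B : nat -> {fset site d}) (A : {fset site d} -> Omega -> R) :
  folner B -> (forall D, continuous (A D)) ->
  (forall D e, D \in active0 c -> 0 < e ->
    exists W, forall L, (W `<=` L)%fset -> forall m, state m -> half_dominates mu m ->
      tinv m -> production D L m <= e - m (A D)) ->
  forall e, 0 < e -> exists k0 : nat, forall k, (k0 <= k)%N ->
    forall m, state m -> half_dominates mu m -> tinv m ->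
    m (Lop c (fun w => ln (dens mu m (B k) w))) <=
      #|` B k|%:R * (e - \sum_(D <- active0 c) m (A D) / #|` D|%:R).
Proof.
move=> [B0 hB] cA hA e e0.
pose N : R := (size (active0 c))%:R.
have N0 : 0 <= N by rewrite ler0n.
pose e1 := e / 2 / (N + 1).
have e10 : 0 < e1 by rewrite !divr_gt0 // ltr_wpDl.
(* With [D] inside [L] the weight of an interior site is exactly 1 / |D|. *)
have [W hW] := @seq_window _ _ (active0 c)
  (fun D L => (D `<=` L)%fset /\ forall m, state m -> half_dominates mu m -> tinv m ->
     production D L m <= e1 - m (A D))
  ltac:(move=> D Dr; have [W hW] := hA D e1 Dr e10; exists (D `|` W)%fset => L;
     rewrite fsubUset => /andP[DL WL]; split => //; exact: hW).
have /choice[C hC] : forall D, exists C : R, 0 <= C /\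
    forall L m, state m -> half_dominates mu m -> production D L m <= C.
  by move=> D; have [C C0 h] := production_ub D; exists C.
have /choice[M hM] : forall D, exists M : R, 0 <= M /\ forall w, `|A D w| <= M.
  by move=> D; have [M M0 h] := continuous_bounded (cA D); exists M.
pose CC := \sum_(D <- active0 c) C D; pose MM := \sum_(D <- active0 c) M D.
have CC0 : 0 <= CC by apply: sumr_ge0 => D _; have [] := hC D.
have MM0 : 0 <= MM by apply: sumr_ge0 => D _; have [] := hM D.
(* At a boundary site the loss is at most [CC] for the production plus [MM] for the sum of the m (A
   D) / |D| that the final bound credits to every site. *)
pose e2 := e / 2 / (CC + MM + 1).
have e20 : 0 < e2 by rewrite !divr_gt0 // ltr_wpDl // addr_ge0.
have [k0 hk0] := hB W e2 e20; exists k0 => k k0k m sm hm tm.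
rewrite Lop_ln_dens //.
set al := \sum_(D <- active0 c) m (A D) / #|` D|%:R.
have alM : al <= MM.
  rewrite /al big_seq /MM [leRHS]big_seq; apply: ler_sum => D Dr.
  have [MD0 hMD] := hM D.
  have D1 : 1 <= #|` D|%:R :> R.
    have [_] := active0P hR2 D; move/(active0P hR2): Dr => -[D00 _] _.
    by rewrite ler1n cardfs_gt0; apply/fset0Pn; exists 0.
  rewrite ler_pdivrMr ?(lt_le_trans _ D1) //.
  apply: (@le_trans _ _ (M D)); last by rewrite ler_peMr.
  by apply: le_trans (ler_norm _) _; apply: (state_norm sm).
have card_pos x D : x \in B k -> D \in active0 c ->
    1 <= (#|` fshift x D `&` B k|%fset)%:R :> R.
  move=> xB /(active0P hR2)[D00 _]; rewrite ler1n cardfs_gt0.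
  by apply/fset0Pn; exists x; rewrite in_fsetI mem_fshift subrr D00.
have term x : x \in B k -> \sum_(D <- active0 c)
     production D (fshift (- x) (B k)) m / (#|` fshift x D `&` B k|%fset)%:R <=
   (N * e1 - al) + (CC + MM) * (~~ (fshift x W `<=` B k)%fset)%:R.
  move=> xB; have [WB|WB] := boolP (fshift x W `<=` B k)%fset.
    rewrite mulr0 addr0.
    have -> : N * e1 - al = \sum_(D <- active0 c) (e1 - m (A D) / #|` D|%:R).
      by rewrite sumrB /N big_const_seq count_predT iter_addr_0 mulr_natl.
    have WB' : (W `<=` fshift (- x) (B k))%fset.
      apply/fsubsetP => y yW; rewrite mem_fshift opprK.
      by move/fsubsetP: WB; apply; rewrite mem_fshift addrK.
    rewrite big_seq [leRHS]big_seq; apply: ler_sum => D Dr.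
    have [DB hD] := hW _ WB' D Dr.
    have -> : (fshift x D `&` B k)%fset = fshift x D.
      apply/fsetIidPl; apply/fsubsetP => y; rewrite mem_fshift => yD.
      by move/fsubsetP: DB => /(_ _ yD); rewrite mem_fshift opprK subrK.
    have D1 : 1 <= #|` D|%:R :> R.
      move/(active0P hR2): Dr => -[D00 _].
      by rewrite ler1n cardfs_gt0; apply/fset0Pn; exists 0.
    have D0 : 0 < #|` D|%:R :> R by rewrite (lt_le_trans _ D1).
    rewrite card_fshift ler_pdivrMr // mulrBl divfK ?gt_eqF //.
    apply: le_trans (hD m sm hm tm) _.
    by rewrite lerD2r ler_peMr // ltW.
  rewrite mulr1.
  apply: (@le_trans _ _ CC).
    rewrite big_seq /CC [leRHS]big_seq; apply: ler_sum => D Dr.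
    have [CD0 hCD] := hC D; have n1 := card_pos x D xB Dr.
    rewrite ler_pdivrMr ?(lt_le_trans _ n1) //.
    apply: le_trans (hCD _ m sm hm) _.
    by rewrite ler_peMr.
  have N1 : 0 <= N * e1 by rewrite mulr_ge0 // ltW.
  rewrite -subr_ge0 (_ : _ - CC = N * e1 + (MM - al)); last by ring.
  by rewrite addr_ge0 // subr_ge0.
rewrite big_seq; apply: le_trans (ler_sum _ _) _; first by move=> x xB; exact: term.
rewrite -big_seq big_split /= -mulr_sumr big_const_seq count_predT iter_addr_0.
have -> : \sum_(i <- B k) (~~ (fshift i W `<=` B k)%fset)%:R =
    (count (fun x => ~~ (fshift x W `<=` B k)%fset) (B k))%:R :> R.
  by rewrite -natr_sum -sum1_count [in RHS]big_mkcond.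
rewrite -[_ *+ size _]mulr_natl -[size (B k)]/(#|` B k|).
set n : R := #|` B k|%:R.
have n0 : 0 <= n by rewrite /n ler0n.
have h1 := hk0 k k0k.
have h2 : (CC + MM) * (count (fun x => ~~ (fshift x W `<=` B k)%fset) (B k))%:R <=
    n * (e / 2).
  apply: (@le_trans _ _ ((CC + MM) * (e2 * n))).
    by apply: ler_wpM2l => //; exact: addr_ge0.
  rewrite mulrA mulrC; apply: ler_wpM2l => //.
  rewrite /e2 mulrCA ger_pMr ?divr_gt0 // ler_pdivrMr ?mul1r.
    by rewrite lerDl.
  by rewrite ltr_wpDl // addr_ge0.
have h3 : N * e1 <= e / 2.
  rewrite /e1 mulrCA ger_pMr ?divr_gt0 // ler_pdivrMr ?mul1r ?lerDl //.
  by rewrite ltr_wpDl.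
apply: le_trans (lerD (lexx _) h2) _.
rewrite -mulrDr; apply: ler_wpM2l => //.
by rewrite addrAC lerD2r [leRHS]splitr lerD2r.
Qed.

End production.

(** * Boxes *)

Lemma bernoulli_ge (R : realType) (t : R) n : 0 <= t <= 1 -> 1 - n%:R * t <= (1 - t) ^+ n.
Proof.
move=> /andP[t0 t1]; elim: n => [|n IH]; first by rewrite mul0r subr0 expr0.
rewrite exprS; apply: (@le_trans _ _ ((1 - t) * (1 - n%:R * t))).
  have -> : (1 - t) * (1 - n%:R * t) = 1 - n.+1%:R * t + n%:R * t ^+ 2.
    by rewrite -natr1; ring.
  by rewrite lerDl mulr_ge0 // sqr_ge0.
by apply: ler_wpM2l => //; rewrite subr_ge0.
Qed.

Section boxes.
Variable d : nat.

Definition box (k : nat) : {fset site d} :=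
  [fset (\row_i ((f : {ffun 'I_d -> 'I_k.+1}) i : nat)%:Z : site d) |
    f in {: {ffun 'I_d -> 'I_k.+1}}]%fset.

Lemma boxP k (x : site d) :
  reflect (forall i, 0 <= x ord0 i <= k%:Z) (x \in box k).
Proof.
apply: (iffP idP) => [/imfsetP[f _ /= ->] i|h].
  by rewrite mxE; apply/andP; split=> //; rewrite lez_nat -ltnS.
apply/imfsetP.
have h2 i : (`|x ord0 i|%N < k.+1)%N.
  by have := h i; lia.
exists [ffun i => Ordinal (h2 i)] => //; apply/rowP => i.
by rewrite !mxE ffunE /= gez0_abs //; have /andP[] := h i.
Qed.

Lemma card_box k : #|` box k| = (k.+1 ^ d)%N.
Proof.
rewrite card_imfset /=; first by rewrite -cardE card_ffun !card_ord.
move=> f g /rowP e; apply/ffunP => i; apply/val_inj.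
by have := e i; rewrite !mxE => -[].
Qed.

Lemma box_margin (W : {fset site d}) : exists r : nat, forall k (x : site d),
  (r.*2 <= k)%N -> x - const_mx r%:Z \in box (k - r.*2) ->
  (fshift x W `<=` box k)%fset.
Proof.
pose r := (\sum_(y <- W) \sum_(i < d) `|y ord0 i|)%N.
exists r => k x rk xbox; apply/fsubsetP => y; rewrite mem_fshift => yW.
apply/boxP => i; move: xbox.
move=> /boxP/(_ i); rewrite !mxE => /andP[h1 h2].
have h3 : (absz ((y - x)%R ord0 i) <= r)%N.
  rewrite /r (big_fsetD1 _ yW) /= (bigD1 i) //= -addnA; exact: leq_addr.
rewrite !mxE in h3; move: (x ord0 i : int) (y ord0 i : int) h1 h2 h3 => a b.
by clear -rk; lia.
Qed.

(** Sites at distance at least r from the faces form a translate of the box with parameter k - 2r;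
    by Bernoulli's inequality they are a fraction at least 1 - 2rd / (k + 1) of the whole. *)
Lemma folner_box (W : {fset site d}) (R : realType) (e : R) : 0 < e ->
  exists k0 : nat, forall k, (k0 <= k)%N ->
    (count (fun x => ~~ (fshift x W `<=` box k)%fset) (box k))%:R <=
      e * #|` box k|%:R.
Proof.
move=> e0; have [r hr] := box_margin W.
pose k0 := (r.*2 + Num.truncn ((d * r.*2)%:R / e))%N.
exists k0 => k k0k; have rk : (r.*2 <= k)%N := leq_trans (leq_addr _ _) k0k.
pose good x := (fshift x W `<=` box k)%fset.
pose G := fshift (const_mx r%:Z) (box (k - r.*2)).
have GB : (#|` G| <= count good (box k))%N.
  rewrite -size_filter; apply: uniq_leq_size; first exact: fset_uniq.
  move=> x xG; rewrite mem_filter.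
  have xG' : x - const_mx r%:Z \in box (k - r.*2) by rewrite -mem_fshift.
  apply/andP; split.
    exact: hr.
  apply/boxP => i; move/boxP: xG' => /(_ i); rewrite !mxE.
  by move: (x ord0 i : int) => a; clear -rk; lia.
have cG : #|` G| = ((k - r.*2).+1 ^ d)%N.
  by rewrite card_imfset ?card_box //=; exact: addIr.
have cc : (count (fun x => ~~ good x) (box k) + count good (box k) = k.+1 ^ d)%N.
  by rewrite addnC -[RHS]card_box -(count_predC good (box k)).
have k1 : 0 < k.+1%:R :> R by rewrite ltr0n.
pose t : R := (r.*2)%:R / k.+1%:R.
have t01 : 0 <= t <= 1.
  rewrite divr_ge0 //= ler_pdivrMr // mul1r ler_nat.
  exact: leq_trans rk _.
have := bernoulli_ge d t01.
have -> : 1 - t = (k - r.*2).+1%:R / k.+1%:R.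
  rewrite -subSn // natrB ?(leqW rk) // /t mulrBl divff //.
rewrite expr_div_n ler_pdivlMr ?exprn_gt0 // -!natrX -cG => hb.
have dt : d%:R * t <= e.
  rewrite /t mulrA -natrM ler_pdivrMr // mulrC -ler_pdivrMr //.
  have := truncnS_gt ((d * r.*2)%:R / e) => /ltW h.
  apply: (le_trans h); rewrite ler_nat ltnS; apply: leq_trans k0k.
  exact: leq_addl.
rewrite card_box -/good.
have : (count (fun x => ~~ good x) (box k))%:R + #|` G|%:R <= (k.+1 ^ d)%:R :> R.
  by rewrite -natrD ler_nat -cc leq_add2l.
rewrite -lerBrDr => /le_trans; apply.
rewrite lerBlDr -lerBlDl (le_trans _ hb) // mulrBl mul1r lerD2l lerN2.
by rewrite ler_wpM2r.
Qed.

Lemma box_gt0 k : (0 < #|` box k|)%N.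
Proof. by rewrite card_box expn_gt0. Qed.

End boxes.

(** * Evolution of the relative entropy *)

Section entropy.
Variables (R : realType) (q d : nat).
Local Notation Omega := (config q (site d)).
Implicit Types (F G u v : Omega -> R) (L W D : {fset site d}).
Implicit Type m : (Omega -> R) -> R.
Variable c : rates R q d.
Arguments c : clear implicits.
Hypotheses (c_ge0 : nonneg_rates c) (hR1 : R1 c) (hR2 : R2 c) (hR4 : R4 c).
Variables (P : R -> (Omega -> R) -> (Omega -> R)).
Hypotheses (hP : markov_semigroup P) (hPc : generated_by P c).
Variables (gam : kernels R q d) (hgam : specification gam).
Hypotheses (hS1 : S1 gam) (hS2 : S2 gam) (hS4 : S4 gam).
Variables (mu : probability Omega R).
Hypotheses (mu_inv : translation_invariant mu) (mu_stat : time_stationary P mu).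
Hypothesis mu_Gibbs : Gibbs gam mu.
Variables (nu : probability Omega R) (nu_inv : translation_invariant nu).

Let I := pstate mu.
Let mu1 : mu setT = 1%E := probability_setT mu.
Let nu1 : nu setT = 1%E := probability_setT nu.
Let sI : state I := pstateP mu1.
Let J := pstate nu.
Let sJ : state J := pstateP nu1.

Let I_gt0 W (xi : {ffun W -> spin q}) : 0 < I (ind R xi).
Proof. exact: (Gibbs_ind_gt0 hgam hS1 hS2 hS4 mu_Gibbs). Qed.

(* Averaging with mu bounds the densities below by 1/2, so no positivity of
   nu P_t is needed. *)
Definition evo (t : R) F : R := (J (P t F) + I F) / 2.

Lemma evo_state t : 0 <= t -> state (evo t).
Proof.
move=> t0; split=> [a F G cF cG|F cF F0|].
- rewrite /evo (semigroup_linear hP) // (state_lin sI) //.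
  by rewrite (state_lin sJ); [field|exact: P_cont..].
- rewrite /evo divr_ge0 // addr_ge0 //.
    by apply: (state_ge0 sJ); [exact: P_cont|exact: (semigroup_ge0 hP)].
  exact: (state_ge0 sI).
- by rewrite /evo (semigroup1 hP) // (state1 sI) (state1 sJ) divff.
Qed.

Lemma evo_half_dominates t : 0 <= t -> half_dominates mu (evo t).
Proof.
move=> t0 F cF F0; rewrite /evo ler_pM2r ?invr_gt0 // lerDr.
by apply: (state_ge0 sJ); [exact: P_cont|exact: (semigroup_ge0 hP)].
Qed.

Lemma evo_tinv t : 0 <= t -> tinv (evo t).
Proof.
have tI : tinv I := pstate_tinv mu_inv.
have tJ : tinv J := pstate_tinv nu_inv.
move=> t0 x F cF; rewrite /evo (tI x F cF).
by rewrite (P_tau hP c_ge0 hR1 hR2 hR4 hPc x t0 cF) (tJ x _ (P_cont hP t0 cF)).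
Qed.

Lemma I_P t F : 0 <= t -> continuous F -> I (P t F) = I F.
Proof.
move=> t0 cF; have [] : (I F)%:E = (I (P t F))%:E => //.
rewrite -(pstate_fin mu1 cF) -(pstate_fin mu1 (P_cont hP t0 cF)).
exact: mu_stat.
Qed.

(** Stationarity of [mu] makes [evo] the evolution of the mixture, not just a mixture with an
    evolution. *)
Lemma evoD t s F : 0 <= t -> 0 <= s -> continuous F ->
  evo (t + s) F = evo t (P s F).
Proof. by move=> t0 s0 cF; rewrite /evo (semigroupD hP) // I_P. Qed.

Lemma I_Lop L F : local L F -> I (Lop c F) = 0.
Proof.
move=> lF; apply/eqP; rewrite -normr_le0.
apply/ler_addgt0Pr => e e0; rewrite add0r.
have [cF cL /(_ e e0)[rho r0 hr]] := gen_local c_ge0 hR1 hR2 hR4 hPc lF.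
pose h := rho / 2; have h0 : 0 < h by rewrite divr_gt0.
have hrho : h < rho by rewrite ltr_pdivrMr // ltr_pMr // ltr1n.
have cPF := P_cont hP (ltW h0) cF.
have chL : continuous (fun w => h * Lop c F w).
  by apply: cont_mul; [exact: cont_cst|exact: cL].
have cPB : continuous (fun w => P h F w - F w) by exact: cont_sub.
have := state_norm sI (cont_sub cPB chL) (hr h h0 hrho).
rewrite (stateB sI cPB chL) (stateB sI cPF cF) (stateZ sI _ cL) (I_P (ltW h0) cF).
by rewrite subrr sub0r normrN normrM gtr0_norm // mulrC ler_pM2r.
Qed.

(** By [evoD] the increment at time [t] is the mean under [evo t] of an increment at time 0, so
    [rho] does not depend on [t]. *)
Lemma evo_step L e : 0 < e -> exists2 rho, 0 < rho &
  forall t s, 0 <= t -> 0 < s -> s < rho -> forall a : {ffun L -> spin q},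
    `|evo (t + s) (ind R a) - evo t (ind R a) - s * evo t (Lop c (ind R a))| <= e * s.
Proof.
move=> e0.
have step (a : {ffun L -> spin q}) : exists2 rho, 0 < rho & forall t s,
    0 <= t -> 0 < s -> s < rho ->
    `|evo (t + s) (ind R a) - evo t (ind R a) - s * evo t (Lop c (ind R a))| <= e * s.
  have [cF cL /(_ e e0)[rho r0 hr]] :=
    gen_local c_ge0 hR1 hR2 hR4 hPc (@ind_local R q d L a).
  exists rho => // t s t0 s0 sr; have sm := evo_state t0.
  have cPF := P_cont hP (ltW s0) cF.
  have csL : continuous (fun w => s * Lop c (ind R a) w).
    by apply: cont_mul; [exact: cont_cst|exact: cL].
  have cPB : continuous (fun w => P s (ind R a) w - ind R a w) by exact: cont_sub.
  have := state_norm sm (cont_sub cPB csL) (hr s s0 sr).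
  by rewrite (stateB sm cPB csL) (stateB sm cPF cF) (stateZ sm _ cL) (evoD t0 (ltW s0) cF).
suff [rho r0 h] : exists2 rho, 0 < rho & forall a, a \in enum {: {ffun L -> spin q}} ->
    forall t s, 0 <= t -> 0 < s -> s < rho ->
    `|evo (t + s) (ind R a) - evo t (ind R a) - s * evo t (Lop c (ind R a))| <= e * s.
  by exists rho => // t s t0 s0 sr a; apply: h => //; rewrite mem_enum.
elim: (enum _) => [|a r [r1 r10 h1]]; first by exists 1.
have [r2 r20 h2] := step a; exists (Num.min r1 r2); first by rewrite lt_min r10.
move=> b; rewrite inE => bar t s t0 s0; rewrite lt_min => /andP[sr1 sr2].
by case/predU1P: bar => [->|br]; [exact: h2|exact: h1].
Qed.

Definition rel_entropy L m : R :=
  \sum_(a : {ffun L -> spin q}) m (ind R a) * ln (m (ind R a) / I (ind R a)).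

Lemma half_gt0 L m (a : {ffun L -> spin q}) : half_dominates mu m -> 0 < m (ind R a).
Proof.
move=> hm; apply: lt_le_trans (hm _ (@ind_cont R q d L a) (@ind_ge0 R q d L a)).
by apply: divr_gt0 => //; exact: I_gt0.
Qed.

Lemma ln_le (x : R) : 0 < x -> ln x <= x - 1.
Proof.
move=> x0; have h : -1 < x - 1 by lra.
by have := le_ln1Dx h; rewrite subrKC.
Qed.

Lemma rel_entropy_ge0 L m : state m -> half_dominates mu m -> 0 <= rel_entropy L m.
Proof.
move=> sm hm.
have -> : 0 = \sum_(a : {ffun L -> spin q}) (m (ind R a) - I (ind R a)).
  by rewrite sumrB (state_ind_sum L sm) (state_ind_sum L sI) subrr.
apply: ler_sum => a _; have p0 := half_gt0 a hm; have i0 := I_gt0 a.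
have h := ln_le (divr_gt0 i0 p0).
rewrite -[_ / m _]invf_div lnV ?posrE ?divr_gt0 // in h.
have : m (ind R a) * (1 - I (ind R a) / m (ind R a)) <=
    m (ind R a) * ln (m (ind R a) / I (ind R a)).
  by rewrite ler_pM2l //; move: h; rewrite invf_div; lra.
by rewrite mulrBr mulr1 mulrCA divff ?mulr1 // gt_eqF.
Qed.

(** Cylinders over [L] have mass at most 1 under [m] and at least delta^|L| under [mu]. As [C] does
    not depend on [L], the entropy per site is bounded, and a fixed amount per site can be lost only
    boundedly often. *)
Lemma rel_entropy_le : exists2 C : R, 0 <= C &
  forall L m, state m -> half_dominates mu m -> rel_entropy L m <= C * #|` L|%:R.
Proof.
have [delta d0 hd] := gcond_lb hgam hS1 hS2 hS4.
have I_lb L (a : {ffun L -> spin q}) : delta ^+ #|` L| <= I (ind R a).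
  have <- : I (gcond gam a) = I (ind R a) := Gibbs_gcond hS1 mu_Gibbs a.
  rewrite -[leLHS](state_cst sI); apply: (state_le sI).
  - exact: cont_cst.
  - exact: gcond_cont.
  - by move=> w; exact: hd.
exists `|ln delta| => // L m sm hm.
have -> : `|ln delta| * #|` L|%:R =
    \sum_(a : {ffun L -> spin q}) m (ind R a) * (`|ln delta| * #|` L|%:R).
  by rewrite -mulr_suml (state_ind_sum L sm) mul1r.
apply: ler_sum => a _; have p0 := half_gt0 a hm; have i0 := I_gt0 a.
rewrite ler_pM2l //.
apply: (@le_trans _ _ (ln ((delta ^+ #|` L|)^-1))).
  rewrite ler_ln ?posrE ?divr_gt0 ?invr_gt0 ?exprn_gt0 //.
  rewrite -[leRHS]mul1r; apply: ler_pM.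
  - exact: ltW.
  - by rewrite invr_ge0 ltW.
  - exact: state_ind_le1.
  - by rewrite lef_pV2 ?posrE ?exprn_gt0 //; exact: I_lb.
rewrite lnV ?posrE ?exprn_gt0 // lnXn // -[ln delta *+ _]mulr_natr -mulNr.
by rewrite ler_wpM2r // -normrN ler_norm.
Qed.

Lemma Lop_ind_sum L m (f : {ffun L -> spin q} -> R) : state m ->
  m (Lop c (fun w => f (restr L w))) = \sum_a f a * m (Lop c (ind R a)).
Proof.
move=> sm.
have lf : local L (fun w => f (restr L w)) by move=> w w' ->.
have cL (a : {ffun L -> spin q}) : continuous (Lop c (ind R a)).
  exact: (Lop_local_cont c_ge0 hR1 hR2 hR4 (@ind_local R q d L a)).
have -> : Lop c (fun w => f (restr L w)) = fun w => \sum_a f a * Lop c (ind R a) w.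
  apply/funext => w; rewrite (Lop_local c_ge0 hR2 hR4 _ lf).
  under [RHS]eq_bigr do
    rewrite (Lop_local c_ge0 hR2 hR4 _ (@ind_local R q d L _)) mulr_sumr.
  rewrite exchange_big /=; apply: eq_bigr => D _.
  under [RHS]eq_bigr do rewrite /Ldelta mulr_sumr.
  rewrite exchange_big /=; apply: eq_bigr => b _.
  rewrite -!(sum_ind f) -sumrB mulr_sumr; apply: eq_bigr => a _; ring.
rewrite (state_sum sm) => [|a _].
  by apply: eq_bigr => a _; rewrite (stateZ sm).
by apply: cont_mul; [exact: cont_cst|exact: cL].
Qed.

(* Uses p' ln (p' / p) <= p' (p' / p - 1). *)
Lemma entropy_term (p p' i : R) : 0 < p -> 0 < p' -> 0 < i ->
  p' * ln (p' / i) - p * ln (p / i) <=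
  (p' - p) * ln (p / i) + (p' - p) + (p' - p) ^+ 2 / p.
Proof.
move=> p0 p'0 i0.
have h := ln_le (divr_gt0 p'0 p0).
have e : ln (p' / i) = ln (p / i) + ln (p' / p).
  rewrite -lnM ?posrE ?divr_gt0 //; congr ln.
  by field; rewrite !gt_eqF.
have : p' * ln (p' / p) <= p' * (p' / p - 1) by rewrite ler_pM2l.
have -> : p' * (p' / p - 1) = (p' - p) + (p' - p) ^+ 2 / p.
  by field; rewrite gt_eqF.
by rewrite e mulrDr mulrBl; lra.
Qed.

(** An upper bound for increments is enough, so the entropy is not differentiated: [entropy_term]
    leaves a remainder quadratic in the increments of the cylinder masses, of order s^2 uniformly in
    [t] because these masses are at least half of those of [mu]. *)
Lemma rel_entropy_step L e : 0 < e -> exists2 rho, 0 < rho &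
  forall t s, 0 <= t -> 0 < s -> s < rho ->
    rel_entropy L (evo (t + s)) - rel_entropy L (evo t) <=
    s * (evo t (Lop c (fun w => ln (dens mu (evo t) L w))) + e).
Proof.
move=> e0.
have /choice[M hM] : forall a : {ffun L -> spin q}, exists M : R, 0 <= M /\
    forall w, `|Lop c (ind R a) w| <= M.
  move=> a; have [M M0 h] := continuous_bounded
    (Lop_local_cont c_ge0 hR1 hR2 hR4 (@ind_local R q d L a)).
  by exists M.
(* [S] collects the first-order errors and [T] the quadratic remainders; [e1 <= 1] below lets
   [M a + 1] bound every increment divided by [s]. *)
pose S := \sum_(a : {ffun L -> spin q}) (I (ind R a))^-1.
pose T := \sum_(a : {ffun L -> spin q}) (M a + 1) ^+ 2 * (2 / I (ind R a)).
have S0 : 0 <= S by apply: sumr_ge0 => a _; rewrite invr_ge0 ltW.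
have T0 : 0 <= T.
  by apply: sumr_ge0 => a _; rewrite mulr_ge0 ?sqr_ge0 // divr_ge0 // ltW.
pose e1 := Num.min 1 (e / 2 / (S + 1)).
have e10 : 0 < e1 by rewrite lt_min ltr01 !divr_gt0 // ltr_wpDl.
have e11 : e1 <= 1 by rewrite ge_min lexx.
have e1S : e1 * S <= e / 2.
  apply: (@le_trans _ _ (e / 2 / (S + 1) * (S + 1))).
    by apply: ler_pM => //; [exact: ltW|rewrite ge_min lexx orbT|rewrite lerDl].
  by rewrite divfK // gt_eqF // ltr_wpDl.
have [r1 r10 h1] := evo_step L e10.
pose r2 := e / 2 / (T + 1).
have r20 : 0 < r2 by rewrite !divr_gt0 // ltr_wpDl.
exists (Num.min r1 r2); first by rewrite lt_min r10.
move=> t s t0 s0; rewrite lt_min => /andP[sr1 sr2].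
have ts0 : 0 <= t + s by rewrite addr_ge0 // ltW.
have sm := evo_state t0; have sm' := evo_state ts0.
have hm := evo_half_dominates t0; have hm' := evo_half_dominates ts0.
set p := fun a : {ffun L -> spin q} => evo t (ind R a).
set p' := fun a : {ffun L -> spin q} => evo (t + s) (ind R a).
set i := fun a : {ffun L -> spin q} => I (ind R a).
have p0 a : 0 < p a by exact: half_gt0.
have p'0 a : 0 < p' a by exact: half_gt0.
have i0 a : 0 < i a by exact: I_gt0.
have -> : evo t (Lop c (fun w => ln (dens mu (evo t) L w))) =
    \sum_a ln (p a / i a) * evo t (Lop c (ind R a)).
  by rewrite -(Lop_ind_sum (fun a => ln (p a / i a)) sm).
have -> : rel_entropy L (evo (t + s)) - rel_entropy L (evo t) =
    \sum_a (p' a * ln (p' a / i a) - p a * ln (p a / i a)).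
  by rewrite sumrB.
have key a : p' a * ln (p' a / i a) - p a * ln (p a / i a) <=
    s * (ln (p a / i a) * evo t (Lop c (ind R a))) + s * (e1 / i a) + (p' a - p a)
     + s * (s * ((M a + 1) ^+ 2 * (2 / i a))).
  apply: le_trans (entropy_term (p0 a) (p'0 a) (i0 a)) _.
  have k1 : `|p' a - p a - s * evo t (Lop c (ind R a))| <= e1 * s by exact: h1.
  have [M0 hMa] := hM a.
  have k2 : `|evo t (Lop c (ind R a))| <= M a.
    apply: (state_norm sm) => //.
    exact: (Lop_local_cont c_ge0 hR1 hR2 hR4 (@ind_local R q d L a)).
  have k3 : `|p' a - p a| <= s * (M a + 1).
    rewrite -[p' a - p a](subrK (s * evo t (Lop c (ind R a)))).
    rewrite (le_trans (ler_normD _ _)) // mulrDr mulr1 addrC lerD //.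
      by rewrite normrM gtr0_norm // ler_pM2l.
    by rewrite (le_trans k1) // ger_pMl.
  have pi : 1 / 2 <= p a / i a.
    by rewrite ler_pdivlMr // mulrC mulrA mulr1; apply: hm;
      [exact: ind_cont|exact: ind_ge0].
  have pi0 : 0 < p a / i a by rewrite divr_gt0.
  have p1 : p a <= 1 by exact: state_ind_le1.
  have i1 : i a <= 1 by exact: state_ind_le1.
  (* From below, p / i >= 1/2 gives -ln (p / i) <= 1; from above, ln x <= x - 1. Both are at most 1
     / i since p and i are at most 1. *)
  have k4 : `|ln (p a / i a)| <= (i a)^-1.
    rewrite ler_norml; apply/andP; split.
      rewrite lerNl -lnV ?posrE //.
      apply: le_trans (ln_le _) _; first by rewrite invr_gt0.
      apply: (@le_trans _ _ 1); last by rewrite invf_ge1.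
      rewrite lerBlDr -[X in _ <= X]invrK lef_pV2 ?posrE ?invr_gt0 ?addr_gt0 //.
      by apply: le_trans pi; rewrite div1r.
    apply: le_trans (ln_le pi0) _.
    rewrite lerBlDr; apply: (@le_trans _ _ (i a)^-1); last by rewrite lerDl.
    by apply: ler_piMl => //; rewrite invr_ge0 ltW.
  have k5 : (p' a - p a) * ln (p a / i a) <=
      s * (ln (p a / i a) * evo t (Lop c (ind R a))) + s * (e1 / i a).
    rewrite -lerBlDl (_ : _ - _ =
      (p' a - p a - s * evo t (Lop c (ind R a))) * ln (p a / i a)); last by ring.
    rewrite (le_trans (ler_norm _)) // normrM mulrA [s * e1]mulrC.
    exact: ler_pM.
  have k6 : (p' a - p a) ^+ 2 / p a <= s * (s * ((M a + 1) ^+ 2 * (2 / i a))).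
    rewrite (_ : s * _ = (s * (M a + 1)) ^+ 2 * (2 / i a)); last by ring.
    apply: ler_pM; rewrite ?sqr_ge0 ?invr_ge0 ?(ltW (p0 a)) //.
      rewrite -(real_normK (num_real (p' a - p a))) ler_pXn2r ?nnegrE //.
      by rewrite mulr_ge0 ?(ltW s0) // addr_ge0.
    have q0 : 0 < i a / 2 by apply: divr_gt0.
    rewrite -[leRHS]invf_div lef_pV2 ?posrE ?q0 ?(p0 a) //.
    have : 1 / 2 * i a <= p a by rewrite -ler_pdivlMr.
    by rewrite mulrC mulrA mulr1.
  exact: lerD (lerD k5 (lexx _)) k6.
apply: le_trans (ler_sum _ (fun a _ => key a)) _.
rewrite !big_split /=.
have -> : \sum_a s * (e1 / i a) = s * (e1 * S) by rewrite /S !mulr_sumr.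
have -> : \sum_a s * (s * ((M a + 1) ^+ 2 * (2 / i a))) = s * (s * T).
  by rewrite /T !mulr_sumr.
rewrite -[X in X + _ + _ + _]mulr_sumr.
(* Cylinder masses add up to 1 at both times, so the terms p' - p cancel in the sum. *)
rewrite sumrN; have -> : \sum_a p' a = 1 := state_ind_sum L sm'.
have -> : \sum_a p a = 1 := state_ind_sum L sm.
rewrite subrr addr0.
rewrite -!mulrDr ler_pM2l // -addrA lerD2l (splitr e) lerD //.
apply: (@le_trans _ _ (r2 * T)); first by rewrite ler_wpM2r // ltW.
rewrite /r2 mulrAC ler_pdivrMr ?ltr_wpDl // ler_pM2l ?divr_gt0 //.
by rewrite lerDl.
Qed.

(** Equal steps shorter than [rho] are added up, which works because the same [rho] is valid at all
    starting times; the error is [e / tau] per unit of time. *)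
Lemma rel_entropy_interval L (B a tau : R) : 0 <= a -> 0 <= tau ->
  (forall t, a <= t <= a + tau ->
    evo t (Lop c (fun w => ln (dens mu (evo t) L w))) <= B) ->
  rel_entropy L (evo (a + tau)) <= rel_entropy L (evo a) + tau * B.
Proof.
move=> a0; rewrite le_eqVlt => /predU1P[<- _|tau0 hB].
  by rewrite addr0 mul0r addr0.
apply/ler_addgt0Pr => e e0.
have e1 : 0 < e / tau by rewrite divr_gt0.
have [rho r0 hr] := rel_entropy_step L e1.
pose n := (Num.truncn (tau / rho)).+1; pose h := tau / n%:R.
have hrho : h < rho.
  by rewrite ltr_pdivrMr ?ltr0n // mulrC -ltr_pdivrMr // /n truncnS_gt.
have hn : tau = n%:R * h by rewrite mulrC divfK // pnatr_eq0.
have h0 : 0 < h by rewrite divr_gt0 // ltr0n.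
have claim k : (k <= n)%N ->
    rel_entropy L (evo (a + k%:R * h)) <= rel_entropy L (evo a) + k%:R * h * (B + e / tau).
  elim: k => [|k IH] kn; first by rewrite !mul0r !addr0.
  have kh0 : 0 <= k%:R * h by rewrite mulr_ge0 // ltW.
  have t0 : 0 <= a + k%:R * h by rewrite addr_ge0.
  have k1 := hr _ h t0 h0 hrho.
  have k2 : evo (a + k%:R * h)
      (Lop c (fun w => ln (dens mu (evo (a + k%:R * h)) L w))) <= B.
    apply: hB; rewrite lerDl kh0 lerD2l [leRHS]hn ler_pM2r // ler_nat.
    exact: ltnW.
  rewrite -natr1 [(k%:R + 1) * h]mulrDl mul1r addrA mulrDl addrA.
  rewrite lerBlDl in k1; apply: le_trans k1 _; apply: lerD.
    exact: IH (ltnW kn).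
  by rewrite ler_pM2l // lerD2r.
have := claim n (leqnn n); rewrite -hn mulrDr addrA mulrC.
by rewrite [tau * (e / tau)]mulrC divfK // ?gt_eqF // [B * tau]mulrC.
Qed.

End entropy.

(** * Limit points *)

Section attractor.
Variables (R : realType) (q d : nat).
Local Notation Omega := (config q (site d)).
Implicit Types (F G u v : Omega -> R) (L W D : {fset site d}).
Implicit Type m : (Omega -> R) -> R.
Variable c : rates R q d.
Arguments c : clear implicits.
Hypotheses (c_ge0 : nonneg_rates c) (hR1 : R1 c) (hR2 : R2 c) (hR4 : R4 c).
Variables (P : R -> (Omega -> R) -> (Omega -> R)).
Hypotheses (hP : markov_semigroup P) (hPc : generated_by P c).
Variables (gam : kernels R q d) (hgam : specification gam).
Hypotheses (hS1 : S1 gam) (hS2 : S2 gam) (hS4 : S4 gam).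
Variables (mu : probability Omega R).
Hypotheses (mu_inv : translation_invariant mu) (mu_stat : time_stationary P mu).
Hypothesis mu_Gibbs : Gibbs gam mu.
Variables (nu : probability Omega R) (nu_inv : translation_invariant nu).

Let I := pstate mu.
Let mu1 : mu setT = 1%E := probability_setT mu.
Let sI : state I := pstateP mu1.

Lemma production_window0 D e : 0 < e ->
  exists W, forall L, (W `<=` L)%fset -> forall m, state m -> half_dominates mu m ->
    production c mu D L m <= e.
Proof.
move=> e0.
have cs (xi : {ffun D -> spin q}) := @cont_cst R q d 0.
have s2 (xi : {ffun D -> spin q}) (w : Omega) : `|(0 : R)| <= 1 / 2.
  by rewrite normr0 divr_ge0.
have [W hW] := production_window c_ge0 hR1 hgam hS1 hS2 hS4 mu_Gibbs cs s2 e0.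
exists W => L WL m sm hm; apply: le_trans (hW L WL m sm hm) _.
rewrite big1 ?subr0 // => xi _; rewrite rgain0; exact: state0.
Qed.

(** Only one transition is tilted, all others being bounded by an arbitrarily small amount.
    Translating [y] to the origin turns [D] into a member of [active0]; the factor 1 / |D| is the
    weight with which an interior site counts this volume. *)
Lemma rate_bound_rgain D (xi : {ffun D -> spin q}) y (s : Omega -> R) e :
  y \in D -> (0 < rate_sup c D)%E -> continuous s ->
  (forall w, `|s w| <= 1 / 2) -> 0 < e ->
  exists k0 : nat, forall k, (k0 <= k)%N ->
    forall m, state m -> half_dominates mu m -> tinv m ->
    m (Lop c (fun w => ln (dens mu m (box d k) w))) <=
      #|` box d k|%:R * (e - m (rgain c gam xi s) / #|` D|%:R).
Proof.
move=> yD cD cs s2 e0; pose D0 := fshift (- y) D.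
pose A D' := if D' == D0 then rgain c gam xi s else fun=> 0.
have D0r : D0 \in active0 c.
  apply/active0P => //; split; first by rewrite mem_fshift opprK add0r.
  exact: rate_sup_shift.
have crg := rgain_cont hR1 hgam hS1 hS2 hS4 (xi := xi) cs.
have cA D' : continuous (A D').
  by rewrite /A; case: ifP => _; [exact: crg|exact: cont_cst].
have fb : folner R (box d) by split; [exact: box_gt0|move=> *; exact: folner_box].
have I_stat := I_Lop c_ge0 hR1 hR2 hR4 hP hPc mu_stat.
have I_tinv : tinv I := pstate_tinv mu_inv.
have hA D' e' : D' \in active0 c -> 0 < e' ->
    exists W, forall L, (W `<=` L)%fset -> forall m, state m -> half_dominates mu m ->
      tinv m -> production c mu D' L m <= e' - m (A D').
  move=> _ e'0; rewrite /A; have [->|D'D0] := eqVneq D' D0; last first.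
    have [W hW] := production_window0 D' e'0; exists W => L WL m sm hm _.
    by rewrite (state0 sm) subr0; exact: hW.
  pose s' (xi' : {ffun D -> spin q}) : Omega -> R := if xi' == xi then s else fun=> 0.
  have cs' xi' : continuous (s' xi').
    by rewrite /s'; case: ifP => _; [exact: cs|exact: cont_cst].
  have s2' xi' w : `|s' xi' w| <= 1 / 2.
    by rewrite /s'; case: ifP => _; rewrite ?normr0 ?divr_ge0.
  have [W hW] := production_window c_ge0 hR1 hgam hS1 hS2 hS4 mu_Gibbs cs' s2' e'0.
  exists (fshift (- y) W) => L WL m sm hm tm.
  have WL' : (W `<=` fshift y L)%fset.
    apply/fsubsetP => x xW; rewrite mem_fshift.
    by move/fsubsetP: WL; apply; rewrite mem_fshift opprK subrK.
  have -> : production c mu D0 L m = production c mu D (fshift y L) m.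
    have := production_tau hR1 hR4 D0 (fshift y L) y sm tm I_tinv.
    by rewrite /D0 fshiftVK fshiftK.
  apply: le_trans (hW _ WL' m sm hm) _.
  rewrite (bigD1 xi) //= big1 ?addr0 ?/s' ?eqxx // => xi' /negbTE ->.
  by rewrite rgain0; exact: state0.
have [k0 hk0] := rate_bound c_ge0 hR1 hR2 hR4 hgam hS1 hS2 hS4 mu_Gibbs
  I_stat I_tinv fb cA hA e0.
exists k0 => k k0k m sm hm tm; apply: le_trans (hk0 k k0k m sm hm tm) _.
rewrite ler_wpM2l // lerD2l lerN2 (big_fsetD1 D0) //= big1_fset.
  by rewrite addr0 /A eqxx card_fshift.
move=> D'; rewrite !inE => /andP[D'D0 _] _.
by rewrite /A (negbTE D'D0) (state0 sm) mul0r.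
Qed.

(** With no tilt at all, the entropy of large boxes grows by at most a small amount per site: this
    covers the times between two visits near the limit point. *)
Lemma rate_bound0 e : 0 < e ->
  exists k0 : nat, forall k, (k0 <= k)%N ->
    forall m, state m -> half_dominates mu m -> tinv m ->
    m (Lop c (fun w => ln (dens mu m (box d k) w))) <= #|` box d k|%:R * e.
Proof.
move=> e0.
have fb : folner R (box d) by split; [exact: box_gt0|move=> *; exact: folner_box].
have I_stat := I_Lop c_ge0 hR1 hR2 hR4 hP hPc mu_stat.
have I_tinv : tinv I := pstate_tinv mu_inv.
have [k0 hk0] := @rate_bound _ _ _ _ c_ge0 hR1 hR2 hR4 _ hgam hS1 hS2 hS4 _ mu_Gibbs
  I_stat I_tinv _ (fun _ _ => 0) fb (fun D => @cont_cst R q d 0)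
  ltac:(by move=> D e' _ e'0; have [W hW] := production_window0 D e'0; exists W => L WL m sm hm _;
    rewrite (state0 sm) subr0; exact: hW) _ e0.
exists k0 => k k0k m sm hm tm; apply: le_trans (hk0 k k0k m sm hm tm) _.
by rewrite ler_wpM2l // big1 ?subr0 // => D _; rewrite (state0 sm) mul0r.
Qed.

Variables (nu_ : R -> probability Omega R).
Hypothesis hnu_ : forall t : R, 0 <= t -> evolves P t nu (nu_ t).
Variables (t_ : nat -> R) (nustar : probability Omega R).
Hypotheses (t_ge0 : forall n, 0 <= t_ n) (t_oo : t_ n @[n --> \oo] --> +oo).
Hypothesis nu_cvg : weak_cvg (fun n => nu_ (t_ n)) nustar.

Local Notation evt := (evo P mu nu).

Definition mixed F : R := (pstate nustar F + I F) / 2.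

Lemma evo_cvg F e : continuous F -> 0 < e ->
  \forall n \near \oo, `|mixed F - evt (t_ n) F| <= e.
Proof.
move=> cF e0; have h := nu_cvg cF.
have ns1 : nustar setT = 1%E := probability_setT nustar.
have {}h : pstate (nu_ (t_ n)) F @[n --> \oo] --> pstate nustar F.
  apply: fine_cvg; rewrite (pstate_fin ns1 cF) in h; exact: h.
have e2 : 0 < e * 2 by rewrite mulr_gt0.
move/cvgrPdist_le : h => /(_ _ e2); apply: filterS => n hn.
have e1 : pstate (nu_ (t_ n)) F = pstate nu (P (t_ n) F).
  have n1 : nu_ (t_ n) setT = 1%E := probability_setT _.
  have nu1 : nu setT = 1%E := probability_setT _.
  have [] : (pstate (nu_ (t_ n)) F)%:E = (pstate nu (P (t_ n) F))%:E => //.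
  rewrite -(pstate_fin n1 cF) -(pstate_fin nu1 (P_cont hP (t_ge0 n) cF)).
  exact: (hnu_ (t_ge0 n) cF).
rewrite e1 in hn; rewrite /mixed /evo -mulrBl normrM (gtr0_norm (x := 2^-1)) ?invr_gt0 //.
by rewrite ler_pdivrMr // opprD addrACA subrr addr0.
Qed.

Lemma mixed_state : state mixed.
Proof.
have sN : state (pstate nustar) := pstateP (probability_setT nustar).
split=> [a F G cF cG|F cF F0|].
- by rewrite /mixed (state_lin sN) // (state_lin sI) //; field.
- by rewrite /mixed divr_ge0 // addr_ge0 //; [exact: (state_ge0 sN)|exact: (state_ge0 sI)].
- by rewrite /mixed (state1 sN) (state1 sI) divff.
Qed.

Lemma mixed_rgain_le0 D (xi : {ffun D -> spin q}) (s : Omega -> R) :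
  continuous s -> (forall w, `|s w| <= 1 / 2) -> mixed (rgain c gam xi s) <= 0.
Proof.
move=> cs s2; have crg := rgain_cont hR1 hgam hS1 hS2 hS4 (xi := xi) cs.
have [[y yD]|D0] := pselect (exists y, y \in D); last first.
  apply: (state_bound mixed_state) => // w.
  have gl (a : {ffun D -> spin q}) w' : glue a w' = w'.
    by apply/funext => x; apply: glueE; apply/negP => xD; apply: D0; exists x.
  have rd : rdefect c gam xi s w = 0.
    rewrite /rdefect /push /gint /ind.
    have -> : (restr D w == xi) = true.
      by apply/eqP; rewrite -(gl xi w) restr_glue.
    rewrite mul1r (bigD1 xi) //= big1 ?addr0 ?gl => [|a /eqP ax].
      by rewrite mulrAC divff ?mul1r ?subrr // gt_eqF // gcond_gt0.
    by exfalso; apply: ax; rewrite -(restr_glue a w) gl -{1}(gl xi w) restr_glue.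
  rewrite /rgain rd sub0r oppr_le0; apply: mulr_ge0 => //.
  by apply: mulr_ge0; [exact: c_ge0|exact: sqr_ge0].
have [cD|cD] := pselect (0 < rate_sup c D)%E; last first.
  have c0 w : c D w xi = 0 by exact: rate_eq0.
  apply: (state_bound mixed_state) => // w.
  rewrite /rgain /rdefect c0 !mul0r mulr0 !subr0 /push /gint big1 ?mulr0 ?mul0r //.
  by move=> a _; rewrite c0 mul0r mulr0.
rewrite leNgt; apply/negP => g0.
set G := rgain c gam xi s in crg g0; set g := mixed G in g0.
(* Of the value [g], one quarter is lost to weak convergence and one to the evolution during [tau];
   the remaining half exceeds [beta] times |D|. *)
have g4 : 0 < g / 4 by rewrite divr_gt0.
have [tau tau0 hPG] := P_cont0 hP crg g4.
pose tau' := tau / 2; have tau'0 : 0 < tau' by rewrite divr_gt0.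
have tautau : tau' < tau by rewrite ltr_pdivrMr // ltr_pMr // ltr1n.
have Dn : 0 < #|` D|%:R :> R.
  by rewrite ltr0n cardfs_gt0; apply/fset0Pn; exists y.
pose beta := g / 4 / #|` D|%:R.
have beta0 : 0 < beta by rewrite divr_gt0.
have [C C0 hC] := rel_entropy_le hgam hS1 hS2 hS4 mu_Gibbs.
have hGt n t : `|mixed G - evt (t_ n) G| <= g / 4 -> t_ n <= t <= t_ n + tau' ->
    beta <= evt t G / #|` D|%:R.
  move=> hn /andP[t1 t2]; rewrite /beta ler_pM2r ?invr_gt0 //.
  have t3 : 0 <= t - t_ n by rewrite subr_ge0.
  have -> : evt t G = evt (t_ n) (P (t - t_ n) G).
    by rewrite -(evoD hP mu_stat nu (t_ge0 n) t3 crg) subrKC.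
  have sm := evo_state hP mu nu (t_ge0 n).
  have t4 : t - t_ n < tau by apply: le_lt_trans tautau; rewrite lerBlDl.
  have := state_close sm (P_cont hP t3 crg) crg (hPG _ t3 t4).
  move: hn; rewrite -/g !ler_norml => /andP[h1 h2] /andP[h3 h4].
  have : g = g / 4 + g / 4 + g / 4 + g / 4 by field.
  by move: h2 h3; move: (evt _ _) (evt _ _) (g / 4) => a b x; lra.
(* After [N] visits near the limit point the bound on the entropy per site has dropped by
   [N%:R * (tau' * beta)]. The time [T] is fixed before [e] and the box, so the errors can be made
   small afterwards. *)
have claim N : exists2 T, 0 <= T & forall e, 0 < e -> exists k0 : nat,
    forall k, (k0 <= k)%N -> rel_entropy mu (box d k) (evt T) <=
      #|` box d k|%:R * (C + e - N%:R * (tau' * beta)).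
  elim: N => [|N [T T0 IH]].
    exists 0 => // e e0; exists 0%N => k _; rewrite mul0r subr0 mulrC.
    apply: le_trans (hC _ _ (evo_state hP mu nu (lexx 0))
      (evo_half_dominates hP mu nu (lexx 0))) _.
    by rewrite ler_wpM2r // lerDl ltW.
  have [n0 _ hn0] := evo_cvg crg g4.
  have [n1 _ hn1] := (iffLR (cvgryPge _) t_oo) T.
  pose n := maxn n0 n1.
  have hn : `|mixed G - evt (t_ n) G| <= g / 4 by apply: hn0; rewrite /= leq_maxl.
  have Tn : T <= t_ n by apply: hn1; rewrite /= leq_maxr.
  exists (t_ n + tau'); first by rewrite addr_ge0 // ltW.
  (* The three parts of [e] pay for the bound at time [T], the interval from [T] to [t_ n], and the
     visit of length [tau']. *)
  move=> e e0; have e3 : 0 < e / 3 by rewrite divr_gt0.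
  have Tn1 : 0 < t_ n - T + 1 by rewrite ltr_wpDl // subr_ge0.
  have ea : 0 < e / 3 / (t_ n - T + 1) by rewrite divr_gt0.
  have eb : 0 < e / 3 / tau' by rewrite divr_gt0.
  have [k1 hk1] := IH _ e3.
  have [k2 hk2] := rate_bound0 ea.
  have [k3 hk3] := rate_bound_rgain xi yD cD cs s2 eb.
  exists (maxn k1 (maxn k2 k3)) => k; rewrite !geq_max => /and3P[kk1 kk2 kk3].
  set nk : R := #|` box d k|%:R; have nk0 : 0 <= nk by rewrite /nk ler0n.
  have s1 : rel_entropy mu (box d k) (evt (t_ n)) <=
      rel_entropy mu (box d k) (evt T) + (t_ n - T) * (nk * (e / 3 / (t_ n - T + 1))).
    have Tn0 : 0 <= t_ n - T by rewrite subr_ge0.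
    have := @rel_entropy_interval _ _ _ _ c_ge0 hR1 hR2 hR4 _ hP hPc _ hgam hS1 hS2 hS4 _ mu_stat
      mu_Gibbs nu (box d k) (nk * (e / 3 / (t_ n - T + 1))) T (t_ n - T) T0 Tn0.
    rewrite subrKC; apply => t /andP[Tt _]; have t0 := le_trans T0 Tt.
    apply: hk2 => //; [exact: evo_state|exact: evo_half_dominates|exact: (evo_tinv c_ge0)].
  have s2' : rel_entropy mu (box d k) (evt (t_ n + tau')) <=
      rel_entropy mu (box d k) (evt (t_ n)) + tau' * (nk * (e / 3 / tau' - beta)).
    apply: (@rel_entropy_interval _ _ _ _ c_ge0 hR1 hR2 hR4 _ hP hPc _ hgam hS1 hS2 hS4 _ mu_stat
      mu_Gibbs nu (box d k) _ (t_ n) tau' (t_ge0 n) (ltW tau'0)) => t tt.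
    have t0 : 0 <= t by case/andP: tt => h _; exact: le_trans (t_ge0 n) h.
    apply: le_trans (hk3 k kk3 _ (evo_state hP mu nu t0) (evo_half_dominates hP mu nu t0)
      (evo_tinv c_ge0 hR1 hR2 hR4 hP hPc mu_inv nu_inv t0)) _.
    by rewrite ler_wpM2l // lerD2l lerN2; exact: hGt hn tt.
  have s3 := hk1 k kk1; rewrite -/nk in s3.
  have s4 : (t_ n - T) * (nk * (e / 3 / (t_ n - T + 1))) <= nk * (e / 3).
    rewrite mulrCA ler_wpM2l // mulrCA ger_pMr // ler_pdivrMr // mul1r.
    by rewrite lerDl.
  apply: le_trans s2' _; apply: le_trans (lerD s1 (lexx _)) _.
  apply: le_trans (lerD (lerD s3 s4) (lexx _)) _.
  have -> : tau' * (nk * (e / 3 / tau' - beta)) = nk * (e / 3 - tau' * beta).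
    by field; rewrite gt_eqF.
  rewrite -!mulrDr ler_wpM2l // -natr1.
  by rewrite le_eqVlt; apply/orP; left; apply/eqP; field.
have tb0 : 0 < tau' * beta by rewrite mulr_gt0.
(* So many visits use up more than [C + 1] per site, against an initial entropy of at most [C] per
   site and a total error of 1. *)
pose N := (Num.truncn ((C + 1) / (tau' * beta))).+1.
have hN : C + 1 < N%:R * (tau' * beta).
  by rewrite -ltr_pdivrMr // /N truncnS_gt.
have [T T0 hT] := claim N.
have [k0 hk0] := hT 1 ltr01.
have := hk0 k0 (leqnn _).
have := rel_entropy_ge0 hgam hS1 hS2 hS4 mu_Gibbs (box d k0)
  (evo_state hP mu nu T0) (evo_half_dominates hP mu nu T0).
move=> h1 /(le_trans h1); rewrite leNgt => /negP; apply.
rewrite pmulr_rlt0; first by rewrite subr_lt0.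
by rewrite ltr0n box_gt0.
Qed.

End attractor.

(** * From transitions to arbitrary spin changes *)

Section transport.
Variables (R : realType) (q d : nat).
Local Notation Omega := (config q (site d)).
Implicit Types (F G u v g : Omega -> R) (L W D : {fset site d}).
Variable c : rates R q d.
Arguments c : clear implicits.
Hypotheses (hR1 : R1 c) (hR6 : R6 c).
Variables (gam : kernels R q d) (hgam : specification gam).
Hypotheses (hS1 : S1 gam) (hS2 : S2 gam) (hS4 : S4 gam).
Variables (mu : probability Omega R) (mu_Gibbs : Gibbs gam mu).

Let I := pstate mu.
Let sI : state I := pstateP (probability_setT mu).

Variables (N : (Omega -> R) -> R) (sN : state N).
Hypothesis N_rdefect : forall D (xi : {ffun D -> spin q}) g, continuous g ->
  N (rdefect c gam xi g) = 0.

Definition finitary (V : {fset site d}) (T : Omega -> Omega) : Prop :=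
  (forall w x, x \notin V -> T w x = w x) /\
  (forall (W : {fset site d}) w w', restr W w = restr W w' -> restr W (T w) = restr W (T w')).

Lemma finitary_cont V T F : finitary V T -> continuous F ->
  continuous (fun w => F (T w)).
Proof. by move=> [_ hT]; apply: cont_map => W; exists W => w w'; exact: hT. Qed.

Lemma push_rate D (xi : {ffun D -> spin q}) g : continuous g ->
  N (push gam xi (fun w => c D w xi * g w)) = N (fun w => c D w xi * g w).
Proof.
move=> cg; apply/eqP; rewrite -subr_eq0 -(stateB sN).
- by apply/eqP; exact: N_rdefect.
- by apply: push_cont => //; apply: cont_mul => //; exact: hR1.
- by apply: cont_mul => //; exact: hR1.
Qed.

(* mu has full support, so the density in push_dual is determined everywhere. *)
Lemma push_ext_dual D (xi : {ffun D -> spin q}) u u' :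
  continuous u -> continuous u' ->
  (forall v, continuous v -> I (fun w => u' w * v w) = I (fun w => u w * v (glue xi w))) ->
  u' = push gam xi u.
Proof.
move=> cu cu' h; have ct : continuous (push gam xi u) by apply: push_cont.
pose z w := u' w - push gam xi u w.
have cz : continuous z by exact: cont_sub.
have zz : I (fun w => z w * z w) = 0.
  have -> : (fun w => z w * z w) = (fun w => u' w * z w - push gam xi u w * z w).
    by apply/funext => w; rewrite -mulrBl.
  rewrite (stateB sI); [|exact: cont_mul..].
  have e : I (fun w => u w * z (glue xi w)) = I (fun w => push gam xi u w * z w).
    exact: (push_dual hgam hS1 hS2 hS4 mu_Gibbs xi cu cz).
  by rewrite h // e subrr.
have z0 := Gibbs_full_support hgam hS1 hS2 hS4 mu_Gibbs cz zz.
by apply/funext => w; apply/eqP; rewrite -subr_eq0; apply/eqP; rewrite -/(z w) z0.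
Qed.

(** Composes the change of variables along a path of allowed transitions. A rate that is positive on
    the path may vanish elsewhere, hence [u] is supported in a cylinder around the start. [u'] is
    the density of the image of u mu under [T]; its support is tracked because the next rate must be
    bounded below there. *)
Lemma path_transport n (s : nat -> Omega) :
  (forall i, (i < n)%N -> pos_transition c (s i) (s i.+1)) ->
  exists V T W, [/\ finitary V T, T (s 0%N) = s n &
    forall u, continuous u -> (forall w, u w != 0 -> restr W w = restr W (s 0%N)) ->
    exists u', [/\ continuous u', N u' = N u,
      forall v, continuous v -> I (fun w => u' w * v w) = I (fun w => u w * v (T w)) &
      forall w, u' w != 0 -> exists2 w0, u w0 != 0 & w = T w0]].
Proof.
elim: n => [_|n IH hs].
  exists fset0, id, fset0; split=> // u cu _; exists u; split=> // w uw.
  by exists w.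
have [|V [T [W [fT Tn hT]]]] := IH; first by move=> i i_n; apply: hs; exact: ltnW.
have [D [xi [sn cpos]]] := hs n (ltnSn n).
have cF := finitary_cont fT (@hR1 D xi).
(* Half of the rate on the path: the window [W'] keeps the oscillation below [a], so the rate stays
   at least [a]. *)
pose a := c D (T (s 0%N)) xi / 2.
have a0 : 0 < a by rewrite /a Tn divr_gt0.
have [W' hW'] := (iffLR (continuous_qlocP _) cF) a a0.
exists (V `|` D)%fset, (fun w => glue xi (T w)), (W `|` W')%fset; split.
- split=> [w x|U w w' /(fT.2 U)]; last exact: restr_glue_eq.
  by rewrite inE negb_or => /andP[xV xD]; rewrite glueE // fT.1.
- by rewrite Tn.
move=> u cu hu.
have [w uw|u' [cu' Nu' Iu' su']] := hT u cu.
  by apply: restr_sub (hu w uw); exact: fsubsetUl.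
(* The maximum of the rate and [a]: the quotient of [u'] by it is continuous everywhere, and on the
   support of [u'] it is the quotient by the rate itself. *)
pose mx w := (c D w xi + a + `|c D w xi - a|) / 2.
have mx_a w : a <= mx w.
  rewrite /mx ler_pdivlMr //; have := ler_norm (- (c D w xi - a)); rewrite normrN; lra.
have cmx : continuous mx.
  apply: cont_mul; last exact: cont_cst.
  apply: cont_add.
    by apply: cont_add; [exact: hR1|exact: cont_cst].
  by apply: cont_norm; apply: cont_sub; [exact: hR1|exact: cont_cst].
have cg : continuous (fun w => u' w * (mx w)^-1).
  apply: cont_mul => //; apply: cont_inv => // w.
  by rewrite gt_eqF // (lt_le_trans a0).
have ug : u' = fun w => c D w xi * (u' w * (mx w)^-1).
  apply/funext => w; have [->|u'w] := eqVneq (u' w) 0; first by rewrite mul0r mulr0.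
  have [w0 uw0 e] := su' w u'w.
  have ca : a <= c D w xi.
    have r0 : restr W' w0 = restr W' (s 0%N).
      by apply: restr_sub (hu w0 uw0); exact: fsubsetUr.
    have := hW' _ _ r0; rewrite -e /a ler_norml => /andP[h _].
    by move: h; rewrite /a; lra.
  have -> : mx w = c D w xi.
    by rewrite /mx ger0_norm ?subr_ge0 //; field.
  by field; rewrite gt_eqF // (lt_le_trans a0).
exists (push gam xi u'); split.
- by apply: push_cont.
- by rewrite {1}ug push_rate // -ug.
- move=> v cv; have e2 := Iu' _ (cont_glue (xi := xi) cv).
  have e : I (fun w => u' w * v (glue xi w)) = I (fun w => push gam xi u' w * v w).
    exact: (push_dual hgam hS1 hS2 hS4 mu_Gibbs xi cu' cv).
  by rewrite -e e2.
move=> w; rewrite /push /ind; have [e|_] := eqVneq (restr D w) xi; last first.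
  by rewrite mulr0n !mul0r eqxx.
rewrite mulr1n mul1r mulf_eq0 negb_or => /andP[gw _].
have [b ub] : exists b : {ffun D -> spin q}, u' (glue b w) != 0.
  apply: contrapT => nb; move/eqP: gw; apply.
  rewrite /gint big1 // => b _.
  have [->|ub] := eqVneq (u' (glue b w)) 0; first by rewrite mulr0.
  by exfalso; apply: nb; exists b.
have [w0 uw0 e0] := su' _ ub; exists w0 => //.
by rewrite -e0 glue_glue -e glue_restr.
Qed.

(** On a small enough cylinder around [eta] the map [T] along a path from [R6] coincides with
    [glue xi]: outside [V] and [L] both change nothing, inside them the result is determined by the
    window. Uniqueness of the density then identifies [u'] with [push gam xi u]. *)
Lemma local_transport L (xi : {ffun L -> spin q}) (eta : Omega) :
  exists W, forall u, continuous u ->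
    (forall w, u w != 0 -> restr W w = restr W eta) -> N (push gam xi u) = N u.
Proof.
have [n [s [s0 sn hs]]] := hR6 eta xi.
have [V [T [W [fT Tn hT]]]] := path_transport hs.
exists (W `|` (V `|` L))%fset => u cu hu.
have [w uw|u' [cu' Nu' Iu' su']] := hT u cu.
  by rewrite s0; apply: restr_sub (hu w uw); exact: fsubsetUl.
rewrite -Nu'; congr N; apply/esym/push_ext_dual => // v cv.
rewrite Iu' //; congr (I _); apply/funext => w.
have [->|uw] := eqVneq (u w) 0; first by rewrite !mul0r.
congr (_ * v _); apply/funext => x.
have hw := restr_sub (fsubsetUr _ _) (hu w uw).
have [xVL|] := boolP (x \in (V `|` L)%fset); last first.
  by rewrite inE negb_or => /andP[xV xL]; rewrite fT.1 // glueE.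
have /restr_eqP -> // := fT.2 _ _ _ hw.
rewrite -s0 Tn sn.
by have /restr_eqP -> := restr_glue_eq xi hw.
Qed.

(** The windows of [local_transport] depend on the starting configuration; compactness gives one
    window for all, and [u] is cut into pieces supported in its cylinders. *)
Lemma push_invariant L (xi : {ffun L -> spin q}) u : continuous u ->
  N (push gam xi u) = N u.
Proof.
move=> cu; have /choice[Wf hWf] := local_transport xi.
have [|W hW] := @cylinder_cover q d (fun eta => [set w | restr (Wf eta) w = restr (Wf eta) eta]).
  by move=> w; apply/nbhs_cylP; exists (Wf w).
have uE : u = fun w => \sum_(a : {ffun W -> spin q}) u w * ind R a w.
  by apply/funext => w; rewrite (sum_ind (fun=> u w)).
have cua (a : {ffun W -> spin q}) : continuous (fun w => u w * ind R a w).
  by apply: cont_mul => //; exact: ind_cont.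
have pushE : push gam xi u = fun w =>
    \sum_(a : {ffun W -> spin q}) push gam xi (fun w => u w * ind R a w) w.
  apply/funext => w; rewrite /push.
  have -> : gint gam L u w = \sum_(a : {ffun W -> spin q})
      gint gam L (fun w => u w * ind R a w) w.
    by rewrite {1}uE (state_sum (gint_state gam L w)).
  by rewrite mulr_sumr mulr_suml.
rewrite pushE (state_sum sN) => [|a _]; last by apply: push_cont.
rewrite [in RHS]uE (state_sum sN) //; apply: eq_bigr => a _.
have [w0 hw0] := hW (glue a point).
apply: (hWf w0) => // w; rewrite mulf_eq0 negb_or => /andP[_ aw].
apply: hw0; rewrite restr_glue; move: aw; rewrite /ind.
by have [->|_] := eqVneq (restr W w) a; rewrite ?mulr0n ?eqxx.
Qed.

(** [push gam xi] sends [gcond gam xi] to the indicator of [xi], so the Gibbs equation is one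
    instance of invariance. *)
Lemma invariant_Gibbs L (xi : {ffun L -> spin q}) : N (gcond gam xi) = N (ind R xi).
Proof.
rewrite -(push_invariant xi); last exact: gcond_cont.
congr N; apply/funext => w; rewrite /push.
have -> : gint gam L (gcond gam xi) w = gcond gam xi w.
  rewrite /gint; under eq_bigr do rewrite gcond_glue.
  by rewrite -mulr_suml gcond_sum mul1r.
by rewrite mulfK // gt_eqF // gcond_gt0.
Qed.

End transport.

Theorem theorem2p10 (R : realType) (q d : nat) (hq : (0 < q)%N)
  (c : rates R q d) (c_ge0 : nonneg_rates c)
  (hR1 : R1 c) (hR2 : R2 c) (hR3 : R3 c) (hR4 : R4 c) (hR5 : R5 c) (hR6 : R6 c)
  (P : R -> (config q (site d) -> R) -> (config q (site d) -> R))
  (hP : markov_semigroup P) (hPc : generated_by P c)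
  (gam : kernels R q d) (hgam : specification gam)
  (hS1 : S1 gam) (hS2 : S2 gam) (hS3 : S3 gam c) (hS4 : S4 gam)
  (mu : probability (config q (site d)) R)
  (mu_inv : translation_invariant mu) (mu_stat : time_stationary P mu)
  (mu_Gibbs : Gibbs gam mu)
  (nu : probability (config q (site d)) R) (nu_inv : translation_invariant nu)
  (nu_ : R -> probability (config q (site d)) R)
  (hnu_ : forall t : R, 0 <= t -> evolves P t nu (nu_ t))
  (t_ : nat -> R) (t_ge0 : forall n, 0 <= t_ n)
  (t_incr : nondecreasing_seq t_) (t_oo : t_ n @[n --> \oo] --> +oo)
  (nustar : probability (config q (site d)) R)
  (nu_cvg : weak_cvg (fun n => nu_ (t_ n)) nustar) :
  Gibbs gam nustar.
Proof.
pose I := pstate mu; pose N := pstate nustar.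
have ns1 : nustar setT = 1%E := probability_setT nustar.
have sI : state I := pstateP (probability_setT mu).
have sN : state N := pstateP ns1.
pose m := mixed mu nustar.
have sm : state m := mixed_state mu nustar.
have le0 (D : {fset site d}) (xi : {ffun D -> spin q}) g : continuous g ->
    m (rdefect c gam xi g) <= 0.
  move=> cg; have [M M0 hM] := continuous_bounded cg.
  have crd := rdefect_cont hR1 hgam hS1 hS2 hS4 (xi := xi) cg.
  have ccgg := css_cont hR1 (xi := xi) cg.
  set K := m (fun w => c D w xi * g w ^+ 2).
  have K0 : 0 <= K.
    by apply: (state_ge0 sm) => // w; apply: mulr_ge0; [exact: c_ge0|exact: sqr_ge0].
  apply/ler_addgt0Pr => e e0; rewrite add0r.
  (* The first bound makes [th * g] admissible as a tilt; the second makes the quadratic price,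
     after division by [th], at most [e]. *)
  pose th := Num.min (1 / 2 / (M + 1)) (e / 2 / (K + 1)).
  have th0 : 0 < th by rewrite lt_min !divr_gt0 // ltr_wpDl.
  have th1 : th <= 1 / 2 / (M + 1) by rewrite ge_min lexx.
  have th2 : th <= e / 2 / (K + 1) by rewrite ge_min lexx orbT.
  have cs : continuous (fun w => th * g w) by apply: cont_mul => //; exact: cont_cst.
  have s2 w : `|th * g w| <= 1 / 2.
    rewrite normrM gtr0_norm //; apply: (@le_trans _ _ (th * (M + 1))).
      by rewrite ler_pM2l // (le_trans (hM w)) // lerDl.
    by rewrite -ler_pdivlMr // ltr_wpDl.
  have := mixed_rgain_le0 c_ge0 hR1 hR2 hR4 hP hPc hgam hS1 hS2 hS4 mu_inv
    mu_stat mu_Gibbs nu_inv hnu_ t_ge0 t_oo nu_cvg xi cs s2.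
  have -> : rgain c gam xi (fun w => th * g w) = fun w =>
      th * rdefect c gam xi g w - (2 * th ^+ 2) * (c D w xi * g w ^+ 2).
    apply/funext => w; rewrite /rgain /rdefect /push.
    have -> : gint gam D (fun w => c D w xi * (th * g w)) w =
        th * gint gam D (fun w => c D w xi * g w) w.
      by rewrite /gint mulr_sumr; apply: eq_bigr => a _; ring.
    by ring.
  rewrite -/m (stateB sm); last 2 first.
  - by apply: cont_mul => //; exact: cont_cst.
  - by apply: cont_mul => //; exact: cont_cst.
  rewrite (stateZ sm) // (stateZ sm) // -/K subr_le0 expr2 mulrA [2 * th]mulrC -!mulrA.
  rewrite ler_pM2l // => /le_trans; apply.
  rewrite mulrCA; apply: (@le_trans _ _ (e / 2 / (K + 1) * (2 * K))).
    by rewrite ler_wpM2r // mulr_ge0.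
  rewrite mulrAC ler_pdivrMr ?ltr_wpDl // mulrA divfK // ler_pM2l // lerDl //.
have eq0 (D : {fset site d}) (xi : {ffun D -> spin q}) g : continuous g -> N (rdefect c gam xi g) = 0.
  move=> cg; have crd := rdefect_cont hR1 hgam hS1 hS2 hS4 (xi := xi) cg.
  have h1 := le0 D xi g cg.
  (* The defect is linear in its test function, so [- g] gives the opposite inequality. *)
  have := le0 D xi (fun w => - g w) (cont_opp cg).
  have -> : rdefect c gam xi (fun w => - g w) = fun w => - rdefect c gam xi g w.
    apply/funext => w; rewrite /rdefect /push.
    have -> : gint gam D (fun w => c D w xi * - g w) w =
        - gint gam D (fun w => c D w xi * g w) w.
      by rewrite /gint -sumrN; apply: eq_bigr => a _; ring.
    by ring.
  rewrite (stateN sm) // oppr_le0 => h2.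
  have m0 : m (rdefect c gam xi g) = 0 by apply/eqP; rewrite eq_le h1.
  (* For [mu] the defect has mean 0 by [push_dual] with v = 1, so the vanishing for the mixture
     passes to [nustar]. *)
  have I0 : I (rdefect c gam xi g) = 0.
    have cu : continuous (fun w => c D w xi * g w).
      by apply: cont_mul => //; exact: hR1.
    have ct : continuous (push gam xi (fun w => c D w xi * g w)) by apply: push_cont.
    rewrite /rdefect (stateB sI) //.
    have c1 := @cont_cst R q d 1.
    have := push_dual hgam hS1 hS2 hS4 mu_Gibbs xi cu c1.
    have -> : (fun w => c D w xi * g w * 1) = (fun w => c D w xi * g w).
      by apply/funext => w; rewrite mulr1.
    have -> : (fun w => push gam xi (fun w => c D w xi * g w) w * 1) =
        push gam xi (fun w => c D w xi * g w).
      by apply/funext => w; rewrite mulr1.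
    by rewrite -/I => ->; rewrite subrr.
  move: m0; rewrite /m /mixed -/I -/N I0 addr0 => /eqP.
  by rewrite mulf_eq0 invr_eq0 pnatr_eq0 orbF => /eqP.
move=> L xi.
have h := invariant_Gibbs hR1 hR6 hgam hS1 hS2 hS4 mu_Gibbs sN eq0 xi.
have e1 : nustar (cyl xi) = (N (ind R xi))%:E := pstate_ind ns1 xi.
rewrite e1 -h -(pstate_fin ns1); last exact: gcond_cont.
by apply: eq_integral => w _; rewrite gcond_EFin.
Qed.
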